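(* The frame cylinder of a force-free strip is Willmore in $S^3$: if $\gamma$ is a Frenet curve in $\mathbb{R}^3$ defining a force-free strip, with tangent image $T:[0,\tilde L]\to S^2$ parametrized by arclength, then the frame cylinder $F:[0,\tilde L]\times S^1\to S^3$ is a Willmore surface in $S^3$.
   Context: All curves are smooth ($C^\infty$). A Frenet curve is a regular curve $\gamma:[0,L]\to\mathbb{R}^3$ with nowhere vanishing curvature $\kappa$; $\tau$ is its torsion, $\lambda=\tau/\kappa$ its modified torsion, $v=|\gamma'|$, and $T,N,B$ its Frenet frame. For $\mu\in\mathbb{R}$ the modified Sadowsky functional is $S_\mu(\gamma)=\int_0^L(\kappa^2(1+\lambda^2)^2-\mu)v\,dt$. The curve $\gamma$ defines an elastic strip with Lagrange multiplier $\mu$ if it is a critical point of $S_\mu$ under all smooth variations through Frenet curves that are fixed near both end points. An elastic strip is force-free if $b_0=0$, where (in arclength parametrization) $b_0=a_1T+a_2N+a_3B$ with $a_1=\frac12(\kappa^2(1+\lambda^2)^2+\mu)$, $a_2=\kappa'(1+\lambda^2)^2+2\kappa(1+\lambda^2)\lambda\lambda'$, $a_3=-\left(\kappa^2(1+\lambda^2)^2\lambda+\left(\frac{\kappa'}{\kappa}(1+\lambda^2)2\lambda\right)'+\left((1+\lambda^2)2\lambda\right)''\right)$. Frame cylinder: identify $S^3$ (the round unit sphere) with the unit quaternions, the double cover of $SO(3)$, and $\mathbb{R}^3$ with the imaginary quaternions. The Hopf map is $\pi:S^3\to S^2$, $\pi(q)=q\,i\,\bar q$. The frame cylinder of $\gamma$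 is the surface parametrizing all adapted orthonormal frames along $\gamma$ (positively oriented frames whose first vector is the tangent $T$), lifted to $S^3$; i.e. it is the preimage of the tangent image $T$ under the Hopf map, $F:[0,\tilde L]\times S^1\to S^3$ with $F(\{t\}\times S^1)=\pi^{-1}(T(t))$. An immersed surface in $S^3$ is Willmore if it is a critical point of $\int(H^2+1)\,dA$ ($H$ the mean curvature, half the sum of the principal curvatures) under compactly supported variations in the interior. *)

(* Defs.v *)
From Stdlib Require Import Reals Lra.
From Coquelicot Require Import Coquelicot.
Open Scope R_scope.

(** * Smooth maps between normed spaces *)

(* [f] is C^(n+1) when it is Frechet differentiable everywhere, with
   differential [v |-> df v x] at [x], and all its directional derivatives
   [df v] are C^n. *)
Fixpoint Ck {V W : NormedModule R_AbsRing} (n : nat) (f : V -> W) : Prop :=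
  match n with
  | O => forall x : V, continuous f x
  | S m => exists df : V -> V -> W,
      (forall x : V, filterdiff f (locally x) (fun v => df v x)) /\
      (forall v : V, Ck m (df v))
  end.

(* A smooth map on a closed domain such as [0,L] or [0,L] x S^1 is represented
   by a smooth map on the whole space R^k, of which only the restriction to that
   domain matters: all the conditions below are imposed on the domain only.  At
   boundary points the derivatives of the extension are the one-sided
   derivatives of the restriction. *)
Definition smooth {V W : NormedModule R_AbsRing} (f : V -> W) : Prop :=
  forall n : nat, Ck n f.

(** * R^3 *)

Definition R3 := (R * R * R)%type.

Definition zero3 : R3 := (0, 0, 0).

Definition add3 (u w : R3) : R3 :=
  let '(u1, u2, u3) := u in let '(w1, w2, w3) := w in
  (u1 + w1, u2 + w2, u3 + w3).

Definition scal3 (a : R) (u : R3) : R3 :=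
  let '(u1, u2, u3) := u in (a * u1, a * u2, a * u3).

Definition dot3 (u w : R3) : R :=
  let '(u1, u2, u3) := u in let '(w1, w2, w3) := w in
  u1 * w1 + u2 * w2 + u3 * w3.

Definition cross3 (u w : R3) : R3 :=
  let '(u1, u2, u3) := u in let '(w1, w2, w3) := w in
  (u2 * w3 - u3 * w2, u3 * w1 - u1 * w3, u1 * w2 - u2 * w1).

Definition norm3 (u : R3) : R := sqrt (dot3 u u).

Definition Derive3 (f : R -> R3) (t : R) : R3 :=
  (Derive (fun r => fst (fst (f r))) t,
   Derive (fun r => snd (fst (f r))) t,
   Derive (fun r => snd (f r)) t).

(** * Space curves: Frenet apparatus, in an arbitrary regular parametrization *)

Definition speed (g : R -> R3) (t : R) : R := norm3 (Derive3 g t).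

(* derivatives with respect to the arclength of [g] *)
Definition ds (g : R -> R3) (f : R -> R) (t : R) : R := Derive f t / speed g t.

Definition ds3 (g : R -> R3) (f : R -> R3) (t : R) : R3 :=
  scal3 (/ speed g t) (Derive3 f t).

Definition tangent (g : R -> R3) : R -> R3 := ds3 g g.

Definition curvature (g : R -> R3) (t : R) : R := norm3 (ds3 g (tangent g) t).

Definition normal (g : R -> R3) (t : R) : R3 :=
  scal3 (/ curvature g t) (ds3 g (tangent g) t).

Definition binormal (g : R -> R3) (t : R) : R3 :=
  cross3 (tangent g t) (normal g t).

(* sign convention N' = - kappa T + tau B *)
Definition torsion (g : R -> R3) (t : R) : R :=
  dot3 (ds3 g (normal g) t) (binormal g t).

Definition mod_torsion (g : R -> R3) (t : R) : R := torsion g t / curvature g t.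

Definition frenet_on (L : R) (g : R -> R3) : Prop :=
  forall t, 0 <= t <= L -> Derive3 g t <> zero3 /\ curvature g t <> 0.

Definition frenet_curve (L : R) (g : R -> R3) : Prop :=
  smooth g /\ frenet_on L g.

(** * Elastic strips *)

Definition sadowsky (mu L : R) (g : R -> R3) : R :=
  RInt (fun t =>
    ((curvature g t) ^ 2 * (1 + (mod_torsion g t) ^ 2) ^ 2 - mu) * speed g t) 0 L.

(* [G s] is a smooth one-parameter family of Frenet curves, |s| < eps, equal to
   [g] for s = 0 and, for every s, near both end points. *)
Definition frenet_variation (L : R) (g : R -> R3) (G : R -> R -> R3) : Prop :=
  smooth (fun p : R * R => G (fst p) (snd p)) /\
  (forall t, 0 <= t <= L -> G 0 t = g t) /\
  exists eps delta : R, 0 < eps /\ 0 < delta /\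
    forall s, Rabs s < eps ->
      frenet_on L (G s) /\
      (forall t, 0 <= t <= L -> t <= delta \/ L - delta <= t -> G s t = g t).

Definition elastic_strip (mu L : R) (g : R -> R3) : Prop :=
  frenet_curve L g /\
  forall G, frenet_variation L g G ->
    is_derive (fun s => sadowsky mu L (G s)) 0 0.

(* The vector b_0 = a_1 T + a_2 N + a_3 B; a prime in its definition is the
   arclength derivative [ds g]. *)
Definition force (mu : R) (g : R -> R3) (t : R) : R3 :=
  let k := curvature g in
  let l := mod_torsion g in
  let a1 := / 2 * ((k t) ^ 2 * (1 + (l t) ^ 2) ^ 2 + mu) in
  let a2 := ds g k t * (1 + (l t) ^ 2) ^ 2
            + 2 * k t * (1 + (l t) ^ 2) * l t * ds g l t in
  let a3 := - ((k t) ^ 2 * (1 + (l t) ^ 2) ^ 2 * l t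
               + ds g (fun r => ds g k r / k r * (1 + (l r) ^ 2) * (2 * l r)) t
               + ds g (ds g (fun r => (1 + (l r) ^ 2) * (2 * l r))) t) in
  add3 (scal3 a1 (tangent g t))
       (add3 (scal3 a2 (normal g t)) (scal3 a3 (binormal g t))).

Definition force_free_strip (mu L : R) (g : R -> R3) : Prop :=
  elastic_strip mu L g /\ forall t, 0 <= t <= L -> force mu g t = zero3.

(* length on S^2 of the tangent image of [g] from 0 to [t] *)
Definition tangent_arclength (g : R -> R3) (t : R) : R :=
  RInt (fun r => norm3 (Derive3 (tangent g) r)) 0 t.

(* [T : [0,Lt] -> S^2] is the tangent image of [g : [0,L] -> R^3],
   reparametrized by arclength. *)
Definition arclength_tangent_image
    (L : R) (g : R -> R3) (Lt : R) (T : R -> R3) : Prop :=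
  Lt = tangent_arclength g L /\
  forall t, 0 <= t <= L -> T (tangent_arclength g t) = tangent g t.

(** * Quaternions and the Hopf map *)

(* (real part, imaginary part); R^3 is the space of imaginary quaternions *)
Definition quat := (R * (R * R * R))%type.

Definition imq (u : R3) : quat := (0, u).

Definition zeroq : quat := (0, zero3).

Definition addq (p q : quat) : quat := (fst p + fst q, add3 (snd p) (snd q)).

Definition scalq (c : R) (p : quat) : quat := (c * fst p, scal3 c (snd p)).

Definition mulq (p q : quat) : quat :=
  (fst p * fst q - dot3 (snd p) (snd q),
   add3 (add3 (scal3 (fst p) (snd q)) (scal3 (fst q) (snd p)))
        (cross3 (snd p) (snd q))).

Definition conjq (p : quat) : quat := (fst p, scal3 (-1) (snd p)).

Definition dotq (p q : quat) : R := fst p * fst q + dot3 (snd p) (snd q).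

Definition in_S3 (p : quat) : Prop := dotq p p = 1.

Definition hopf (q : quat) : quat := mulq (mulq q (imq (1, 0, 0))) (conjq q).

Definition Deriveq (f : R -> quat) (t : R) : quat :=
  (Derive (fun r => fst (f r)) t, Derive3 (fun r => snd (f r)) t).

(** * Surfaces in S^3 *)

Definition du (f : R -> R -> quat) (u v : R) : quat := Deriveq (fun r => f r v) u.
Definition dv (f : R -> R -> quat) (u v : R) : quat := Deriveq (fun r => f u r) v.

(* triple vector product of R^4, characterized by
   <p, crossq x y z> = det (p, x, y, z) *)
Definition crossq (x y z : quat) : quat :=
  (dot3 (snd x) (cross3 (snd y) (snd z)),
   add3 (scal3 (- fst x) (cross3 (snd y) (snd z)))
        (add3 (scal3 (fst y) (cross3 (snd x) (snd z)))
              (scal3 (- fst z) (cross3 (snd x) (snd y))))).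

Lemma crossq_orthogonal (x y z : quat) :
  dotq x (crossq x y z) = 0 /\ dotq y (crossq x y z) = 0 /\
  dotq z (crossq x y z) = 0.
Proof.
  destruct x as [x0 [[x1 x2] x3]], y as [y0 [[y1 y2] y3]],
    z as [z0 [[z1 z2] z3]].
  unfold dotq, crossq, add3, scal3, cross3, dot3; cbn.
  repeat split; ring.
Qed.

(* unit normal in S^3: orthogonal to the position vector and to both partial
   derivatives *)
Definition unit_normal (f : R -> R -> quat) (u v : R) : quat :=
  let n := crossq (f u v) (du f u v) (dv f u v) in
  scalq (/ sqrt (dotq n n)) n.

Definition first_E (f : R -> R -> quat) (u v : R) : R := dotq (du f u v) (du f u v).
Definition first_F (f : R -> R -> quat) (u v : R) : R := dotq (du f u v) (dv f u v).
Definition first_G (f : R -> R -> quat) (u v : R) : R := dotq (dv f u v) (dv f u v).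

(* The second fundamental form in S^3: the Levi-Civita connection of S^3 differs
   from that of R^4 by a multiple of the position vector, which is orthogonal
   to [unit_normal f]. *)
Definition second_e (f : R -> R -> quat) (u v : R) : R :=
  dotq (du (du f) u v) (unit_normal f u v).
Definition second_f (f : R -> R -> quat) (u v : R) : R :=
  dotq (dv (du f) u v) (unit_normal f u v).
Definition second_g (f : R -> R -> quat) (u v : R) : R :=
  dotq (dv (dv f) u v) (unit_normal f u v).

Definition gram (f : R -> R -> quat) (u v : R) : R :=
  first_E f u v * first_G f u v - (first_F f u v) ^ 2.

(* The principal curvatures are the eigenvalues of the shape operator, whose
   matrix is the inverse of the first fundamental form times the second one;
   [shape11] and [shape22] are its diagonal entries, so that their sum, the
   trace, is the sum of the principal curvatures. *)
Definition shape11 (f : R -> R -> quat) (u v : R) : R :=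
  (first_G f u v * second_e f u v - first_F f u v * second_f f u v) / gram f u v.
Definition shape22 (f : R -> R -> quat) (u v : R) : R :=
  (first_E f u v * second_g f u v - first_F f u v * second_f f u v) / gram f u v.

Definition mean_curvature (f : R -> R -> quat) (u v : R) : R :=
  (shape11 f u v + shape22 f u v) / 2.

Definition area_density (f : R -> R -> quat) (u v : R) : R := sqrt (gram f u v).

(** * Cylinders [0,L] x S^1 -> S^3 *)

(* Functions on S^1 = R / 2 pi Z are 2 pi-periodic functions on R. *)
Definition immersed_cylinder_on (L : R) (f : R -> R -> quat) : Prop :=
  forall u v, 0 <= u <= L ->
    in_S3 (f u v) /\
    f u (v + 2 * PI) = f u v /\
    (forall a b : R,
       addq (scalq a (du f u v)) (scalq b (dv f u v)) = zeroq ->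
       a = 0 /\ b = 0).

Definition immersed_cylinder (L : R) (f : R -> R -> quat) : Prop :=
  smooth (fun p : R * R => f (fst p) (snd p)) /\ immersed_cylinder_on L f.

Definition willmore_energy (L : R) (f : R -> R -> quat) : R :=
  RInt (fun u =>
    RInt (fun v => ((mean_curvature f u v) ^ 2 + 1) * area_density f u v)
      0 (2 * PI)) 0 L.

(* Variations through immersions into S^3, with compact support in the interior
   ]0,L[ x S^1. *)
Definition cylinder_variation
    (L : R) (f : R -> R -> quat) (G : R -> R -> R -> quat) : Prop :=
  smooth (fun p : R * R * R => G (fst (fst p)) (snd (fst p)) (snd p)) /\
  (forall u v, 0 <= u <= L -> G 0 u v = f u v) /\
  exists eps delta : R, 0 < eps /\ 0 < delta /\
    forall s, Rabs s < eps ->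
      immersed_cylinder_on L (G s) /\
      (forall u v, 0 <= u <= L -> u <= delta \/ L - delta <= u ->
         G s u v = f u v).

Definition willmore_cylinder (L : R) (f : R -> R -> quat) : Prop :=
  immersed_cylinder L f /\
  forall G, cylinder_variation L f G ->
    is_derive (fun s => willmore_energy L (G s)) 0 0.

(* [F] parametrizes the frame cylinder of a curve with tangent image
   [T : [0,Lt] -> S^2]: it is a smooth map [0,Lt] x S^1 -> S^3 and each
   [F t : S^1 -> S^3] is a regular parametrization of the Hopf fibre over [T t].
   Regularity of the [F t] is necessary for [F] to be an immersion; it is not
   implied by the equality of [F t (S^1)] and the fibre as sets. *)
Definition frame_cylinder (Lt : R) (T : R -> R3) (F : R -> R -> quat) : Prop :=
  smooth (fun p : R * R => F (fst p) (snd p)) /\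
  forall t, 0 <= t <= Lt ->
    (forall th, F t (th + 2 * PI) = F t th) /\
    (forall th, dv F t th <> zeroq) /\
    (forall q : quat,
       (exists th, F t th = q) <-> (in_S3 q /\ hopf q = imq (T t))).

(* Main.v *)
Require Import Defs.
From Stdlib Require Import Reals Lra Classical ClassicalEpsilon FunctionalExtensionality.
From Coquelicot Require Import Coquelicot.
Open Scope R_scope.

(* Let [T] be the tangent image, parametrized by arclength [u], and [lam] its geodesic
   curvature, which is the modified torsion of [gamma].  For a force-free strip
   [a_1 = 0] makes [kappa (1 + lam^2)] constant, and [a_3 = 0] then becomes the equation
   [lam'' + lam (1 + lam^2) / 2 = 0] of free elastic curves on S^2.

   A family [G s u v] in S^3 is described by the R^3-valued functions
   [al = G_u / G], [be = G_v / G] and [xi = G_s / G] (quaternion quotients), which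
   satisfy [al_v - be_u = -2 al x be], and likewise for the other two pairs; the Willmore
   integrand is a function of [al], [be] and their first derivatives.  On the frame
   cylinder, and in the frame [T, T', T x T'], one has [al = (p, 0, 1/2)] and
   [be = (r, 0, 0)], and for [xi = (a, b, c)] the [s]-derivative of the integrand is a
   divergence plus a multiple of [b (lam'' + lam (1 + lam^2) / 2)].  Hence the first
   variation vanishes, for tangential variations as well. *)

(** Right translation by a unit quaternion is an isometry of S^3, so the metric and the mean
    curvature are expressed by the quotients [al] and [be] and their derivatives, and the position
    of the surface drops out. In the direction x q the Hopf map h = q i conj(q) has derivative x h -
    h x = 2 x × h; the component 1/2 of [al] comes from this factor 2. On the frame cylinder the
    mean curvature is lam up to sign and the integrand is (1 + lam^2) |r| / 2; the equation for lam
    is the Euler-Lagrange equation of the integral of 1 + lam^2 over curves in the unit sphere.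
    Neither the parametrization of the fibres nor the variation is normalized: [p] and [r] are only
    known to satisfy p_v = r_u and r <> 0, and [xi] may have tangential components. Hence one
    explicit identity with a flux takes the place of the Willmore equation for normal variations.
    The data are prescribed on closed intervals and continued arbitrarily. Identities are
    differentiated on the open interval and reach the ends by continuity; [T], not given as smooth,
    is replaced by the Hopf image of the curve u |-> [F u 0]. *)

(** * Closure properties of [Ck] and directional derivatives *)

Lemma Ck_weaken {V W : NormedModule R_AbsRing} (n : nat) (f : V -> W) :
  Ck (S n) f -> Ck n f.
Proof.
  revert f; induction n as [|n IH]; intros f (df & Hd & Hc).
  - intro x; apply filterdiff_continuous; eexists; apply Hd.
  - exists df; split; [exact Hd|].
    intro v; apply IH, Hc.
Qed.

Lemma smooth_const {V W : NormedModule R_AbsRing} (c : W) :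
  smooth (fun _ : V => c).
Proof.
  intro n; revert c; induction n as [|n IH]; intro c.
  - intro x; apply continuous_const.
  - exists (fun _ _ => zero); split; [|intro; apply IH].
    intro x; apply filterdiff_const.
Qed.

Lemma smooth_comp_linear {U V W : NormedModule R_AbsRing} (l : V -> W) (f : U -> V) :
  is_linear l -> smooth f -> smooth (fun x => l (f x)).
Proof.
  intros Hl Hf n; specialize (Hf n); revert f Hf.
  induction n as [|n IH]; intros f Hf.
  - intro x; apply continuous_comp; [apply Hf|now apply linear_cont].
  - destruct Hf as (df & Hd & Hc).
    exists (fun v x => l (df v x)); split; [|intro v; apply IH, Hc].
    intro x; apply (filterdiff_comp' f l x (fun v => df v x) l (Hd x)).
    now apply filterdiff_linear.
Qed.

Lemma smooth_precomp_linear {U V W : NormedModule R_AbsRing} (l : U -> V) (f : V -> W) :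
  is_linear l -> smooth f -> smooth (fun x => f (l x)).
Proof.
  intros Hl Hf n; specialize (Hf n); revert f Hf.
  induction n as [|n IH]; intros f Hf.
  - intro x; apply continuous_comp; [now apply linear_cont|apply Hf].
  - destruct Hf as (df & Hd & Hc).
    exists (fun v x => df (l v) (l x)); split; [|intro v; apply (IH (df (l v))), Hc].
    intro x; apply (filterdiff_comp' l f x l (fun v => df v (l x))); [|apply Hd].
    now apply filterdiff_linear.
Qed.

Lemma Ck_plus {V : NormedModule R_AbsRing} (n : nat) (f g : V -> R) :
  Ck n f -> Ck n g -> Ck n (fun x => f x + g x).
Proof.
  revert f g; induction n as [|n IH]; intros f g Hf Hg.
  - intro x; apply (continuous_plus (V := R_NormedModule) f g); auto.
  - destruct Hf as (df & Hdf & Hf), Hg as (dg & Hdg & Hg).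
    exists (fun v x => df v x + dg v x); split; [|intro v; apply IH; auto].
    intro x.
    apply (filterdiff_plus_fct (V := R_NormedModule) f g
             (fun v => df v x) (fun v => dg v x)); auto.
Qed.

Lemma Ck_mult {V : NormedModule R_AbsRing} (n : nat) (f g : V -> R) :
  Ck n f -> Ck n g -> Ck n (fun x => f x * g x).
Proof.
  revert f g; induction n as [|n IH]; intros f g Hf Hg.
  - intro x; apply (continuous_mult (K := R_AbsRing) f g); auto.
  (* The product rule keeps undifferentiated factors, so these are needed at order [n] too. *)
  - pose proof (Ck_weaken _ _ Hf) as Hf0; pose proof (Ck_weaken _ _ Hg) as Hg0.
    destruct Hf as (df & Hdf & Hf), Hg as (dg & Hdg & Hg).
    exists (fun v x => df v x * g x + f x * dg v x); split.
    + intro x.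
      apply (filterdiff_mult_fct (K := R_AbsRing) f g x
               (fun v => df v x) (fun v => dg v x)); auto.
      exact Rmult_comm.
    + intro v; apply Ck_plus; apply IH; auto.
Qed.

Lemma smooth_plus {V : NormedModule R_AbsRing} (f g : V -> R) :
  smooth f -> smooth g -> smooth (fun x => f x + g x).
Proof. intros Hf Hg n; apply Ck_plus; auto. Qed.

Lemma smooth_mult {V : NormedModule R_AbsRing} (f g : V -> R) :
  smooth f -> smooth g -> smooth (fun x => f x * g x).
Proof. intros Hf Hg n; apply Ck_mult; auto. Qed.

Lemma is_linear_line {V : NormedModule R_AbsRing} (w : V) :
  is_linear (fun k : R => scal k w).
Proof. apply (is_linear_scal_l (K := R_AbsRing) w). Qed.

Lemma filterdiff_line {V : NormedModule R_AbsRing} (f : V -> R) (x w : V) (l : V -> R) :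
  filterdiff f (locally x) l ->
  is_derive (fun k : R => f (plus x (scal k w))) 0 (l w).
Proof.
  intro Hf.
  assert (H : filterdiff (fun k : R => f (plus x (scal k w))) (locally 0)
                (fun k : R => l (scal k w))).
  { apply (filterdiff_comp' (fun k : R => plus x (scal k w)) f 0
             (fun k : R => scal k w) l).
    - apply filterdiff_ext_lin with (fun k : R => plus zero (scal k w)).
      + apply (filterdiff_plus_fct (fun _ : R => x) (fun k : R => scal k w)
                 (fun _ => zero) (fun k => scal k w)).
        * apply filterdiff_const.
        * apply filterdiff_linear, is_linear_line.
      + intro y; apply plus_zero_l.
    - replace (plus x (scal 0 w)) with x; [exact Hf|].
      rewrite <- (plus_zero_r x) at 1; f_equal.
      symmetry; apply (scal_zero_l (K := R_AbsRing) w). }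
  unfold is_derive.
  apply filterdiff_ext_lin with (1 := H).
  intro k; rewrite linear_scal; [reflexivity|apply Hf].
Qed.

(** The differential in [Ck] is an existential witness. Along a line it must agree with the
    one-variable derivative, so its smoothness passes to an explicitly defined function. *)
Lemma smooth_dir {V : NormedModule R_AbsRing} (f : V -> R) (w : V) :
  smooth f -> smooth (fun x => Derive (fun k : R => f (plus x (scal k w))) 0).
Proof.
  intros Hf n.
  destruct (Hf (S n)) as (df & Hd & Hc).
  refine (eq_ind _ (fun g : V -> R => Ck n g) (Hc w) _ _).
  apply functional_extensionality; intro x; symmetry.
  apply is_derive_unique, (filterdiff_line f x w (fun v => df v x)), Hd.
Qed.

(** * Smooth functions of three variables *)

Definition smooth3 (f : R -> R -> R -> R) : Prop :=
  smooth (fun p : R * R * R => f (fst (fst p)) (snd (fst p)) (snd p)).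

Definition D1 (f : R -> R -> R -> R) (s u v : R) : R := Derive (fun x => f x u v) s.
Definition D2 (f : R -> R -> R -> R) (s u v : R) : R := Derive (fun x => f s x v) u.
Definition D3 (f : R -> R -> R -> R) (s u v : R) : R := Derive (fun x => f s u x) v.

(** The 3 counts variables: this is joint continuity, not an order of differentiability. *)
Definition C3 (f : R -> R -> R -> R) : Prop :=
  forall p : R * R * R,
    continuous (fun q : R * R * R => f (fst (fst q)) (snd (fst q)) (snd q)) p.

Lemma smooth3_C3 (f : R -> R -> R -> R) : smooth3 f -> C3 f.
Proof. intro Hf; exact (Hf 0%nat). Qed.

Lemma smooth3_plus (f g : R -> R -> R -> R) :
  smooth3 f -> smooth3 g -> smooth3 (fun s u v => f s u v + g s u v).
Proof. intros Hf Hg; exact (smooth_plus _ _ Hf Hg). Qed.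

Lemma smooth3_mult (f g : R -> R -> R -> R) :
  smooth3 f -> smooth3 g -> smooth3 (fun s u v => f s u v * g s u v).
Proof. intros Hf Hg; exact (smooth_mult _ _ Hf Hg). Qed.

Lemma smooth3_const (c : R) : smooth3 (fun _ _ _ => c).
Proof. exact (smooth_const c). Qed.

Lemma smooth3_opp (f : R -> R -> R -> R) :
  smooth3 f -> smooth3 (fun s u v => - f s u v).
Proof.
  intro Hf.
  replace (fun s u v => - f s u v) with (fun s u v => (-1) * f s u v).
  - now apply smooth3_mult; [apply smooth3_const|].
  - repeat (apply functional_extensionality; intro); ring.
Qed.

Lemma smooth3_minus (f g : R -> R -> R -> R) :
  smooth3 f -> smooth3 g -> smooth3 (fun s u v => f s u v - g s u v).
Proof. intros Hf Hg; apply smooth3_plus; [|apply smooth3_opp]; assumption. Qed.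

Lemma is_derive_shift (f : R -> R) (x l : R) :
  is_derive (fun k => f (x + k)) 0 l -> is_derive f x l.
Proof.
  intro H.
  apply is_derive_ext with (fun y => (fun k => f (x + k)) (y - x)).
  - intro y; cbv beta; f_equal; ring.
  - replace l with (1 * l) by ring.
    apply (is_derive_comp (fun k => f (x + k)) (fun y => y - x)).
    + now replace (x - x) with 0 by ring.
    + auto_derive; [trivial|ring].
Qed.

(** The derivative of [smooth_dir] spelled out in coordinates; the two are convertible, and the
    three partial derivatives are its values on the unit vectors. *)
Definition dir3 (w : R * R * R) (f : R -> R -> R -> R) (s u v : R) : R :=
  Derive (fun k : R => f (s + k * fst (fst w)) (u + k * snd (fst w)) (v + k * snd w)) 0.

Lemma smooth3_dir3 (w : R * R * R) (f : R -> R -> R -> R) :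
  smooth3 f -> smooth3 (dir3 w f).
Proof. intro Hf; exact (smooth_dir _ w Hf). Qed.

Lemma ex_derive_dir3 (w : R * R * R) (f : R -> R -> R -> R) (s u v : R) :
  smooth3 f ->
  is_derive (fun k : R => f (s + k * fst (fst w)) (u + k * snd (fst w)) (v + k * snd w)) 0
    (dir3 w f s u v).
Proof.
  intro Hf; apply Derive_correct.
  destruct (Hf 1%nat) as (df & Hd & _).
  eexists; exact (filterdiff_line _ ((s, u, v) : R * R * R) w _ (Hd (s, u, v))).
Qed.

Ltac partial_from_dir Hf w s u v :=
  let H := fresh in
  pose proof (ex_derive_dir3 w _ s u v Hf) as H; cbn [fst snd] in H;
  apply is_derive_shift; eapply is_derive_ext; [|exact H];
  intro; cbv beta; f_equal; ring.

Lemma is_derive_dir1 (f : R -> R -> R -> R) (s u v : R) :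
  smooth3 f -> is_derive (fun x => f x u v) s (dir3 (1, 0, 0) f s u v).
Proof. intro Hf; partial_from_dir Hf ((1, 0, 0) : R * R * R) s u v. Qed.

Lemma is_derive_dir2 (f : R -> R -> R -> R) (s u v : R) :
  smooth3 f -> is_derive (fun x => f s x v) u (dir3 (0, 1, 0) f s u v).
Proof. intro Hf; partial_from_dir Hf ((0, 1, 0) : R * R * R) s u v. Qed.

Lemma is_derive_dir3 (f : R -> R -> R -> R) (s u v : R) :
  smooth3 f -> is_derive (fun x => f s u x) v (dir3 (0, 0, 1) f s u v).
Proof. intro Hf; partial_from_dir Hf ((0, 0, 1) : R * R * R) s u v. Qed.

Ltac fun_ext3 :=
  apply functional_extensionality; intro; apply functional_extensionality; intro;
  apply functional_extensionality; intro.

Lemma D1_dir (f : R -> R -> R -> R) : smooth3 f -> D1 f = dir3 (1, 0, 0) f.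
Proof. intro Hf; fun_ext3; apply is_derive_unique, is_derive_dir1, Hf. Qed.

Lemma D2_dir (f : R -> R -> R -> R) : smooth3 f -> D2 f = dir3 (0, 1, 0) f.
Proof. intro Hf; fun_ext3; apply is_derive_unique, is_derive_dir2, Hf. Qed.

Lemma D3_dir (f : R -> R -> R -> R) : smooth3 f -> D3 f = dir3 (0, 0, 1) f.
Proof. intro Hf; fun_ext3; apply is_derive_unique, is_derive_dir3, Hf. Qed.

Lemma smooth3_D1 (f : R -> R -> R -> R) : smooth3 f -> smooth3 (D1 f).
Proof. intro Hf; rewrite (D1_dir f Hf); now apply smooth3_dir3. Qed.

Lemma smooth3_D2 (f : R -> R -> R -> R) : smooth3 f -> smooth3 (D2 f).
Proof. intro Hf; rewrite (D2_dir f Hf); now apply smooth3_dir3. Qed.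

Lemma smooth3_D3 (f : R -> R -> R -> R) : smooth3 f -> smooth3 (D3 f).
Proof. intro Hf; rewrite (D3_dir f Hf); now apply smooth3_dir3. Qed.

Lemma is_derive_D1 (f : R -> R -> R -> R) (s u v : R) :
  smooth3 f -> is_derive (fun x => f x u v) s (D1 f s u v).
Proof. intro Hf; rewrite (D1_dir f Hf); now apply is_derive_dir1. Qed.

Lemma is_derive_D2 (f : R -> R -> R -> R) (s u v : R) :
  smooth3 f -> is_derive (fun x => f s x v) u (D2 f s u v).
Proof. intro Hf; rewrite (D2_dir f Hf); now apply is_derive_dir2. Qed.

Lemma is_derive_D3 (f : R -> R -> R -> R) (s u v : R) :
  smooth3 f -> is_derive (fun x => f s u x) v (D3 f s u v).
Proof. intro Hf; rewrite (D3_dir f Hf); now apply is_derive_dir3. Qed.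

Lemma C3_slice {U : UniformSpace} (f : R -> R -> R -> R) (a b c : U -> R) (x : U) :
  C3 f -> continuous a x -> continuous b x -> continuous c x ->
  continuous (fun y => f (a y) (b y) (c y)) x.
Proof.
  intros Hf Ha Hb Hc.
  apply (continuous_comp_2 (fun y => (a y, b y)) c
           (fun p w => f (fst p) (snd p) w)); [|exact Hc|].
  - apply (continuous_comp_2 a b (fun y z => (y, z))); auto.
    eapply continuous_ext; [|apply continuous_id]. now intros [? ?].
  - exact (Hf (a x, b x, c x)).
Qed.

Lemma continuity_2d_pt_continuous (f : R -> R -> R) (x y : R) :
  continuous (fun p : R * R => f (fst p) (snd p)) (x, y) -> continuity_2d_pt f x y.
Proof. intro H; apply continuity_2d_pt_filterlim; exact H. Qed.

Lemma D12_comm (f : R -> R -> R -> R) (s u v : R) :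
  smooth3 f -> D1 (D2 f) s u v = D2 (D1 f) s u v.
Proof.
  intro Hf.
  pose proof (smooth3_D1 f Hf) as H1; pose proof (smooth3_D2 f Hf) as H2.
  apply (Schwarz (fun x y => f x y v) s u).
  - exists (mkposreal 1 Rlt_0_1); intros x y _ _; repeat split; eexists.
    + now apply is_derive_D1.
    + now apply is_derive_D2.
    + exact (is_derive_D1 (D2 f) x y v H2).
    + exact (is_derive_D2 (D1 f) x y v H1).
  - apply continuity_2d_pt_continuous, (C3_slice (D1 (D2 f)) fst snd (fun _ => v));
      [apply smooth3_C3, smooth3_D1, H2|apply continuous_fst|apply continuous_snd
      |apply continuous_const].
  - apply continuity_2d_pt_continuous, (C3_slice (D2 (D1 f)) fst snd (fun _ => v));
      [apply smooth3_C3, smooth3_D2, H1|apply continuous_fst|apply continuous_snd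
      |apply continuous_const].
Qed.

Lemma D13_comm (f : R -> R -> R -> R) (s u v : R) :
  smooth3 f -> D1 (D3 f) s u v = D3 (D1 f) s u v.
Proof.
  intro Hf.
  pose proof (smooth3_D1 f Hf) as H1; pose proof (smooth3_D3 f Hf) as H2.
  apply (Schwarz (fun x y => f x u y) s v).
  - exists (mkposreal 1 Rlt_0_1); intros x y _ _; repeat split; eexists.
    + now apply is_derive_D1.
    + now apply is_derive_D3.
    + exact (is_derive_D1 (D3 f) x u y H2).
    + exact (is_derive_D3 (D1 f) x u y H1).
  - apply continuity_2d_pt_continuous, (C3_slice (D1 (D3 f)) fst (fun _ => u) snd);
      [apply smooth3_C3, smooth3_D1, H2|apply continuous_fst
      |apply continuous_const|apply continuous_snd].
  - apply continuity_2d_pt_continuous, (C3_slice (D3 (D1 f)) fst (fun _ => u) snd);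
      [apply smooth3_C3, smooth3_D3, H1|apply continuous_fst
      |apply continuous_const|apply continuous_snd].
Qed.

Lemma D23_comm (f : R -> R -> R -> R) (s u v : R) :
  smooth3 f -> D2 (D3 f) s u v = D3 (D2 f) s u v.
Proof.
  intro Hf.
  pose proof (smooth3_D2 f Hf) as H1; pose proof (smooth3_D3 f Hf) as H2.
  apply (Schwarz (fun x y => f s x y) u v).
  - exists (mkposreal 1 Rlt_0_1); intros x y _ _; repeat split; eexists.
    + now apply is_derive_D2.
    + now apply is_derive_D3.
    + exact (is_derive_D2 (D3 f) s x y H2).
    + exact (is_derive_D3 (D2 f) s x y H1).
  - apply continuity_2d_pt_continuous, (C3_slice (D2 (D3 f)) (fun _ => s) fst snd);
      [apply smooth3_C3, smooth3_D2, H2|apply continuous_const|apply continuous_fst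
      |apply continuous_snd].
  - apply continuity_2d_pt_continuous, (C3_slice (D3 (D2 f)) (fun _ => s) fst snd);
      [apply smooth3_C3, smooth3_D3, H1|apply continuous_const|apply continuous_fst
      |apply continuous_snd].
Qed.

(** * Integrals depending on parameters *)

(** Tube lemma: continuity at each (s0, u0, t) gives a radius depending on t, and compactness of
    [a, b] gives a common one. *)
Lemma C3_uniform_slice (J : R -> R -> R -> R) (a b s0 u0 eps : R) :
  C3 J -> 0 < eps ->
  exists d, 0 < d /\ forall s u v, Rabs (s - s0) < d -> Rabs (u - u0) < d ->
    a <= v <= b -> Rabs (J s u v - J s0 u0 v) < eps.
Proof.
  intros HJ He.
  assert (Hloc : forall t, exists d : posreal, forall s u v,
    Rabs (s - s0) < d -> Rabs (u - u0) < d -> Rabs (v - t) < d ->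
    Rabs (J s u v - J s0 u0 t) < eps / 2).
  { intro t.
    assert (He2 : 0 < eps / 2) by lra.
    destruct (proj1 (filterlim_locally _ _) (HJ (s0, u0, t)) (mkposreal _ He2))
      as [d Hd].
    exists d; intros s u v Hs Hu Hv.
    apply (Hd (s, u, v)); repeat split; assumption. }
  (* The compactness lemma expects a gauge, that is, a function of t, so the radii are chosen. *)
  set (delta := fun t => proj1_sig (constructive_indefinite_description _ (Hloc t))).
  destruct (compactness_value_1d a b delta) as [d Hd].
  exists d; split; [apply cond_pos|].
  intros s u v Hs Hu Hv.
  (* The covering property is stated under a double negation. Both values of [J] are then compared
     with the value at (s0, u0, t), whence the eps / 2 above. *)
  destruct (NNPP _ (Hd v Hv)) as (t & Ht & Hvt & Hdt).
  pose proof (proj2_sig (constructive_indefinite_description _ (Hloc t))) as Hp.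
  change (proj1_sig (constructive_indefinite_description _ (Hloc t))) with (delta t) in Hp.
  pose proof (Hp s u v ltac:(lra) ltac:(lra) Hvt) as H1.
  pose proof (Hp s0 u0 v) as H2; rewrite !Rminus_diag, Rabs_R0 in H2.
  specialize (H2 (cond_pos _) (cond_pos _) Hvt).
  apply Rabs_def2 in H1; apply Rabs_def2 in H2; apply Rabs_def1; lra.
Qed.

Lemma C3_section2 (J : R -> R -> R -> R) (s v u : R) :
  C3 J -> continuous (fun u => J s u v) u.
Proof.
  intro HJ; apply (C3_slice J (fun _ => s) (fun u => u) (fun _ => v)); auto;
    first [apply continuous_id|apply continuous_const].
Qed.

Lemma C3_section3 (J : R -> R -> R -> R) (s u v : R) :
  C3 J -> continuous (fun v => J s u v) v.
Proof.
  intro HJ; apply (C3_slice J (fun _ => s) (fun _ => u) (fun v => v)); auto;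
    first [apply continuous_id|apply continuous_const].
Qed.

Lemma ex_RInt_C3 (J : R -> R -> R -> R) (a b s u : R) :
  C3 J -> ex_RInt (fun v => J s u v) a b.
Proof.
  intro HJ; apply (ex_RInt_continuous (V := R_CompleteNormedModule)).
  intros; now apply C3_section3.
Qed.

Lemma continuous_RInt_C3 (J : R -> R -> R -> R) (a b : R) (p : R * R) :
  a <= b -> C3 J ->
  continuous (fun q : R * R => RInt (fun v => J (fst q) (snd q) v) a b) p.
Proof.
  intros Hab HJ; destruct p as [s0 u0].
  apply filterlim_locally; intro eps.
  (* The summand 1 keeps the quotient meaningful when a = b and makes the final estimate strict. *)
  assert (Hpos : 0 < eps / (b - a + 1))
    by (apply Rdiv_lt_0_compat; [apply cond_pos|lra]).
  destruct (C3_uniform_slice J a b s0 u0 _ HJ Hpos) as (d & Hd & Hu).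
  exists (mkposreal d Hd); intros [s u] [Hs Hu']; cbn in Hs, Hu'.
  change (Rabs (RInt (fun v => J s u v) a b - RInt (fun v => J s0 u0 v) a b) < eps).
  pose proof (RInt_minus (V := R_CompleteNormedModule) (fun v => J s u v)
    (fun v => J s0 u0 v) a b (ex_RInt_C3 J a b s u HJ) (ex_RInt_C3 J a b s0 u0 HJ)) as E.
  change (RInt (fun v => J s u v - J s0 u0 v) a b
    = RInt (fun v => J s u v) a b - RInt (fun v => J s0 u0 v) a b) in E.
  rewrite <- E.
  apply Rle_lt_trans with ((b - a) * (eps / (b - a + 1))).
  - apply abs_RInt_le_const; [exact Hab| |].
    + apply (ex_RInt_minus (V := R_CompleteNormedModule) (fun v => J s u v));
        now apply ex_RInt_C3.
    + intros t Ht; apply Rlt_le, Hu; assumption.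
  - replace (pos eps) with ((b - a + 1) * (eps / (b - a + 1))) at 2 by (field; lra).
    nra.
Qed.

Lemma is_derive_RInt_unif (f df : R -> R -> R) (a b s0 e : R) :
  0 < e ->
  (forall s v, Rabs (s - s0) < e -> is_derive (fun x => f x v) s (df s v)) ->
  (forall s v, Rabs (s - s0) < e -> continuous (fun w => f s w) v) ->
  (forall v, continuous (fun p : R * R => df (fst p) (snd p)) (s0, v)) ->
  is_derive (fun s => RInt (fun v => f s v) a b) s0 (RInt (fun v => df s0 v) a b).
Proof.
  intros He Hd Hc Hdc.
  assert (E : forall s v, Rabs (s - s0) < e -> Derive (fun x => f x v) s = df s v)
    by (intros; apply is_derive_unique; auto).
  rewrite (RInt_ext (fun v => df s0 v) (fun v => Derive (fun x => f x v) s0)).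
  - apply is_derive_RInt_param.
    + exists (mkposreal e He); intros s Hs t _; eexists; apply Hd, Hs.
    + intros t _; apply continuity_2d_pt_ext_loc with df.
      * exists (mkposreal e He); intros s v Hs _; symmetry; apply E, Hs.
      * apply continuity_2d_pt_continuous, Hdc.
    + exists (mkposreal e He); intros s Hs.
      apply (ex_RInt_continuous (V := R_CompleteNormedModule)).
      intros; apply Hc, Hs.
  - intros v _; symmetry; apply E; rewrite Rminus_diag, Rabs_R0; exact He.
Qed.

Lemma is_derive_RInt2 (f df : R -> R -> R -> R) (a b c d e : R) :
  0 < e -> a <= b -> C3 f -> C3 df ->
  (forall s u v, Rabs s < e -> is_derive (fun x => f x u v) s (df s u v)) ->
  is_derive (fun s => RInt (fun u => RInt (fun v => f s u v) a b) c d) 0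
    (RInt (fun u => RInt (fun v => df 0 u v) a b) c d).
Proof.
  intros He Hab Hf Hdf Hd.
  apply (is_derive_RInt_unif (fun s u => RInt (fun v => f s u v) a b)
           (fun s u => RInt (fun v => df s u v) a b) c d 0 e He).
  - intros s u Hs; rewrite Rminus_0_r in Hs.
    (* The ball of radius e - |s| around s stays inside the region |x| < e where [f] is
       differentiable. *)
    apply (is_derive_RInt_unif (fun s v => f s u v) (fun s v => df s u v)
             a b s (e - Rabs s)); [lra| | |].
    + intros x v Hx; apply Hd.
      replace x with ((x - s) + s) by ring.
      eapply Rle_lt_trans; [apply Rabs_triang|lra].
    + intros; now apply C3_section3.
    + intro v; apply (C3_slice df fst (fun _ => u) snd);
        [exact Hdf|apply continuous_fst|apply continuous_const|apply continuous_snd].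
  - intros s u _.
    apply (continuous_comp (fun w : R => (s, w))
             (fun q : R * R => RInt (fun v => f (fst q) (snd q) v) a b)).
    + apply (continuous_comp_2 (fun _ : R => s) (fun w : R => w) (fun y z => (y, z)));
        [apply continuous_const|apply continuous_id|].
      eapply continuous_ext; [|apply continuous_id]. now intros [? ?].
    + now apply continuous_RInt_C3.
  - intro u; now apply continuous_RInt_C3.
Qed.

(** Divergence theorem on the cylinder for the flux (P, Q). [P] is smooth up to the ends because it
    is integrated in u over [0, L]; [Q] is only differentiated in v over interior u, since the flux
    to which this is applied contains 1 / r, and r is known to be nonzero only there. *)
Lemma RInt_divergence (L : R) (h P Q : R -> R -> R -> R) :
  0 < L -> C3 h -> smooth3 P ->
  (forall u v, 0 < u < L -> is_derive (fun w => Q 0 u w) v (h 0 u v - D2 P 0 u v)) ->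
  (forall u, 0 < u < L -> Q 0 u (2 * PI) = Q 0 u 0) ->
  (forall v, P 0 0 v = 0) -> (forall v, P 0 L v = 0) ->
  RInt (fun u => RInt (fun v => h 0 u v) 0 (2 * PI)) 0 L = 0.
Proof.
  intros HL Hh HP HQ HQp HP0 HPL.
  pose proof PI_RGT_0 as Hpi.
  pose proof (smooth3_C3 _ HP) as HPc.
  pose proof (smooth3_C3 _ (smooth3_D2 _ HP)) as HDP.
  set (Pi := fun u => RInt (fun v => P 0 u v) 0 (2 * PI)).
  set (dPi := fun u => RInt (fun v => D2 P 0 u v) 0 (2 * PI)).
  assert (HdPi : forall u, is_derive Pi u (dPi u)).
  { intro u.
    apply (is_derive_RInt_unif (fun u v => P 0 u v) (fun u v => D2 P 0 u v)
             0 (2 * PI) u 1); [lra| | |].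
    - intros; now apply is_derive_D2.
    - intros; now apply C3_section3.
    - intro v; apply (C3_slice (D2 P) (fun _ => 0) fst snd);
        [exact HDP|apply continuous_const|apply continuous_fst|apply continuous_snd]. }
  assert (HcPi : forall u, continuous dPi u).
  { intro u.
    apply (continuous_comp (fun w : R => (0, w))
             (fun q : R * R => RInt (fun v => D2 P (fst q) (snd q) v) 0 (2 * PI))).
    + apply (continuous_comp_2 (fun _ : R => 0) (fun w : R => w) (fun y z => (y, z)));
        [apply continuous_const|apply continuous_id|].
      eapply continuous_ext; [|apply continuous_id]. now intros [? ?].
    + apply continuous_RInt_C3; [lra|exact HDP]. }
  (* For interior u the integral of h - P_u over a period is the increment of [Q], which is 0; so
     the inner integral of [h] is the derivative of [Pi], and [Pi] takes equal values at both
     ends. *)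
  rewrite (RInt_ext _ dPi).
  - rewrite (is_RInt_unique dPi 0 L _
      (is_RInt_derive Pi dPi 0 L (fun x _ => HdPi x) (fun x _ => HcPi x))).
    assert (E0 : Pi 0 = Pi L).
    { apply RInt_ext; intros; now rewrite HP0, HPL. }
    rewrite E0; apply (minus_eq_zero (G := R_AbelianGroup)).
  - intros u Hu; rewrite Rmin_left, Rmax_right in Hu by lra.
    assert (E : is_RInt (fun v => h 0 u v - D2 P 0 u v) 0 (2 * PI) 0).
    { replace 0 with (minus (Q 0 u (2 * PI)) (Q 0 u 0)) at 2.
      - apply (is_RInt_derive (fun w => Q 0 u w)
                 (fun v => h 0 u v - D2 P 0 u v) 0 (2 * PI)).
        + intros; now apply HQ.
        + intros; apply (continuous_minus (V := R_NormedModule) (fun v => h 0 u v));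
            now apply C3_section3.
      - rewrite HQp by exact Hu; apply (minus_eq_zero (G := R_AbelianGroup)). }
    apply (is_RInt_unique (V := R_CompleteNormedModule)) in E.
    pose proof (RInt_minus (V := R_CompleteNormedModule) (fun v => h 0 u v)
      (fun v => D2 P 0 u v) 0 (2 * PI) (ex_RInt_C3 _ _ _ _ _ Hh) (ex_RInt_C3 _ _ _ _ _ HDP)) as E'.
    change (RInt (fun v => h 0 u v - D2 P 0 u v) 0 (2 * PI)
      = RInt (fun v => h 0 u v) 0 (2 * PI) - dPi u) in E'.
    change (RInt (fun v => h 0 u v) 0 (2 * PI) = dPi u); lra.
Qed.

(** An identity known on [0, L] can be differentiated in u in the interior but not directly at the
    ends; this lemma carries the result to the ends. *)
Lemma continuous_eq_closed (f : R -> R) (a b c : R) :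
  a < b -> (forall x, continuous f x) -> (forall x, a < x < b -> f x = c) ->
  forall x, a <= x <= b -> f x = c.
Proof.
  intros Hab Hc Hf x Hx.
  apply NNPP; intro Hne.
  assert (He : 0 < Rabs (f x - c)) by (apply Rabs_pos_lt; lra).
  destruct (proj1 (filterlim_locally _ _) (Hc x) (mkposreal _ He)) as [d Hd].
  (* The point lies from x in the direction of the half of [a, b] not containing x; a step of at
     most (b - a) / 4 does not leave the interval. *)
  assert (exists y, a < y < b /\ Rabs (y - x) < d) as (y & Hy & Hyx).
  { pose proof (cond_pos d) as Hdp.
    destruct (Rle_lt_dec x ((a + b) / 2)).
    - exists (x + Rmin (d / 2) ((b - a) / 4)).
      pose proof (Rmin_l (d / 2) ((b - a) / 4)).
      pose proof (Rmin_r (d / 2) ((b - a) / 4)).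
      assert (0 < Rmin (d / 2) ((b - a) / 4)) by (apply Rmin_glb_lt; lra).
      split; [lra|rewrite Rabs_pos_eq; lra].
    - exists (x - Rmin (d / 2) ((b - a) / 4)).
      pose proof (Rmin_l (d / 2) ((b - a) / 4)).
      pose proof (Rmin_r (d / 2) ((b - a) / 4)).
      assert (0 < Rmin (d / 2) ((b - a) / 4)) by (apply Rmin_glb_lt; lra).
      split; [lra|rewrite Rabs_left; lra]. }
  specialize (Hd y Hyx); change (Rabs (f y - f x) < Rabs (f x - c)) in Hd.
  rewrite (Hf y Hy), Rabs_minus_sym in Hd; lra.
Qed.

(** Composition with this retraction turns a function that is continuous on [a, b] into one
    continuous on the whole line, with the same range of arguments. *)
Definition clamp (a b x : R) : R := Rmax a (Rmin b x).

Lemma clamp_in (a b x : R) : a <= b -> a <= clamp a b x <= b.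
Proof.
  intro H; unfold clamp; split; [apply Rmax_l|].
  apply Rmax_lub; [exact H|apply Rmin_l].
Qed.

Lemma clamp_id (a b x : R) : a <= x <= b -> clamp a b x = x.
Proof. intro H; unfold clamp; rewrite Rmin_right, Rmax_right; lra. Qed.

Lemma continuous_clamp (a b x : R) : a <= b -> continuous (clamp a b) x.
Proof.
  intros Hab; apply filterlim_locally; intro eps; exists eps; intros y Hy.
  change (Rabs (y - x) < eps) in Hy; change (Rabs (clamp a b y - clamp a b x) < eps).
  apply Rle_lt_trans with (2 := Hy); unfold clamp, Rmax, Rmin, Rabs.
  repeat (destruct Rle_dec || destruct Rcase_abs); lra.
Qed.

(** * Vector algebra *)

Ltac r3 :=
  repeat match goal with x : R3 |- _ => destruct x as [[? ?] ?] end;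
  unfold add3, scal3, cross3, dot3, zero3 in *; cbn [fst snd] in *.

Ltac r3_ring := intros; r3; repeat (apply injective_projections; cbn [fst snd]); ring.

Lemma dot3_comm (x y : R3) : dot3 x y = dot3 y x.
Proof. r3_ring. Qed.

Lemma dot3_self_nonneg (x : R3) : 0 <= dot3 x x.
Proof. r3; nra. Qed.

Lemma dot3_self_eq0 (x : R3) : dot3 x x = 0 -> x = zero3.
Proof. r3; intro H; repeat f_equal; nra. Qed.

Lemma dot3_self_pos (x : R3) : x <> zero3 -> 0 < dot3 x x.
Proof.
  intro H; destruct (Rle_lt_or_eq_dec _ _ (dot3_self_nonneg x)) as [|E]; [assumption|].
  now elim H; apply dot3_self_eq0.
Qed.

Lemma norm3_sqr (x : R3) : norm3 x * norm3 x = dot3 x x.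
Proof. apply sqrt_sqrt, dot3_self_nonneg. Qed.

Lemma norm3_scal (a : R) (x : R3) : norm3 (scal3 a x) = Rabs a * norm3 x.
Proof.
  unfold norm3; replace (dot3 (scal3 a x) (scal3 a x)) with (Rsqr a * dot3 x x)
    by (unfold Rsqr; r3_ring).
  rewrite sqrt_mult; [|apply Rle_0_sqr|apply dot3_self_nonneg].
  now rewrite sqrt_Rsqr_abs.
Qed.

Lemma scal3_scal3 (a b : R) (x : R3) : scal3 a (scal3 b x) = scal3 (a * b) x.
Proof. r3_ring. Qed.

Lemma scal3_one (x : R3) : scal3 1 x = x.
Proof. r3_ring. Qed.

Definition orthonormal (x y : R3) : Prop :=
  dot3 x x = 1 /\ dot3 y y = 1 /\ dot3 x y = 0.

Definition in_frame (t n x : R3) : R3 :=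
  add3 (scal3 (fst (fst x)) t)
       (add3 (scal3 (snd (fst x)) n) (scal3 (snd x) (cross3 t n))).

(** Here and in the next two lemmas the vectors t and n are first left arbitrary: a polynomial
    identity collects their mutual dot products, [ring] proves it, and only then do the values 1, 1,
    0 enter. *)
Lemma dot3_in_frame (t n x y : R3) :
  orthonormal t n -> dot3 (in_frame t n x) (in_frame t n y) = dot3 x y.
Proof.
  intros (Ht & Hn & Htn).
  replace (dot3 (in_frame t n x) (in_frame t n y)) with
    (fst (fst x) * fst (fst y) * dot3 t t + snd (fst x) * snd (fst y) * dot3 n n
     + (fst (fst x) * snd (fst y) + snd (fst x) * fst (fst y)) * dot3 t n
     + snd x * snd y * (dot3 t t * dot3 n n - dot3 t n * dot3 t n))
    by (unfold in_frame; r3_ring).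
  rewrite Ht, Hn, Htn; r3_ring.
Qed.

Lemma cross3_in_frame (t n x y : R3) :
  orthonormal t n ->
  cross3 (in_frame t n x) (in_frame t n y) = in_frame t n (cross3 x y).
Proof.
  intros (Ht & Hn & Htn).
  replace (cross3 (in_frame t n x) (in_frame t n y)) with
    (add3 (scal3 (snd (fst x) * snd y - snd x * snd (fst y))
             (add3 (scal3 (dot3 n n) t) (scal3 (- dot3 t n) n)))
       (add3 (scal3 (snd x * fst (fst y) - fst (fst x) * snd y)
             (add3 (scal3 (dot3 t t) n) (scal3 (- dot3 t n) t)))
          (scal3 (fst (fst x) * snd (fst y) - snd (fst x) * fst (fst y)) (cross3 t n))))
    by (unfold in_frame; r3_ring).
  rewrite Ht, Hn, Htn; unfold in_frame; r3_ring.
Qed.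

Lemma frame_expansion (t n x : R3) :
  orthonormal t n ->
  x = in_frame t n (dot3 x t, dot3 x n, dot3 x (cross3 t n)).
Proof.
  intros (Ht & Hn & Htn).
  (* Valid for all t and n; the first coefficient is their Gram determinant, which is 1 for an
     orthonormal pair. *)
  assert (E : add3 (scal3 (dot3 t t * dot3 n n - dot3 t n * dot3 t n) x)
      (add3 (scal3 (dot3 t n) (add3 (scal3 (dot3 x t) n) (scal3 (dot3 x n) t))) zero3)
    = add3 (scal3 (dot3 n n * dot3 x t) t)
       (add3 (scal3 (dot3 t t * dot3 x n) n) (scal3 (dot3 x (cross3 t n)) (cross3 t n))))
    by r3_ring.
  rewrite Ht, Hn, Htn in E; unfold in_frame; cbn [fst snd].
  transitivity (add3 (scal3 (1 * 1 - 0 * 0) x)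
    (add3 (scal3 0 (add3 (scal3 (dot3 x t) n) (scal3 (dot3 x n) t))) zero3)).
  - r3_ring.
  - rewrite E; r3_ring.
Qed.

Lemma cross3_eq0_dependent (x y : R3) :
  cross3 x y = zero3 ->
  add3 (scal3 (dot3 y y) x) (scal3 (- dot3 x y) y) = zero3.
Proof.
  intro H.
  transitivity (cross3 y (cross3 x y)); [r3_ring|].
  rewrite H; r3_ring.
Qed.

(** * Derivatives of vector-valued functions *)

Definition is_derive3 (f : R -> R3) (x : R) (l : R3) : Prop :=
  is_derive (fun y => fst (fst (f y))) x (fst (fst l)) /\
  is_derive (fun y => snd (fst (f y))) x (snd (fst l)) /\
  is_derive (fun y => snd (f y)) x (snd l).

Lemma is_derive3_unique (f : R -> R3) (x : R) (l : R3) :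
  is_derive3 f x l -> Derive3 f x = l.
Proof.
  destruct l as [[l1 l2] l3]; intros (H1 & H2 & H3); cbn [fst snd] in *.
  unfold Derive3.
  apply injective_projections; [apply injective_projections|]; cbn [fst snd];
    now apply is_derive_unique.
Qed.

Lemma is_derive3_Derive3 (f : R -> R3) (x : R) (l : R3) :
  is_derive3 f x l -> is_derive3 f x (Derive3 f x).
Proof. intro H; now rewrite (is_derive3_unique _ _ _ H). Qed.

Lemma is_derive3_ext_loc (f g : R -> R3) (x : R) (l : R3) :
  locally x (fun y => f y = g y) -> is_derive3 f x l -> is_derive3 g x l.
Proof.
  intros He (H1 & H2 & H3); split; [|split];
    (eapply is_derive_ext_loc; [|eassumption]; revert He; apply filter_imp;
     intros y E; now rewrite E).
Qed.

Lemma is_derive_R (f : R -> R) (x l l' : R) :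
  is_derive f x l -> l = l' -> is_derive f x l'.
Proof. now intros H <-. Qed.

Lemma is_derive_Rmult (f g : R -> R) (x a b : R) :
  is_derive f x a -> is_derive g x b ->
  is_derive (fun y => f y * g y) x (a * g x + f x * b).
Proof.
  intros Hf Hg.
  apply (is_derive_mult (K := R_AbsRing) f g x a b Hf Hg); exact Rmult_comm.
Qed.

Lemma is_derive_Rplus (f g : R -> R) (x a b : R) :
  is_derive f x a -> is_derive g x b -> is_derive (fun y => f y + g y) x (a + b).
Proof. intros Hf Hg; exact (is_derive_plus f g x a b Hf Hg). Qed.

Lemma is_derive_Ropp (f : R -> R) (x a : R) :
  is_derive f x a -> is_derive (fun y => - f y) x (- a).
Proof. intros Hf; exact (is_derive_opp f x a Hf). Qed.

Lemma is_derive_Rminus (f g : R -> R) (x a b : R) :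
  is_derive f x a -> is_derive g x b -> is_derive (fun y => f y - g y) x (a - b).
Proof. intros Hf Hg; exact (is_derive_minus f g x a b Hf Hg). Qed.

Lemma is_derive_Rconst (c x : R) : is_derive (fun _ : R => c) x 0.
Proof. exact (is_derive_const (K := R_AbsRing) (V := R_NormedModule) c x). Qed.

Ltac derive_poly :=
  lazymatch goal with
  | |- is_derive (fun y => _ + _) _ _ => apply is_derive_Rplus; derive_poly
  | |- is_derive (fun y => _ - _) _ _ => apply is_derive_Rminus; derive_poly
  | |- is_derive (fun y => _ * _) _ _ => apply is_derive_Rmult; derive_poly
  | |- is_derive (fun y => - _) _ _ => apply is_derive_Ropp; derive_poly
  | |- _ => first [eassumption | apply is_derive_Rconst]
  end.

Lemma add3_eq (x y : R3) : add3 x y =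
  (fst (fst x) + fst (fst y), snd (fst x) + snd (fst y), snd x + snd y).
Proof. now r3. Qed.

Lemma scal3_eq (a : R) (y : R3) : scal3 a y =
  (a * fst (fst y), a * snd (fst y), a * snd y).
Proof. now r3. Qed.

Lemma dot3_eq (x y : R3) : dot3 x y =
  fst (fst x) * fst (fst y) + snd (fst x) * snd (fst y) + snd x * snd y.
Proof. now r3. Qed.

Lemma cross3_eq (x y : R3) : cross3 x y =
  (snd (fst x) * snd y - snd x * snd (fst y),
   snd x * fst (fst y) - fst (fst x) * snd y,
   fst (fst x) * snd (fst y) - snd (fst x) * fst (fst y)).
Proof. now r3. Qed.

Lemma is_derive_fun_ext (f g : R -> R) (x l : R) :
  (forall y, f y = g y) -> is_derive g x l -> is_derive f x l.
Proof. intros E H; eapply is_derive_ext; [intro; symmetry; apply E|exact H]. Qed.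

Lemma is_derive_dot3 (f g : R -> R3) (x : R) (a b : R3) :
  is_derive3 f x a -> is_derive3 g x b ->
  is_derive (fun y => dot3 (f y) (g y)) x (dot3 a (g x) + dot3 (f x) b).
Proof.
  intros (F1 & F2 & F3) (G1 & G2 & G3).
  eapply is_derive_fun_ext; [intro; apply dot3_eq|].
  eapply is_derive_R; [derive_poly|cbv beta; rewrite !dot3_eq; ring].
Qed.

Lemma is_derive3_add3 (f g : R -> R3) (x : R) (a b : R3) :
  is_derive3 f x a -> is_derive3 g x b ->
  is_derive3 (fun y => add3 (f y) (g y)) x (add3 a b).
Proof.
  intros (F1 & F2 & F3) (G1 & G2 & G3); split; [|split];
    (eapply is_derive_fun_ext; [intro; rewrite add3_eq; reflexivity|];
     rewrite add3_eq; cbn [fst snd]; derive_poly).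
Qed.

Lemma is_derive3_scal3 (f : R -> R) (g : R -> R3) (x a : R) (b : R3) :
  is_derive f x a -> is_derive3 g x b ->
  is_derive3 (fun y => scal3 (f y) (g y)) x (add3 (scal3 a (g x)) (scal3 (f x) b)).
Proof.
  intros F1 (G1 & G2 & G3); split; [|split];
    (eapply is_derive_fun_ext; [intro; rewrite scal3_eq; reflexivity|];
     rewrite add3_eq, !scal3_eq; cbn [fst snd]; derive_poly).
Qed.

Lemma is_derive3_cross3 (f g : R -> R3) (x : R) (a b : R3) :
  is_derive3 f x a -> is_derive3 g x b ->
  is_derive3 (fun y => cross3 (f y) (g y)) x
    (add3 (cross3 a (g x)) (cross3 (f x) b)).
Proof.
  intros (F1 & F2 & F3) (G1 & G2 & G3); split; [|split];
    (eapply is_derive_fun_ext; [intro; rewrite cross3_eq; reflexivity|];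
     rewrite add3_eq, !cross3_eq; cbn [fst snd];
     eapply is_derive_R; [derive_poly|cbv beta; ring]).
Qed.

Lemma is_derive3_comp (f : R -> R3) (g : R -> R) (x a : R) (b : R3) :
  is_derive3 f (g x) b -> is_derive g x a ->
  is_derive3 (fun y => f (g y)) x (scal3 a b).
Proof.
  intros (F1 & F2 & F3) G; rewrite scal3_eq; split; [|split]; cbn [fst snd];
    [apply (is_derive_comp (fun y => fst (fst (f y))) g)
    |apply (is_derive_comp (fun y => snd (fst (f y))) g)
    |apply (is_derive_comp (fun y => snd (f y)) g)]; assumption.
Qed.

Lemma is_derive_const_loc (f : R -> R) (x c l : R) :
  locally x (fun y => f y = c) -> is_derive f x l -> l = 0.
Proof.
  intros He Hf.
  rewrite <- (is_derive_unique _ _ _ Hf), (Derive_ext_loc f (fun _ => c) x He).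
  apply Derive_const.
Qed.

Lemma locally_open_interval (a b x : R) (P : R -> Prop) :
  a < x < b -> (forall y, a < y < b -> P y) -> locally x P.
Proof.
  intros Hx HP.
  assert (Hd : 0 < Rmin (x - a) (b - x)) by (apply Rmin_glb_lt; lra).
  exists (mkposreal _ Hd); intros y Hy.
  change (Rabs (y - x) < Rmin (x - a) (b - x)) in Hy.
  pose proof (Rmin_l (x - a) (b - x)); pose proof (Rmin_r (x - a) (b - x)).
  apply Rabs_def2 in Hy; apply HP; lra.
Qed.

(** Encoded as a function of (s, u, v) that depends on u alone, so that the closure lemmas for
    [smooth3] and the derivative [D2] also serve for one variable. *)
Definition smooth1 (f : R -> R) : Prop := smooth3 (fun _ u _ => f u).

Lemma smooth1_is_derive (f : R -> R) (x : R) : smooth1 f -> is_derive f x (Derive f x).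
Proof. intro H; exact (is_derive_D2 _ 0 x 0 H). Qed.

Lemma smooth1_Derive (f : R -> R) : smooth1 f -> smooth1 (Derive f).
Proof. intro H; exact (smooth3_D2 _ H). Qed.

Lemma smooth1_continuous (f : R -> R) (x : R) : smooth1 f -> continuous f x.
Proof. intro H; exact (C3_section2 _ 0 0 x (smooth3_C3 _ H)). Qed.

Definition smooth13 (f : R -> R3) : Prop :=
  smooth1 (fun x => fst (fst (f x))) /\ smooth1 (fun x => snd (fst (f x))) /\
  smooth1 (fun x => snd (f x)).

Lemma smooth13_is_derive3 (f : R -> R3) (x : R) :
  smooth13 f -> is_derive3 f x (Derive3 f x).
Proof.
  intros (H1 & H2 & H3); split; [|split]; cbn [Derive3 fst snd];
    now apply smooth1_is_derive.
Qed.

Lemma smooth13_Derive3 (f : R -> R3) : smooth13 f -> smooth13 (Derive3 f).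
Proof.
  intros (H1 & H2 & H3); split; [|split]; cbn [Derive3 fst snd];
    now apply smooth1_Derive.
Qed.

Ltac smooth3_poly :=
  lazymatch goal with
  | |- smooth3 (fun s u v => _ + _) => apply smooth3_plus; smooth3_poly
  | |- smooth3 (fun s u v => _ - _) => apply smooth3_minus; smooth3_poly
  | |- smooth3 (fun s u v => _ * _) => apply smooth3_mult; smooth3_poly
  | |- smooth3 (fun s u v => - _) => apply smooth3_opp; smooth3_poly
  | |- _ => first [assumption | apply smooth3_const]
  end.

Lemma smooth1_dot3 (f g : R -> R3) :
  smooth13 f -> smooth13 g -> smooth1 (fun x => dot3 (f x) (g x)).
Proof.
  intros (F1 & F2 & F3) (G1 & G2 & G3); unfold smooth1 in *.
  replace (fun _ u _ : R => dot3 (f u) (g u)) with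
    (fun _ u _ : R => fst (fst (f u)) * fst (fst (g u)) + snd (fst (f u)) * snd (fst (g u))
      + snd (f u) * snd (g u))
    by (repeat (apply functional_extensionality; intro); now rewrite dot3_eq).
  smooth3_poly.
Qed.

Lemma smooth13_cross3 (f g : R -> R3) :
  smooth13 f -> smooth13 g -> smooth13 (fun x => cross3 (f x) (g x)).
Proof.
  intros (F1 & F2 & F3) (G1 & G2 & G3).
  replace (fun x : R => cross3 (f x) (g x)) with (fun x : R =>
  (snd (fst (f x)) * snd (g x) - snd (f x) * snd (fst (g x)),
   snd (f x) * fst (fst (g x)) - fst (fst (f x)) * snd (g x),
   fst (fst (f x)) * snd (fst (g x)) - snd (fst (f x)) * fst (fst (g x))))
    by (apply functional_extensionality; intro; now rewrite cross3_eq).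
  unfold smooth13, smooth1 in *; cbn [fst snd]; split; [|split]; smooth3_poly.
Qed.

(** * The tangent image of a force-free strip *)

Lemma norm3_pos (x : R3) : x <> zero3 -> 0 < norm3 x.
Proof. intro H; now apply sqrt_lt_R0, dot3_self_pos. Qed.

Lemma norm3_nonneg (x : R3) : 0 <= norm3 x.
Proof. apply sqrt_pos. Qed.

Lemma continuous_pos_loc (f : R -> R) (x : R) :
  continuous f x -> 0 < f x -> locally x (fun y => 0 < f y).
Proof. intros Hc H; exact (Hc _ (open_gt 0 (f x) H)). Qed.

(** Outside [0, L] the velocity may vanish, so [tangent g] is not smooth on the line. The explicit
    derivative [W] of the quotient g' / |g'| is valid near every regular point, which suffices for
    both claims. *)
Lemma tangent_regular (g : R -> R3) (t : R) :
  smooth13 g -> Derive3 g t <> zero3 ->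
  is_derive3 (tangent g) t (Derive3 (tangent g) t) /\
  continuous (fun r => norm3 (Derive3 (tangent g) r)) t.
Proof.
  intros Hg Ht.
  pose proof (smooth13_Derive3 _ Hg) as Hg1.
  pose proof (smooth13_Derive3 _ Hg1) as Hg2.
  set (q := fun r => dot3 (Derive3 g r) (Derive3 g r)).
  assert (Hq : smooth1 q) by now apply smooth1_dot3.
  pose proof (smooth1_Derive _ Hq) as Hq1.
  set (C := fun r => dot3 (Derive3 g r) (Derive3 (Derive3 g) r)).
  assert (HC : smooth1 C) by now apply smooth1_dot3.
  set (E := fun r => dot3 (Derive3 (Derive3 g) r) (Derive3 (Derive3 g) r)).
  assert (HE : smooth1 E) by now apply smooth1_dot3.
  set (d := fun r => - Derive q r / (2 * q r * sqrt (q r))).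
  set (W := fun r => add3 (scal3 (d r) (Derive3 g r))
                       (scal3 (/ sqrt (q r)) (Derive3 (Derive3 g) r))).
  assert (HW : forall y, 0 < q y -> is_derive3 (tangent g) y (W y)).
  { intros y Hy.
    apply (is_derive3_scal3 (fun r => / sqrt (q r)) (Derive3 g) y (d y)
             (Derive3 (Derive3 g) y)).
    - pose proof (sqrt_lt_R0 _ Hy) as Hs.
      auto_derive.
      + repeat split; [eexists; now apply smooth1_is_derive|exact Hy|lra].
      + unfold d; change (fun x => q x) with q.
        rewrite sqrt_sqrt by lra; field; lra.
    - now apply smooth13_is_derive3. }
  assert (Hpos : 0 < q t) by now apply dot3_self_pos.
  split; [apply (is_derive3_Derive3 _ _ _ (HW t Hpos))|].
  (* The squared length of [W], expanded in the smooth scalar functions [q], [C] and [E]. *)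
  apply continuous_ext_loc with (fun r => sqrt
    (d r ^ 2 * q r + 2 * d r * / sqrt (q r) * C r + (/ sqrt (q r)) ^ 2 * E r)).
  - generalize (continuous_pos_loc q t (smooth1_continuous _ _ Hq) Hpos).
    apply filter_imp; intros y Hy.
    rewrite (is_derive3_unique _ _ _ (HW y Hy)); unfold norm3; f_equal.
    unfold W; generalize (d y) (/ sqrt (q y)); intros a b; unfold q, C, E.
    generalize (Derive3 g y) (Derive3 (Derive3 g) y); r3_ring.
  - apply continuous_comp; [|apply continuous_sqrt].
    apply (ex_derive_continuous (V := R_NormedModule)).
    pose proof (sqrt_lt_R0 _ Hpos) as Hs.
    unfold d; auto_derive.
    change (fun x => q x) with q; change (fun x => Derive q x) with (Derive q).
    repeat split;
      first [lra | nra | eexists; now apply smooth1_is_derive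
            | apply Rgt_not_eq; repeat apply Rmult_lt_0_compat; lra | idtac].
Qed.

Lemma dot3_scal_unit (a : R) (x : R3) :
  a <> 0 -> dot3 x x = a * a -> dot3 (scal3 (/ a) x) (scal3 (/ a) x) = 1.
Proof.
  intros Ha H; transitivity (/ a * / a * dot3 x x); [r3_ring|].
  rewrite H; field; exact Ha.
Qed.

Lemma tangent_unit (g : R -> R3) (t : R) :
  Derive3 g t <> zero3 -> dot3 (tangent g t) (tangent g t) = 1.
Proof.
  intro Ht; apply dot3_scal_unit; [apply Rgt_not_eq, norm3_pos, Ht|].
  symmetry; apply norm3_sqr.
Qed.

Section ArclengthTangent.

Context (mu L : R) (g : R -> R3) (Lt : R) (T X : R -> R3).
Context (HL : 0 < L) (Hg : smooth13 g) (Hfr : frenet_on L g).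
Context (Hforce : forall t, 0 <= t <= L -> force mu g t = zero3).
Context (HT : arclength_tangent_image L g Lt T).
(** [T] is constrained only on [0, Lt] and comes without derivatives; [X] is a smooth curve on the
    line that agrees with it there. *)
Context (HX : smooth13 X) (HXT : forall x, 0 <= x <= Lt -> X x = T x).

Let w (t : R) : R := norm3 (Derive3 (tangent g) t).
(** Clamping the integrand makes [sigma] differentiable on the line with positive derivative, hence
    strictly increasing; on [0, L] it is the arclength of the tangent image. *)
Let sigma (t : R) : R := RInt (fun r => w (clamp 0 L r)) 0 t.
Let lam (x : R) : R := dot3 (Derive3 (Derive3 X) x) (cross3 (X x) (Derive3 X x)).

Lemma speed_pos (t : R) : 0 <= t <= L -> 0 < speed g t.
Proof. intro Ht; apply norm3_pos, Hfr, Ht. Qed.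

Lemma tangent_speed_eq (t : R) : 0 <= t <= L -> w t = speed g t * curvature g t.
Proof.
  intro Ht; pose proof (speed_pos t Ht) as Hs.
  unfold curvature, ds3; rewrite norm3_scal, Rabs_pos_eq.
  - unfold w; field; lra.
  - now apply Rlt_le, Rinv_0_lt_compat.
Qed.

Lemma curvature_pos (t : R) : 0 <= t <= L -> 0 < curvature g t.
Proof.
  intro Ht; destruct (norm3_nonneg (ds3 g (tangent g) t)) as [H|H]; [exact H|].
  now elim (proj2 (Hfr t Ht)).
Qed.

Lemma tangent_speed_pos (t : R) : 0 <= t <= L -> 0 < w t.
Proof.
  intro Ht; rewrite tangent_speed_eq by exact Ht.
  apply Rmult_lt_0_compat; [now apply speed_pos|now apply curvature_pos].
Qed.

Lemma tangent_speed_continuous (t : R) : continuous (fun r => w (clamp 0 L r)) t.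
Proof.
  apply (continuous_comp (clamp 0 L) w); [apply continuous_clamp; lra|].
  apply tangent_regular; [exact Hg|].
  apply Hfr, clamp_in; lra.
Qed.

Lemma sigma_derive (t : R) : is_derive sigma t (w (clamp 0 L t)).
Proof.
  apply (is_derive_RInt (V := R_NormedModule) (fun r => w (clamp 0 L r)) sigma 0 t);
    [|apply tangent_speed_continuous].
  apply filter_forall; intro y.
  apply (RInt_correct (V := R_CompleteNormedModule)).
  apply (ex_RInt_continuous (V := R_CompleteNormedModule)).
  intros; apply tangent_speed_continuous.
Qed.

Lemma sigma_incr (x y : R) : x < y -> sigma x < sigma y.
Proof.
  intro Hxy.
  apply (incr_function sigma m_infty p_infty (fun t => w (clamp 0 L t))); try easy.
  - intros; apply sigma_derive.
  - intros; apply tangent_speed_pos, clamp_in; lra.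
Qed.

Lemma sigma_zero : sigma 0 = 0.
Proof. apply (RInt_point (V := R_CompleteNormedModule)). Qed.

Lemma sigma_arclength (t : R) : 0 <= t <= L -> tangent_arclength g t = sigma t.
Proof.
  intro Ht; apply RInt_ext; intros x Hx.
  rewrite Rmin_left, Rmax_right in Hx by lra.
  rewrite clamp_id; [reflexivity|lra].
Qed.

Lemma sigma_end : sigma L = Lt.
Proof. rewrite (proj1 HT); symmetry; apply sigma_arclength; lra. Qed.

Lemma sigma_range (t : R) : 0 < t < L -> 0 < sigma t < Lt.
Proof.
  intro Ht; rewrite <- sigma_zero at 1; rewrite <- sigma_end.
  split; apply sigma_incr; lra.
Qed.

Lemma arclength_pos : 0 < Lt.
Proof. rewrite <- sigma_zero, <- sigma_end; now apply sigma_incr. Qed.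

Lemma sigma_onto (x : R) : 0 < x < Lt -> exists t, 0 < t < L /\ sigma t = x.
Proof.
  intro Hx.
  destruct (IVT_cor (fun t => sigma t - x) 0 L) as (t & Ht & E).
  - intro t; apply continuity_pt_filterlim.
    apply (ex_derive_continuous (V := R_NormedModule) (fun t => sigma t - x) t).
    exists (w (clamp 0 L t) - 0).
    apply is_derive_Rminus; [apply sigma_derive|apply is_derive_Rconst].
  - lra.
  - rewrite sigma_zero, sigma_end; nra.
  - exists t; split; [|lra].
    split; apply Rnot_le_lt; intro H.
    + assert (t = 0) by lra; subst t; rewrite sigma_zero in E; lra.
    + assert (t = L) by lra; subst t; rewrite sigma_end in E; lra.
Qed.

Lemma X_sigma (t : R) : 0 < t < L -> X (sigma t) = tangent g t.
Proof.
  intro Ht; pose proof (sigma_range t Ht).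
  rewrite HXT by lra; rewrite <- (proj2 HT t) by lra.
  now rewrite sigma_arclength by lra.
Qed.

Lemma sigma_derive_in (t : R) : 0 < t < L -> is_derive sigma t (w t).
Proof.
  intro Ht; pose proof (sigma_derive t) as H; now rewrite clamp_id in H by lra.
Qed.

(** The tangent image has speed |gamma'| kappa, and T' = |gamma'| kappa N, so its unit tangent is
    N. *)
Lemma dX_sigma (t : R) : 0 < t < L -> Derive3 X (sigma t) = normal g t.
Proof.
  intro Ht.
  assert (H : is_derive3 (tangent g) t (scal3 (w t) (Derive3 X (sigma t)))).
  { apply is_derive3_ext_loc with (fun r => X (sigma r)).
    - apply (locally_open_interval 0 L t _ Ht); intros; now apply X_sigma.
    - apply is_derive3_comp; [now apply smooth13_is_derive3|].
      now apply sigma_derive_in. }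
  unfold normal, ds3 at 1; rewrite (is_derive3_unique _ _ _ H), !scal3_scal3.
  pose proof (curvature_pos t ltac:(lra)); pose proof (speed_pos t ltac:(lra)).
  rewrite tangent_speed_eq by lra.
  replace (/ curvature g t * / speed g t * (speed g t * curvature g t)) with 1
    by (field; lra).
  now rewrite scal3_one.
Qed.

Lemma dX_sigma_unit (t : R) :
  0 < t < L -> dot3 (Derive3 X (sigma t)) (Derive3 X (sigma t)) = 1.
Proof.
  intro Ht; rewrite dX_sigma by exact Ht.
  apply dot3_scal_unit; [apply Rgt_not_eq, curvature_pos; lra|].
  symmetry; apply norm3_sqr.
Qed.

Lemma X_orthonormal (x : R) : 0 < x < Lt -> orthonormal (X x) (Derive3 X x).
Proof.
  assert (H1 : forall y, 0 < y < Lt -> dot3 (X y) (X y) = 1).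
  { intros y Hy; destruct (sigma_onto y Hy) as (t & Ht & <-).
    rewrite X_sigma by exact Ht; apply tangent_unit, Hfr; lra. }
  intro Hx; split; [now apply H1|split].
  - destruct (sigma_onto x Hx) as (t & Ht & <-); now apply dX_sigma_unit.
  - assert (E : dot3 (Derive3 X x) (X x) + dot3 (X x) (Derive3 X x) = 0).
    { apply (is_derive_const_loc (fun y => dot3 (X y) (X y)) x 1).
      - now apply (locally_open_interval 0 Lt x).
      - apply is_derive_dot3; now apply smooth13_is_derive3. }
    rewrite (dot3_comm (Derive3 X x)) in E; lra.
Qed.

(** With N = X' and B = X × X', differentiating N in the arclength of gamma gives kappa X''; its
    B-component is tau, so tau / kappa is the geodesic curvature of X. *)
Lemma mod_torsion_sigma (t : R) : 0 < t < L -> mod_torsion g t = lam (sigma t).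
Proof.
  intro Ht.
  assert (H : is_derive3 (normal g) t (scal3 (w t) (Derive3 (Derive3 X) (sigma t)))).
  { apply is_derive3_ext_loc with (fun r => Derive3 X (sigma r)).
    - apply (locally_open_interval 0 L t _ Ht); intros; now apply dX_sigma.
    - apply is_derive3_comp; [now apply smooth13_is_derive3, smooth13_Derive3|].
      now apply sigma_derive_in. }
  unfold mod_torsion, torsion, ds3, binormal.
  rewrite (is_derive3_unique _ _ _ H), <- dX_sigma, <- X_sigma by exact Ht.
  rewrite scal3_scal3, tangent_speed_eq by lra; unfold lam.
  pose proof (curvature_pos t ltac:(lra)); pose proof (speed_pos t ltac:(lra)).
  replace (/ speed g t * (speed g t * curvature g t)) with (curvature g t)
    by (field; lra).
  generalize (cross3 (X (sigma t)) (Derive3 X (sigma t))) as b.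
  generalize (Derive3 (Derive3 X) (sigma t)) as a; intros a b.
  replace (dot3 (scal3 (curvature g t) a) b) with (curvature g t * dot3 a b) by r3_ring.
  field; lra.
Qed.

Let a1 (t : R) : R :=
  / 2 * ((curvature g t) ^ 2 * (1 + (mod_torsion g t) ^ 2) ^ 2 + mu).

Let a3 (t : R) : R :=
  (curvature g t) ^ 2 * (1 + (mod_torsion g t) ^ 2) ^ 2 * mod_torsion g t
  + ds g (fun r => ds g (curvature g) r / curvature g r
                   * (1 + (mod_torsion g r) ^ 2) * (2 * mod_torsion g r)) t
  + ds g (ds g (fun r => (1 + (mod_torsion g r) ^ 2) * (2 * mod_torsion g r))) t.

Lemma force_components (t : R) : 0 < t < L -> a1 t = 0 /\ a3 t = 0.
Proof.
  intro Ht; pose proof (Hforce t ltac:(lra)) as H.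
  pose proof (X_orthonormal (sigma t) (sigma_range t Ht)) as Ho.
  unfold force in H; cbv zeta in H; fold (a1 t) (a3 t) in H.
  set (a2 := _ + 2 * curvature g t * _ * _ * _) in H.
  assert (Hb : binormal g t = cross3 (X (sigma t)) (Derive3 X (sigma t)))
    by now rewrite dX_sigma, X_sigma.
  rewrite Hb, <- X_sigma, <- dX_sigma in H by exact Ht.
  change (in_frame (X (sigma t)) (Derive3 X (sigma t)) (a1 t, a2, - a3 t) = zero3) in H.
  split.
  - transitivity (dot3 (a1 t, a2, - a3 t) (1, 0, 0)); [unfold dot3; ring|].
    rewrite <- (dot3_in_frame _ _ _ _ Ho), H, dot3_eq.
    unfold zero3; cbn [fst snd]; ring.
  - transitivity (- dot3 (a1 t, a2, - a3 t) (0, 0, 1)); [unfold dot3; ring|].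
    rewrite <- (dot3_in_frame _ _ _ _ Ho), H, dot3_eq.
    unfold zero3; cbn [fst snd]; ring.
Qed.

(** The equation a_1 = 0 reads (kappa (1 + lam^2))^2 = - mu. As kappa is positive, kappa (1 + lam^2)
    is this root, and the curvature becomes the function [K] of the new parameter. *)
Let c : R := sqrt (- mu).
Let K (x : R) : R := c / (1 + lam x ^ 2).

Lemma curvature_sigma (t : R) : 0 < t < L -> curvature g t = K (sigma t).
Proof.
  intro Ht; destruct (force_components t Ht) as [H _]; unfold a1 in H.
  rewrite mod_torsion_sigma in H by exact Ht.
  pose proof (curvature_pos t ltac:(lra)) as Hk.
  unfold K, c; set (l := lam (sigma t)) in *.
  replace (- mu) with (Rsqr (curvature g t * (1 + l ^ 2))) by (unfold Rsqr; lra).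
  rewrite sqrt_Rsqr by nra; field; nra.
Qed.

(** Chain rule d/ds = kappa d/dx between the arclength s of gamma and the arclength x of the tangent
    image, with kappa written as [K]. *)
Lemma ds_sigma (h phi : R -> R) (d t : R) :
  0 < t < L -> (forall r, 0 < r < L -> h r = phi (sigma r)) ->
  is_derive phi (sigma t) d -> ds g h t = d * K (sigma t).
Proof.
  intros Ht Hh Hd.
  assert (H : is_derive h t (w t * d)).
  { apply is_derive_ext_loc with (fun r => phi (sigma r)).
    - apply (locally_open_interval 0 L t _ Ht); intros; symmetry; now apply Hh.
    - exact (is_derive_comp phi sigma t d (w t) Hd (sigma_derive_in t Ht)). }
  pose proof (curvature_pos t ltac:(lra)); pose proof (speed_pos t ltac:(lra)).
  unfold ds; rewrite (is_derive_unique _ _ _ H), tangent_speed_eq, <- curvature_sigma by lra.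
  field; lra.
Qed.

Lemma lam_smooth : smooth1 lam.
Proof.
  unfold lam; pose proof (smooth13_Derive3 _ HX) as H1.
  apply smooth1_dot3; [now apply smooth13_Derive3|now apply smooth13_cross3].
Qed.

Lemma elastic_equation (x : R) :
  0 < x < Lt -> Derive (Derive lam) x = - (lam x * (1 + lam x ^ 2) / 2).
Proof.
  intro Hx; destruct (sigma_onto x Hx) as (t & Ht & <-).
  pose proof lam_smooth as Hlam; pose proof (smooth1_Derive _ Hlam) as Hlam1.
  assert (Hc : 0 < c).
  { pose proof (curvature_sigma t Ht) as E; pose proof (curvature_pos t ltac:(lra)) as H.
    rewrite E in H; unfold K in H.
    apply Rmult_lt_reg_r with (/ (1 + lam (sigma t) ^ 2)); [|lra].
    apply Rinv_0_lt_compat; nra. }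
  assert (Hk : forall r, 0 < r < L -> ds g (curvature g) r =
     - 2 * c * lam (sigma r) * Derive lam (sigma r) / (1 + lam (sigma r) ^ 2) ^ 2
     * K (sigma r)).
  { intros r Hr; apply (ds_sigma (curvature g) K); [exact Hr|exact curvature_sigma|].
    unfold K; auto_derive.
    - split; [eexists; now apply smooth1_is_derive|split; [nra|trivial]].
    - change (fun x => lam x) with lam; field; nra. }
  (* In the parameter x, [p1] is (kappa' / kappa) (1 + lam^2) 2 lam, with the prime taken in the
     arclength of gamma, and [p3] is the derivative of [p2] in that arclength. *)
  set (p1 := fun x => - 4 * c * lam x ^ 2 * Derive lam x / (1 + lam x ^ 2)).
  set (p2 := fun x => (1 + lam x ^ 2) * (2 * lam x)).
  set (p3 := fun x => (2 + 6 * lam x ^ 2) * Derive lam x * c / (1 + lam x ^ 2)).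
  assert (Hex : forall y, ex_derive (fun x => lam x) y)
    by (intro; eexists; now apply smooth1_is_derive).
  assert (Hex1 : forall y, ex_derive (fun x => Derive (fun x => lam x) x) y)
    by (intro; eexists; exact (smooth1_is_derive (Derive lam) y Hlam1)).
  assert (Hp : ex_derive p1 (sigma t) /\ ex_derive p3 (sigma t)).
  { unfold p1, p3; split; auto_derive; repeat split; auto; nra. }
  destruct Hp as [Hp1 Hp3].
  assert (H1 : ds g (fun r => ds g (curvature g) r / curvature g r
      * (1 + (mod_torsion g r) ^ 2) * (2 * mod_torsion g r)) t
      = Derive p1 (sigma t) * K (sigma t)).
  { apply (ds_sigma _ p1); [exact Ht| |now apply Derive_correct].
    intros r Hr; rewrite Hk, mod_torsion_sigma by exact Hr; unfold p1.
    pose proof (curvature_pos r ltac:(lra)) as Hkp.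
    rewrite curvature_sigma in * by exact Hr; field; split; nra. }
  assert (H2 : forall r, 0 < r < L ->
    ds g (fun r => (1 + (mod_torsion g r) ^ 2) * (2 * mod_torsion g r)) r = p3 (sigma r)).
  { intros r Hr.
    rewrite (ds_sigma _ p2 ((2 + 6 * lam (sigma r) ^ 2) * Derive lam (sigma r)) r Hr).
    - unfold p3, K; field; nra.
    - intros q Hq; now rewrite mod_torsion_sigma.
    - unfold p2; auto_derive; [auto|].
      change (fun x => lam x) with lam; ring. }
  assert (H3 : ds g (ds g (fun r => (1 + (mod_torsion g r) ^ 2) * (2 * mod_torsion g r))) t
    = Derive p3 (sigma t) * K (sigma t)).
  { apply (ds_sigma _ p3); [exact Ht|exact H2|now apply Derive_correct]. }
  (* The numerators add up to (2 + 6 lam^2 - 4 lam^2) c lam', and 2 + 2 lam^2 cancels the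
     denominator: p1 + p3 = 2 c lam'. *)
  assert (H4 : Derive p1 (sigma t) + Derive p3 (sigma t)
    = 2 * c * Derive (Derive lam) (sigma t)).
  { rewrite <- Derive_plus by assumption.
    transitivity (Derive (fun x => 2 * c * Derive lam x) (sigma t));
      [|apply Derive_scal].
    apply Derive_ext; intro x; unfold p1, p3; field; nra. }
  destruct (force_components t Ht) as [_ H]; unfold a3 in H.
  rewrite H1, H3, curvature_sigma, mod_torsion_sigma in H by exact Ht.
  (* This is a_3 = 0 after inserting kappa = c / (1 + lam^2); the elastic equation follows since c >
     0. *)
  assert (E : c * c * (lam (sigma t) + 2 * Derive (Derive lam) (sigma t)
                         / (1 + lam (sigma t) ^ 2)) = 0).
  { rewrite <- H.
    replace (Derive p1 (sigma t)) with
      (2 * c * Derive (Derive lam) (sigma t) - Derive p3 (sigma t)) by lra.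
    unfold K; field; nra. }
  apply Rmult_integral in E; destruct E as [E|E]; [nra|].
  apply Rmult_eq_reg_r with (2 / (1 + lam (sigma t) ^ 2)).
  - transitivity (- lam (sigma t)); [lra|field; nra].
  - apply Rgt_not_eq, Rdiv_lt_0_compat; nra.
Qed.

End ArclengthTangent.

(** * Smooth vector fields of three variables *)

Definition smooth3v (A : R -> R -> R -> R3) : Prop :=
  smooth3 (fun s u v => fst (fst (A s u v))) /\
  smooth3 (fun s u v => snd (fst (A s u v))) /\
  smooth3 (fun s u v => snd (A s u v)).

Definition V1 (A : R -> R -> R -> R3) (s u v : R) : R3 := Derive3 (fun x => A x u v) s.
Definition V2 (A : R -> R -> R -> R3) (s u v : R) : R3 := Derive3 (fun x => A s x v) u.
Definition V3 (A : R -> R -> R -> R3) (s u v : R) : R3 := Derive3 (fun x => A s u x) v.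

Lemma smooth3v_V1 (A : R -> R -> R -> R3) : smooth3v A -> smooth3v (V1 A).
Proof. intros (H1 & H2 & H3); split; [|split];
    [exact (smooth3_D1 _ H1)|exact (smooth3_D1 _ H2)|exact (smooth3_D1 _ H3)]. Qed.

Lemma smooth3v_V2 (A : R -> R -> R -> R3) : smooth3v A -> smooth3v (V2 A).
Proof. intros (H1 & H2 & H3); split; [|split];
    [exact (smooth3_D2 _ H1)|exact (smooth3_D2 _ H2)|exact (smooth3_D2 _ H3)]. Qed.

Lemma smooth3v_V3 (A : R -> R -> R -> R3) : smooth3v A -> smooth3v (V3 A).
Proof. intros (H1 & H2 & H3); split; [|split];
    [exact (smooth3_D3 _ H1)|exact (smooth3_D3 _ H2)|exact (smooth3_D3 _ H3)]. Qed.

Lemma is_derive3_V1 (A : R -> R -> R -> R3) (s u v : R) :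
  smooth3v A -> is_derive3 (fun x => A x u v) s (V1 A s u v).
Proof.
  intros (H1 & H2 & H3); split; [|split];
    [exact (is_derive_D1 _ s u v H1)|exact (is_derive_D1 _ s u v H2)
    |exact (is_derive_D1 _ s u v H3)].
Qed.

Lemma is_derive3_V2 (A : R -> R -> R -> R3) (s u v : R) :
  smooth3v A -> is_derive3 (fun x => A s x v) u (V2 A s u v).
Proof.
  intros (H1 & H2 & H3); split; [|split];
    [exact (is_derive_D2 _ s u v H1)|exact (is_derive_D2 _ s u v H2)
    |exact (is_derive_D2 _ s u v H3)].
Qed.

Lemma is_derive3_V3 (A : R -> R -> R -> R3) (s u v : R) :
  smooth3v A -> is_derive3 (fun x => A s u x) v (V3 A s u v).
Proof.
  intros (H1 & H2 & H3); split; [|split];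
    [exact (is_derive_D3 _ s u v H1)|exact (is_derive_D3 _ s u v H2)
    |exact (is_derive_D3 _ s u v H3)].
Qed.

Lemma R3_ext (x y : R3) :
  fst (fst x) = fst (fst y) -> snd (fst x) = snd (fst y) -> snd x = snd y -> x = y.
Proof. now destruct x as [[? ?] ?], y as [[? ?] ?]; cbn; intros -> -> ->. Qed.

Lemma V12_comm (A : R -> R -> R -> R3) (s u v : R) :
  smooth3v A -> V1 (V2 A) s u v = V2 (V1 A) s u v.
Proof.
  intros (H1 & H2 & H3); apply R3_ext;
    [exact (D12_comm _ s u v H1)|exact (D12_comm _ s u v H2)|exact (D12_comm _ s u v H3)].
Qed.

Lemma V13_comm (A : R -> R -> R -> R3) (s u v : R) :
  smooth3v A -> V1 (V3 A) s u v = V3 (V1 A) s u v.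
Proof.
  intros (H1 & H2 & H3); apply R3_ext;
    [exact (D13_comm _ s u v H1)|exact (D13_comm _ s u v H2)|exact (D13_comm _ s u v H3)].
Qed.

Lemma V23_comm (A : R -> R -> R -> R3) (s u v : R) :
  smooth3v A -> V2 (V3 A) s u v = V3 (V2 A) s u v.
Proof.
  intros (H1 & H2 & H3); apply R3_ext;
    [exact (D23_comm _ s u v H1)|exact (D23_comm _ s u v H2)|exact (D23_comm _ s u v H3)].
Qed.

Lemma smooth3_ext (f g : R -> R -> R -> R) :
  (forall s u v, f s u v = g s u v) -> smooth3 f -> smooth3 g.
Proof. intros E H; replace g with f; [exact H|fun_ext3; apply E]. Qed.

Lemma smooth3_dot3 (A B : R -> R -> R -> R3) :
  smooth3v A -> smooth3v B -> smooth3 (fun s u v => dot3 (A s u v) (B s u v)).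
Proof.
  intros (F1 & F2 & F3) (G1 & G2 & G3).
  eapply smooth3_ext; [intros; symmetry; apply dot3_eq|]; smooth3_poly.
Qed.

Lemma smooth3v_cross3 (A B : R -> R -> R -> R3) :
  smooth3v A -> smooth3v B -> smooth3v (fun s u v => cross3 (A s u v) (B s u v)).
Proof.
  intros (F1 & F2 & F3) (G1 & G2 & G3); split; [|split];
    (eapply smooth3_ext; [intros; rewrite cross3_eq; reflexivity|]; cbn [fst snd];
     smooth3_poly).
Qed.

Lemma smooth3v_add3 (A B : R -> R -> R -> R3) :
  smooth3v A -> smooth3v B -> smooth3v (fun s u v => add3 (A s u v) (B s u v)).
Proof.
  intros (F1 & F2 & F3) (G1 & G2 & G3); split; [|split];
    (eapply smooth3_ext; [intros; rewrite add3_eq; reflexivity|]; cbn [fst snd];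
     smooth3_poly).
Qed.

Lemma smooth3v_scal3 (f : R -> R -> R -> R) (A : R -> R -> R -> R3) :
  smooth3 f -> smooth3v A -> smooth3v (fun s u v => scal3 (f s u v) (A s u v)).
Proof.
  intros Hf (F1 & F2 & F3); split; [|split];
    (eapply smooth3_ext; [intros; rewrite scal3_eq; reflexivity|]; cbn [fst snd];
     smooth3_poly).
Qed.

(** * The first variation of the Willmore integrand *)

Definition gram3 (x y : R3) : R := dot3 (cross3 x y) (cross3 x y).

(* For a surface [f] in S^3 with [f_u = x f] and [f_v = y f] (quaternion products),
   [shape3 x y x_u x_v y_v] is, up to sign, twice the mean curvature times
   [gram3 x y ^ (3/2)]. *)
Definition shape3 (x y xu xv yv : R3) : R :=
  dot3 x x * dot3 yv (cross3 x y)
  - 2 * dot3 x y * (dot3 xv (cross3 x y) + gram3 x y)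
  + dot3 y y * dot3 xu (cross3 x y).

Definition dcross3 (x y dx dy : R3) : R3 := add3 (cross3 dx y) (cross3 x dy).

Definition dgram3 (x y dx dy : R3) : R := 2 * dot3 (dcross3 x y dx dy) (cross3 x y).

Definition dshape3 (x y xu xv yv dx dy dxu dxv dyv : R3) : R :=
  2 * dot3 x dx * dot3 yv (cross3 x y)
  + dot3 x x * (dot3 dyv (cross3 x y) + dot3 yv (dcross3 x y dx dy))
  - 2 * (dot3 dx y + dot3 x dy) * (dot3 xv (cross3 x y) + gram3 x y)
  - 2 * dot3 x y * (dot3 dxv (cross3 x y) + dot3 xv (dcross3 x y dx dy)
                    + dgram3 x y dx dy)
  + 2 * dot3 y dy * dot3 xu (cross3 x y)
  + dot3 y y * (dot3 dxu (cross3 x y) + dot3 xu (dcross3 x y dx dy)).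

Lemma in_frame_e1 (t n : R3) : t = in_frame t n (1, 0, 0).
Proof. unfold in_frame; r3_ring. Qed.

Lemma in_frame_add3 (t n x y : R3) :
  add3 (in_frame t n x) (in_frame t n y) = in_frame t n (add3 x y).
Proof. unfold in_frame; r3_ring. Qed.

Lemma in_frame_scal3 (t n : R3) (k : R) (x : R3) :
  scal3 k (in_frame t n x) = in_frame t n (scal3 k x).
Proof. unfold in_frame; r3_ring. Qed.

(** [in_frame t n] is a rotation, and the integrand and its variation are built from dot and cross
    products; so they may be evaluated on frame coordinates. *)
Lemma gram3_in_frame (t n x y : R3) :
  orthonormal t n -> gram3 (in_frame t n x) (in_frame t n y) = gram3 x y.
Proof. intro H; unfold gram3; now rewrite cross3_in_frame, dot3_in_frame. Qed.

Lemma dgram3_in_frame (t n x y dx dy : R3) :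
  orthonormal t n ->
  dgram3 (in_frame t n x) (in_frame t n y) (in_frame t n dx) (in_frame t n dy)
  = dgram3 x y dx dy.
Proof.
  intro H; unfold dgram3, dcross3.
  now rewrite !cross3_in_frame, in_frame_add3, dot3_in_frame.
Qed.

Lemma shape3_in_frame (t n x y xu xv yv : R3) :
  orthonormal t n ->
  shape3 (in_frame t n x) (in_frame t n y) (in_frame t n xu) (in_frame t n xv)
    (in_frame t n yv) = shape3 x y xu xv yv.
Proof.
  intro H; unfold shape3.
  now rewrite gram3_in_frame, !cross3_in_frame, !dot3_in_frame.
Qed.

Lemma dshape3_in_frame (t n x y xu xv yv dx dy dxu dxv dyv : R3) :
  orthonormal t n ->
  dshape3 (in_frame t n x) (in_frame t n y) (in_frame t n xu) (in_frame t n xv)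
    (in_frame t n yv) (in_frame t n dx) (in_frame t n dy) (in_frame t n dxu)
    (in_frame t n dxv) (in_frame t n dyv) = dshape3 x y xu xv yv dx dy dxu dxv dyv.
Proof.
  intro H; unfold dshape3.
  rewrite dgram3_in_frame, gram3_in_frame by exact H; unfold dcross3.
  now rewrite !cross3_in_frame, !in_frame_add3, !dot3_in_frame.
Qed.

Lemma is_derive_gram3 (A B : R -> R3) (s : R) (a b : R3) :
  is_derive3 A s a -> is_derive3 B s b ->
  is_derive (fun x => gram3 (A x) (B x)) s (dgram3 (A s) (B s) a b).
Proof.
  intros HA HB; pose proof (is_derive3_cross3 _ _ _ _ _ HA HB) as HC.
  eapply is_derive_R; [exact (is_derive_dot3 _ _ _ _ _ HC HC)|].
  unfold dgram3, dcross3; cbv beta.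
  generalize (cross3 a (B s)) (cross3 (A s) b) (cross3 (A s) (B s)); r3_ring.
Qed.

Lemma is_derive_shape3 (A B Au Av Bv : R -> R3) (s : R) (a b au av bv : R3) :
  is_derive3 A s a -> is_derive3 B s b -> is_derive3 Au s au -> is_derive3 Av s av ->
  is_derive3 Bv s bv ->
  is_derive (fun x => shape3 (A x) (B x) (Au x) (Av x) (Bv x)) s
    (dshape3 (A s) (B s) (Au s) (Av s) (Bv s) a b au av bv).
Proof.
  intros HA HB HAu HAv HBv.
  pose proof (is_derive3_cross3 _ _ _ _ _ HA HB) as HC.
  pose proof (is_derive_gram3 _ _ _ _ _ HA HB) as HG.
  pose proof (is_derive_dot3 _ _ _ _ _ HA HA) as HAA.
  pose proof (is_derive_dot3 _ _ _ _ _ HA HB) as HAB.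
  pose proof (is_derive_dot3 _ _ _ _ _ HB HB) as HBB.
  pose proof (is_derive_dot3 _ _ _ _ _ HBv HC) as H1.
  pose proof (is_derive_dot3 _ _ _ _ _ HAv HC) as H2.
  pose proof (is_derive_dot3 _ _ _ _ _ HAu HC) as H3.
  unfold shape3; eapply is_derive_R; [derive_poly|].
  cbv beta; unfold dshape3, dcross3.
  rewrite (dot3_comm a (A s)), (dot3_comm b (B s)); ring.
Qed.

(** The central identity. Here a, b, c are the frame components of [xi], the suffixes u and v denote
    partial derivatives, and l, l1, l2 are lam and its first two derivatives. The vectors [dx] and
    [dy] are al_s and be_s from the structure equations; [xu] and [dxu] contain the terms due to the
    turning of the frame. The coefficients on the left come from [ddensity_value]. Up to the sign
    [sg], the first group on the right is the u-derivative of the flux component [P] and the second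
    the v-derivative of [Q]. *)
Lemma willmore_integrand_variation (p pu pv r ru rv l l1 l2 a au av auu auv avv b bu bv buu buv bvv c cu cv cuu cuv cvv : R) :
  r <> 0 -> pv = ru -> l2 = - (l * (1 + l ^ 2) / 2) ->
  let x1 := au in let x2 := bu - l * c + 2 * p * c in let x3 := cu + l * b - 2 * p * b in
  let x1u := auu in
  let x2u := buu - l1 * c - l * cu + 2 * pu * c + 2 * p * cu in
  let x3u := cuu + l1 * b + l * bu - 2 * pu * b - 2 * p * bu in
  let x1v := auv in
  let x2v := buv - l * cv + 2 * pv * c + 2 * p * cv in
  let x3v := cuv + l * bv - 2 * pv * b - 2 * p * bv in
  let dx : R3 := (x1, x2, x3) in
  let dxu : R3 := (x1u - x2, x1 + x2u - l * x3, l * x2 + x3u) in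
  let dxv : R3 := (x1v, x2v, x3v) in
  let dy : R3 := (av, bv + 2 * r * c, cv - 2 * r * b) in
  let dyv : R3 := (avv, bvv + 2 * rv * c + 2 * r * cv, cvv - 2 * rv * b - 2 * r * bv) in
  let x : R3 := (p, 0, / 2) in let y : R3 := (r, 0, 0) in
  let xu : R3 := (pu, p - l / 2, 0) in
  let xv : R3 := (pv, 0, 0) in
  let yv : R3 := (rv, 0, 0) in
  - 4 * l / r ^ 2 * dshape3 x y xu xv yv dx dy dxu dxv dyv
  + (1 - 5 * l ^ 2) / r * dgram3 x y dx dy
  = (cu * (1 + l ^ 2) * r + c * 2 * l * l1 * r + c * (1 + l ^ 2) * ru
     - (2 * ru * (l * bu - b * l1) + 2 * r * (l * buu - b * l2)
            - 2 * pu * l * bv - 2 * p * l1 * bv - 2 * p * l * buv))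
  + ((1 + l ^ 2) * (av - 2 * cv * p - 2 * c * pv) / 2
     - (- 2 * pv * (l * bu - b * l1) - 2 * p * (l * buv - bv * l1)
            + (8 * p * pv * r - (4 * p ^ 2 + 1) * rv) / (2 * r ^ 2) * l * bv
            + (4 * p ^ 2 + 1) / (2 * r) * l * bvv)).
Proof.
  intros Hr Hpv Hl2; cbv zeta; subst pv l2.
  unfold dshape3, dgram3, dcross3, gram3, add3, cross3, dot3.
  field_simplify_eq; [|exact Hr].
  ring.
Qed.

(* [(H^2 + 1) dA] for [m = shape3 ...] and [q = gram3 ...] *)
Definition density (m q : R) : R := (m ^ 2 / (4 * q ^ 3) + 1) * sqrt q.

Definition ddensity (m q dm dq : R) : R :=
  (m * dm / (2 * q ^ 3) - 3 * m ^ 2 * dq / (4 * q ^ 4)) * sqrt q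
  + (m ^ 2 / (4 * q ^ 3) + 1) * (dq / (2 * sqrt q)).

Lemma is_derive_density (m q : R -> R) (s dm dq : R) :
  is_derive m s dm -> is_derive q s dq -> 0 < q s ->
  is_derive (fun x => density (m x) (q x)) s (ddensity (m s) (q s) dm dq).
Proof.
  intros Hm Hq Hpos; unfold density, ddensity.
  pose proof (sqrt_lt_R0 _ Hpos) as Hs.
  auto_derive.
  - repeat split; [eexists; exact Hm|eexists; exact Hq| |eexists; exact Hq|exact Hpos].
    apply Rgt_not_eq; repeat apply Rmult_lt_0_compat; lra.
  - change (fun x => m x) with m; change (fun x => q x) with q.
    rewrite (is_derive_unique _ _ _ Hm), (is_derive_unique _ _ _ Hq).
    field; lra.
Qed.

Lemma sign_mult_pos (x : R) : x <> 0 -> 0 < sign x * x.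
Proof.
  intro H; destruct (Rlt_le_dec 0 x).
  - rewrite sign_eq_1; lra.
  - rewrite sign_eq_m1; lra.
Qed.

Lemma sign_cases (x : R) : x <> 0 -> sign x = 1 \/ sign x = -1.
Proof.
  intro H; destruct (Rlt_le_dec 0 x).
  - left; apply sign_eq_1; lra.
  - right; apply sign_eq_m1; lra.
Qed.

(** The first two arguments are the values of [shape3] and [gram3] on the frame cylinder; the
    squared mean curvature is then l^2, and [sg] resolves sqrt (r^2) = |r|. *)
Lemma ddensity_value (sg r l dm dq : R) :
  sg = 1 \/ sg = -1 -> 0 < sg * r ->
  ddensity (- r ^ 3 * l / 4) (r ^ 2 / 4) dm dq
  = sg * (- 4 * l / r ^ 2 * dm + (1 - 5 * l ^ 2) / r * dq).
Proof.
  intros Hsg Hr; unfold ddensity.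
  assert (E : sqrt (r ^ 2 / 4) = sg * r / 2).
  { replace (r ^ 2 / 4) with (Rsqr (sg * r / 2)) by (unfold Rsqr; destruct Hsg; subst; field).
    apply sqrt_Rsqr; lra. }
  rewrite E; destruct Hsg; subst; field; lra.
Qed.

(** * The first variation in the moving frame of the tangent image *)

Section FirstVariation.

(** No quaternions occur in this section. The family enters through the structure equations at s =
    0, the two relations saying that the Hopf image of (u, v) is [X u], periodicity and support.
    Derivatives in s are always traded for derivatives of [xi], so these relations at s = 0
    suffice. *)
Context (L : R) (al be xi : R -> R -> R -> R3) (X : R -> R3).
Context (HL : 0 < L) (Hal : smooth3v al) (Hbe : smooth3v be) (Hxi : smooth3v xi)
  (HX : smooth13 X).

Let lam (x : R) : R := dot3 (Derive3 (Derive3 X) x) (cross3 (X x) (Derive3 X x)).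

Context (Hon : forall u, 0 < u < L -> orthonormal (X u) (Derive3 X u)).
Context (Hode : forall u, 0 < u < L ->
  Derive (Derive lam) u = - (lam u * (1 + lam u ^ 2) / 2)).
Context (Hcompat : forall u v, 0 < u < L ->
  V3 al 0 u v = add3 (V2 be 0 u v) (scal3 (-2) (cross3 (al 0 u v) (be 0 u v)))).
Context (Hdal : forall u v, 0 < u < L ->
  V1 al 0 u v = add3 (V2 xi 0 u v) (scal3 (-2) (cross3 (al 0 u v) (xi 0 u v)))).
Context (Hdbe : forall u v, 0 < u < L ->
  V1 be 0 u v = add3 (V3 xi 0 u v) (scal3 (-2) (cross3 (be 0 u v) (xi 0 u v)))).
Context (HalX : forall u v, 0 < u < L ->
  scal3 2 (cross3 (al 0 u v) (X u)) = Derive3 X u).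
Context (HbeX : forall u v, 0 < u < L -> cross3 (be 0 u v) (X u) = zero3).
Context (Hbe0 : forall u v, 0 < u < L -> be 0 u v <> zero3).
Context (Hper_al : forall u v, 0 < u < L -> al 0 u (v + 2 * PI) = al 0 u v).
Context (Hper_be : forall u v, 0 < u < L -> be 0 u (v + 2 * PI) = be 0 u v).
Context (Hper_xi : forall u v, 0 < u < L -> xi 0 u (v + 2 * PI) = xi 0 u v).
Context (delta : R) (Hdelta : 0 < delta).
Context (Hsupp : forall u v, 0 < u < L -> u <= delta \/ L - delta <= u ->
  xi 0 u v = zero3).

Let p (s u v : R) : R := dot3 (al s u v) (X u).
Let r (s u v : R) : R := dot3 (be s u v) (X u).
Let a (s u v : R) : R := dot3 (xi s u v) (X u).
Let b (s u v : R) : R := dot3 (xi s u v) (Derive3 X u).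
Let c (s u v : R) : R := dot3 (xi s u v) (cross3 (X u) (Derive3 X u)).
Let l (s u v : R) : R := lam u.

Lemma lift_smooth13 (Y : R -> R3) : smooth13 Y -> smooth3v (fun _ u _ => Y u).
Proof. exact (fun H => H). Qed.

Let HX1 : smooth13 (Derive3 X) := smooth13_Derive3 _ HX.

Lemma l_smooth : smooth3 l.
Proof.
  apply (smooth1_dot3 (Derive3 (Derive3 X)) (fun x => cross3 (X x) (Derive3 X x))).
  - now apply smooth13_Derive3.
  - now apply smooth13_cross3.
Qed.

Lemma p_smooth : smooth3 p.
Proof. exact (smooth3_dot3 _ _ Hal (lift_smooth13 _ HX)). Qed.

Lemma r_smooth : smooth3 r.
Proof. exact (smooth3_dot3 _ _ Hbe (lift_smooth13 _ HX)). Qed.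

Lemma a_smooth : smooth3 a.
Proof. exact (smooth3_dot3 _ _ Hxi (lift_smooth13 _ HX)). Qed.

Lemma b_smooth : smooth3 b.
Proof. exact (smooth3_dot3 _ _ Hxi (lift_smooth13 _ HX1)). Qed.

Lemma c_smooth : smooth3 c.
Proof.
  exact (smooth3_dot3 _ _ Hxi (lift_smooth13 _ (smooth13_cross3 _ _ HX HX1))).
Qed.

Let fr (u : R) : R3 -> R3 := in_frame (X u) (Derive3 X u).

(** Frenet equation X'' = - X + lam X × X' of a unit-speed curve on the sphere, obtained by
    differentiating the orthonormality relations. *)
Lemma X2_frame (u : R) : 0 < u < L -> Derive3 (Derive3 X) u = fr u (-1, 0, lam u).
Proof.
  intro Hu; pose proof (Hon u Hu) as Ho.
  unfold fr; rewrite (frame_expansion (X u) (Derive3 X u) (Derive3 (Derive3 X) u) Ho) at 1.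
  fold (lam u); f_equal.
  pose proof (smooth13_is_derive3 X u HX) as D0.
  pose proof (smooth13_is_derive3 _ u HX1) as D1.
  assert (E1 : dot3 (Derive3 X u) (Derive3 X u) + dot3 (X u) (Derive3 (Derive3 X) u) = 0).
  { apply (is_derive_const_loc (fun y => dot3 (X y) (Derive3 X y)) u 0).
    - apply (locally_open_interval 0 L u _ Hu); intros y Hy; apply (Hon y Hy).
    - now apply is_derive_dot3. }
  assert (E2 : dot3 (Derive3 (Derive3 X) u) (Derive3 X u)
               + dot3 (Derive3 X u) (Derive3 (Derive3 X) u) = 0).
  { apply (is_derive_const_loc (fun y => dot3 (Derive3 X y) (Derive3 X y)) u 1).
    - apply (locally_open_interval 0 L u _ Hu); intros y Hy; apply (Hon y Hy).
    - now apply is_derive_dot3. }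
  destruct Ho as (_ & Hn & _); rewrite Hn, dot3_comm in E1.
  rewrite (dot3_comm (Derive3 X u)) in E2.
  repeat (apply injective_projections; cbn [fst snd]); lra.
Qed.

(** The frame turns with u: X' is its second vector, X'' is given by [X2_frame], and (X × X')' = -
    lam X'. These produce the undifferentiated terms; in [frame_V3] there are none, as the frame
    does not depend on v. *)
Lemma frame_V2 (A : R -> R -> R -> R3) (a1 a2 a3 : R -> R -> R -> R) :
  smooth3 a1 -> smooth3 a2 -> smooth3 a3 ->
  (forall u v, 0 < u < L -> A 0 u v = fr u (a1 0 u v, a2 0 u v, a3 0 u v)) ->
  forall u v, 0 < u < L ->
  V2 A 0 u v = fr u (D2 a1 0 u v - a2 0 u v,
                     a1 0 u v + D2 a2 0 u v - lam u * a3 0 u v,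
                     lam u * a2 0 u v + D2 a3 0 u v).
Proof.
  intros H1 H2 H3 HA u v Hu; pose proof (Hon u Hu) as Ho.
  apply is_derive3_unique.
  pose proof (smooth13_is_derive3 X u HX) as D0.
  pose proof (smooth13_is_derive3 _ u HX1) as D1.
  apply is_derive3_ext_loc with (fun y => fr y (a1 0 y v, a2 0 y v, a3 0 y v)).
  { apply (locally_open_interval 0 L u _ Hu); intros y Hy; symmetry; now apply HA. }
  pose proof (is_derive3_cross3 _ _ _ _ _ D0 D1) as DC.
  pose proof (is_derive3_scal3 _ _ _ _ _ (is_derive_D2 a1 0 u v H1) D0) as E1.
  pose proof (is_derive3_scal3 _ _ _ _ _ (is_derive_D2 a2 0 u v H2) D1) as E2.
  pose proof (is_derive3_scal3 _ _ _ _ _ (is_derive_D2 a3 0 u v H3) DC) as E3.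
  pose proof (is_derive3_add3 _ _ _ _ _ E1 (is_derive3_add3 _ _ _ _ _ E2 E3)) as E.
  cbv beta in E.
  assert (HC : cross3 (X u) (Derive3 (Derive3 X) u) = fr u (0, - lam u, 0)).
  { rewrite (X2_frame u Hu), (in_frame_e1 (X u) (Derive3 X u)) at 1.
    unfold fr; rewrite cross3_in_frame by exact Ho; f_equal; r3_ring. }
  rewrite HC, (X2_frame u Hu) in E.
  match type of E with is_derive3 _ _ ?w =>
    replace (fr u _) with w; [exact E|] end.
  unfold fr, in_frame; generalize (X u) (Derive3 X u); r3_ring.
Qed.

Lemma frame_V3 (A : R -> R -> R -> R3) (a1 a2 a3 : R -> R -> R -> R) :
  smooth3 a1 -> smooth3 a2 -> smooth3 a3 ->
  (forall u v, 0 < u < L -> A 0 u v = fr u (a1 0 u v, a2 0 u v, a3 0 u v)) ->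
  forall u v, 0 < u < L ->
  V3 A 0 u v = fr u (D3 a1 0 u v, D3 a2 0 u v, D3 a3 0 u v).
Proof.
  intros H1 H2 H3 HA u v Hu.
  apply is_derive3_unique.
  apply is_derive3_ext_loc with (fun y => fr u (a1 0 u y, a2 0 u y, a3 0 u y)).
  { apply filter_forall; intro y; symmetry; now apply HA. }
  assert (Hc : forall x : R3, is_derive3 (fun _ => x) v zero3)
    by (intro x; split; [|split]; apply is_derive_Rconst).
  pose proof (is_derive3_scal3 _ _ _ _ _ (is_derive_D3 a1 0 u v H1) (Hc (X u))) as E1.
  pose proof (is_derive3_scal3 _ _ _ _ _ (is_derive_D3 a2 0 u v H2) (Hc (Derive3 X u))) as E2.
  pose proof (is_derive3_scal3 _ _ _ _ _ (is_derive_D3 a3 0 u v H3)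
    (Hc (cross3 (X u) (Derive3 X u)))) as E3.
  pose proof (is_derive3_add3 _ _ _ _ _ E1 (is_derive3_add3 _ _ _ _ _ E2 E3)) as E.
  cbv beta in E.
  match type of E with is_derive3 _ _ ?w =>
    replace (fr u _) with w; [exact E|] end.
  unfold fr, in_frame; generalize (X u) (Derive3 X u); r3_ring.
Qed.

Lemma triple_product (x y z : R3) : dot3 x (cross3 y z) = dot3 (cross3 x y) z.
Proof. r3_ring. Qed.

(** The relation 2 al × X = X' fixes [al] up to a multiple of X. The remaining component [p] is
    free: it records how the parametrization of the fibres shifts with u. *)
Lemma al_frame (u v : R) : 0 < u < L -> al 0 u v = fr u (p 0 u v, 0, / 2).
Proof.
  intro Hu; unfold fr.
  rewrite (frame_expansion (X u) (Derive3 X u) (al 0 u v) (Hon u Hu)) at 1; f_equal.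
  destruct (Hon u Hu) as (_ & Hn & _).
  assert (E2 : dot3 (al 0 u v) (Derive3 X u) = 0).
  { rewrite <- (HalX u v Hu); generalize (al 0 u v) (X u); r3_ring. }
  assert (E3 : 2 * dot3 (al 0 u v) (cross3 (X u) (Derive3 X u)) = 1).
  { rewrite triple_product, <- Hn; rewrite <- (HalX u v Hu) at 3.
    generalize (cross3 (al 0 u v) (X u)) (Derive3 X u); r3_ring. }
  unfold p; rewrite E2; repeat (apply injective_projections; cbn [fst snd]); lra.
Qed.

Lemma be_frame (u v : R) : 0 < u < L -> be 0 u v = fr u (r 0 u v, 0, 0).
Proof.
  intro Hu; unfold fr.
  rewrite (frame_expansion (X u) (Derive3 X u) (be 0 u v) (Hon u Hu)) at 1; f_equal.
  assert (E2 : dot3 (be 0 u v) (Derive3 X u) = 0).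
  { rewrite <- (HalX u v Hu).
    (* After X' has been replaced by 2 al × X, the triple product moves the cross product onto [be],
       where it vanishes. *)
    transitivity (- 2 * dot3 (al 0 u v) (cross3 (be 0 u v) (X u))).
    - generalize (al 0 u v) (X u) (be 0 u v); r3_ring.
    - rewrite HbeX by exact Hu; generalize (al 0 u v); r3_ring. }
  assert (E3 : dot3 (be 0 u v) (cross3 (X u) (Derive3 X u)) = 0).
  { rewrite triple_product, HbeX by exact Hu; generalize (Derive3 X u); r3_ring. }
  now rewrite E2, E3.
Qed.

Lemma xi_frame (u v : R) : 0 < u < L -> xi 0 u v = fr u (a 0 u v, b 0 u v, c 0 u v).
Proof. intro Hu; apply frame_expansion, Hon, Hu. Qed.

Lemma r_neq0 (u v : R) : 0 < u < L -> r 0 u v <> 0.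
Proof.
  intros Hu E; apply (Hbe0 u v Hu).
  rewrite be_frame, E by exact Hu; unfold fr, in_frame.
  generalize (X u) (Derive3 X u); r3_ring.
Qed.

(** The sign at one interior point is the sign everywhere ([sg_r]), so |r| = sg r is smooth and a
    single flux serves the whole cylinder. *)
Let sg : R := sign (r 0 (L / 2) 0).

Lemma sg_cases : sg = 1 \/ sg = -1.
Proof. apply sign_cases, r_neq0; lra. Qed.

(** A change of sign along the segment from (L / 2, 0) to (u, v) would produce a zero of r over an
    interior point. *)
Lemma sg_r (u v : R) : 0 < u < L -> 0 < sg * r 0 u v.
Proof.
  intro Hu; apply Rnot_le_lt; intro Hle.
  set (k := fun t => r 0 (L / 2 + t * (u - L / 2)) (t * v)).
  assert (Hk0 : 0 < sg * k 0).
  { unfold k; replace (L / 2 + 0 * (u - L / 2)) with (L / 2) by ring.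
    rewrite Rmult_0_l; apply sign_mult_pos, r_neq0; lra. }
  assert (Hk1 : sg * k 1 <= 0).
  { unfold k; replace (L / 2 + 1 * (u - L / 2)) with u by ring.
    now rewrite Rmult_1_l. }
  destruct (IVT_cor k 0 1) as (t & Ht & E).
  - intro t; apply continuity_pt_filterlim.
    apply (C3_slice r (fun _ => 0) (fun t => L / 2 + t * (u - L / 2)) (fun t => t * v)).
    + exact (smooth3_C3 _ r_smooth).
    + apply continuous_const.
    + apply (ex_derive_continuous (V := R_NormedModule)
               (fun t => L / 2 + t * (u - L / 2)) t); auto_derive; trivial.
    + apply (ex_derive_continuous (V := R_NormedModule) (fun t => t * v) t);
        auto_derive; trivial.
  - lra.
  - destruct sg_cases as [Es|Es]; rewrite Es in *; nra.
  - revert E; apply r_neq0; nra.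
Qed.

(** Second and third frame components of al_s = xi_u - 2 al × xi. The terms - b and a from the
    turning frame cancel against the component 1/2 of [al], so the first component is just a_u. *)
Let x2 (s u v : R) : R :=
  D2 b s u v - l s u v * c s u v + 2 * p s u v * c s u v.
Let x3 (s u v : R) : R :=
  D2 c s u v + l s u v * b s u v - 2 * p s u v * b s u v.
Let y2 (s u v : R) : R := D3 b s u v + 2 * r s u v * c s u v.
Let y3 (s u v : R) : R := D3 c s u v - 2 * r s u v * b s u v.

Ltac known_smooth :=
  pose proof p_smooth; pose proof r_smooth; pose proof a_smooth; pose proof b_smooth;
  pose proof c_smooth; pose proof l_smooth;
  pose proof (smooth3_D2 _ a_smooth); pose proof (smooth3_D2 _ b_smooth);
  pose proof (smooth3_D2 _ c_smooth);
  pose proof (smooth3_D3 _ a_smooth); pose proof (smooth3_D3 _ b_smooth);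
  pose proof (smooth3_D3 _ c_smooth);
  pose proof (smooth3_D2 _ l_smooth).

Lemma x2_smooth : smooth3 x2.
Proof. known_smooth; unfold x2; smooth3_poly. Qed.

Lemma x3_smooth : smooth3 x3.
Proof. known_smooth; unfold x3; smooth3_poly. Qed.

Lemma y2_smooth : smooth3 y2.
Proof. known_smooth; unfold y2; smooth3_poly. Qed.

Lemma y3_smooth : smooth3 y3.
Proof. known_smooth; unfold y3; smooth3_poly. Qed.

Lemma dal_frame (u v : R) : 0 < u < L ->
  V1 al 0 u v = fr u (D2 a 0 u v, x2 0 u v, x3 0 u v).
Proof.
  intro Hu; rewrite Hdal by exact Hu.
  rewrite (frame_V2 xi a b c a_smooth b_smooth c_smooth xi_frame u v Hu).
  rewrite al_frame, xi_frame by exact Hu; unfold fr.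
  rewrite cross3_in_frame by (now apply Hon).
  rewrite in_frame_scal3, in_frame_add3; f_equal; unfold x2, x3, l.
  unfold add3, scal3, cross3; repeat (apply injective_projections; cbn [fst snd]); field.
Qed.

Lemma dbe_frame (u v : R) : 0 < u < L ->
  V1 be 0 u v = fr u (D3 a 0 u v, y2 0 u v, y3 0 u v).
Proof.
  intro Hu; rewrite Hdbe by exact Hu.
  rewrite (frame_V3 xi a b c a_smooth b_smooth c_smooth xi_frame u v Hu).
  rewrite be_frame, xi_frame by exact Hu; unfold fr.
  rewrite cross3_in_frame by (now apply Hon).
  rewrite in_frame_scal3, in_frame_add3; f_equal; unfold y2, y3.
  unfold add3, scal3, cross3; repeat (apply injective_projections; cbn [fst snd]); ring.
Qed.

Lemma D2_const (k u v : R) : D2 (fun _ _ _ => k) 0 u v = 0.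
Proof. exact (Derive_const k u). Qed.

Lemma D3_const (k u v : R) : D3 (fun _ _ _ => k) 0 u v = 0.
Proof. exact (Derive_const k v). Qed.

Lemma al_u_frame (u v : R) : 0 < u < L ->
  V2 al 0 u v = fr u (D2 p 0 u v, p 0 u v - lam u / 2, 0).
Proof.
  intro Hu.
  rewrite (frame_V2 al p (fun _ _ _ => 0) (fun _ _ _ => / 2) p_smooth
    (smooth3_const 0) (smooth3_const (/ 2)) al_frame u v Hu), !D2_const.
  f_equal; repeat (apply injective_projections; cbn [fst snd]); field.
Qed.

Lemma al_v_frame (u v : R) : 0 < u < L -> V3 al 0 u v = fr u (D3 p 0 u v, 0, 0).
Proof.
  intro Hu.
  now rewrite (frame_V3 al p (fun _ _ _ => 0) (fun _ _ _ => / 2) p_smooth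
    (smooth3_const 0) (smooth3_const (/ 2)) al_frame u v Hu), !D3_const.
Qed.

Lemma be_v_frame (u v : R) : 0 < u < L -> V3 be 0 u v = fr u (D3 r 0 u v, 0, 0).
Proof.
  intro Hu.
  now rewrite (frame_V3 be r (fun _ _ _ => 0) (fun _ _ _ => 0) r_smooth
    (smooth3_const 0) (smooth3_const 0) be_frame u v Hu), !D3_const.
Qed.

(** The one-form p du + r dv is closed: this is the X-component of the structure equation, to which
    al × be contributes nothing. *)
Lemma p_v_eq_r_u (u v : R) : 0 < u < L -> D3 p 0 u v = D2 r 0 u v.
Proof.
  intro Hu; pose proof (Hcompat u v Hu) as E.
  rewrite (frame_V2 be r (fun _ _ _ => 0) (fun _ _ _ => 0) r_smooth
    (smooth3_const 0) (smooth3_const 0) be_frame u v Hu) in E.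
  rewrite al_v_frame, al_frame, be_frame in E by exact Hu; unfold fr in E.
  pose proof (Hon u Hu) as Ho.
  rewrite cross3_in_frame, in_frame_scal3, in_frame_add3 in E by exact Ho.
  apply (f_equal (dot3 (in_frame (X u) (Derive3 X u) (1, 0, 0)))) in E.
  rewrite !dot3_in_frame in E by exact Ho.
  unfold dot3, add3, scal3, cross3 in E; lra.
Qed.

Let M (s u v : R) : R :=
  shape3 (al s u v) (be s u v) (V2 al s u v) (V3 al s u v) (V3 be s u v).
Let Gm (s u v : R) : R := gram3 (al s u v) (be s u v).

Lemma M_value (u v : R) : 0 < u < L -> M 0 u v = - r 0 u v ^ 3 * lam u / 4.
Proof.
  intro Hu; unfold M.
  rewrite al_u_frame, al_v_frame, be_v_frame, al_frame, be_frame by exact Hu.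
  unfold fr; rewrite shape3_in_frame by (now apply Hon).
  unfold shape3, gram3, cross3, dot3; field.
Qed.

Lemma Gm_value (u v : R) : 0 < u < L -> Gm 0 u v = r 0 u v ^ 2 / 4.
Proof.
  intro Hu; unfold Gm; rewrite al_frame, be_frame by exact Hu.
  unfold fr; rewrite gram3_in_frame by (now apply Hon).
  unfold gram3, cross3, dot3; field.
Qed.

(* [(P, Q)] is the flux of the variation: the tangential part of [xi] carries the
   integrand [(1 + lam^2) |r| / 2] along, and the normal part [b] contributes
   [H grad b - b grad H], where [H = - lam] is the mean curvature with respect to the
   unit normal [T']. *)
Let P (s u v : R) : R :=
  sg * (c s u v * (1 + l s u v * l s u v) * r s u v
        - (2 * r s u v * (l s u v * D2 b s u v - b s u v * D2 l s u v)
           - 2 * p s u v * l s u v * D3 b s u v)).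

Let Q (s u v : R) : R :=
  sg * ((1 + l s u v * l s u v) * (a s u v - 2 * c s u v * p s u v) * / 2
        - (- (2 * p s u v * (l s u v * D2 b s u v - b s u v * D2 l s u v))
           + (4 * p s u v * p s u v + 1) * / 2 * / r s u v * l s u v * D3 b s u v)).

Lemma P_smooth : smooth3 P.
Proof. known_smooth; unfold P; smooth3_poly. Qed.

(** The s-derivative is first moved inside the u- and v-derivatives; there al_s and be_s are known
    in the frame for all interior u and all v, and can be differentiated again. *)
Lemma DM_value (u v : R) : 0 < u < L ->
  D1 M 0 u v =
  dshape3 (p 0 u v, 0, / 2) (r 0 u v, 0, 0) (D2 p 0 u v, p 0 u v - lam u / 2, 0)
    (D3 p 0 u v, 0, 0) (D3 r 0 u v, 0, 0)
    (D2 a 0 u v, x2 0 u v, x3 0 u v) (D3 a 0 u v, y2 0 u v, y3 0 u v)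
    (D2 (D2 a) 0 u v - x2 0 u v, D2 a 0 u v + D2 x2 0 u v - lam u * x3 0 u v,
     lam u * x2 0 u v + D2 x3 0 u v)
    (D3 (D2 a) 0 u v, D3 x2 0 u v, D3 x3 0 u v)
    (D3 (D3 a) 0 u v, D3 y2 0 u v, D3 y3 0 u v).
Proof.
  intro Hu; apply is_derive_unique.
  pose proof (is_derive_shape3 _ _ _ _ _ _ _ _ _ _ _
    (is_derive3_V1 al 0 u v Hal) (is_derive3_V1 be 0 u v Hbe)
    (is_derive3_V1 (V2 al) 0 u v (smooth3v_V2 _ Hal))
    (is_derive3_V1 (V3 al) 0 u v (smooth3v_V3 _ Hal))
    (is_derive3_V1 (V3 be) 0 u v (smooth3v_V3 _ Hbe))) as E; cbv beta in E.
  rewrite V12_comm, !V13_comm in E by assumption.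
  rewrite (frame_V2 (V1 al) (D2 a) x2 x3 (smooth3_D2 _ a_smooth) x2_smooth x3_smooth
    dal_frame u v Hu) in E.
  rewrite (frame_V3 (V1 al) (D2 a) x2 x3 (smooth3_D2 _ a_smooth) x2_smooth x3_smooth
    dal_frame u v Hu) in E.
  rewrite (frame_V3 (V1 be) (D3 a) y2 y3 (smooth3_D3 _ a_smooth) y2_smooth y3_smooth
    dbe_frame u v Hu) in E.
  rewrite dal_frame, dbe_frame, al_u_frame, al_v_frame, be_v_frame, al_frame, be_frame
    in E by exact Hu.
  unfold fr in E; rewrite dshape3_in_frame in E by (now apply Hon).
  exact E.
Qed.

Lemma DGm_value (u v : R) : 0 < u < L ->
  D1 Gm 0 u v =
  dgram3 (p 0 u v, 0, / 2) (r 0 u v, 0, 0)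
    (D2 a 0 u v, x2 0 u v, x3 0 u v) (D3 a 0 u v, y2 0 u v, y3 0 u v).
Proof.
  intro Hu; apply is_derive_unique.
  pose proof (is_derive_gram3 _ _ _ _ _
    (is_derive3_V1 al 0 u v Hal) (is_derive3_V1 be 0 u v Hbe)) as E; cbv beta in E.
  rewrite dal_frame, dbe_frame, al_frame, be_frame in E by exact Hu.
  unfold fr in E; rewrite dgram3_in_frame in E by (now apply Hon).
  exact E.
Qed.

Lemma l_v (u v : R) : is_derive (fun w => l 0 u w) v 0.
Proof. exact (is_derive_Rconst (lam u) v). Qed.

Lemma dl_v (u v : R) : is_derive (fun w => D2 l 0 u w) v 0.
Proof. exact (is_derive_Rconst (D2 l 0 u v) v). Qed.

Ltac known_u u v :=
  pose proof (is_derive_D2 p 0 u v p_smooth); pose proof (is_derive_D2 r 0 u v r_smooth);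
  pose proof (is_derive_D2 b 0 u v b_smooth); pose proof (is_derive_D2 c 0 u v c_smooth);
  pose proof (is_derive_D2 l 0 u v l_smooth);
  pose proof (is_derive_D2 (D2 b) 0 u v (smooth3_D2 _ b_smooth));
  pose proof (is_derive_D2 (D3 b) 0 u v (smooth3_D3 _ b_smooth));
  pose proof (is_derive_D2 (D2 c) 0 u v (smooth3_D2 _ c_smooth));
  pose proof (is_derive_D2 (D2 l) 0 u v (smooth3_D2 _ l_smooth)).

Ltac known_v u v :=
  pose proof (is_derive_D3 p 0 u v p_smooth); pose proof (is_derive_D3 r 0 u v r_smooth);
  pose proof (is_derive_D3 a 0 u v a_smooth);
  pose proof (is_derive_D3 b 0 u v b_smooth); pose proof (is_derive_D3 c 0 u v c_smooth);
  pose proof (l_v u v); pose proof (dl_v u v);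
  pose proof (is_derive_D3 (D2 b) 0 u v (smooth3_D2 _ b_smooth));
  pose proof (is_derive_D3 (D3 b) 0 u v (smooth3_D3 _ b_smooth));
  pose proof (is_derive_D3 (D2 c) 0 u v (smooth3_D2 _ c_smooth));
  pose proof (is_derive_D3 (D3 c) 0 u v (smooth3_D3 _ c_smooth)).

Ltac partial_value :=
  apply is_derive_unique; eapply is_derive_R; [derive_poly|cbv beta; try ring].

Lemma D2_x2 (u v : R) : D2 x2 0 u v =
  D2 (D2 b) 0 u v - D2 l 0 u v * c 0 u v - lam u * D2 c 0 u v
  + 2 * D2 p 0 u v * c 0 u v + 2 * p 0 u v * D2 c 0 u v.
Proof. known_u u v; unfold x2; partial_value; unfold l; ring. Qed.

Lemma D3_x2 (u v : R) : D3 x2 0 u v =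
  D3 (D2 b) 0 u v - lam u * D3 c 0 u v + 2 * D3 p 0 u v * c 0 u v
  + 2 * p 0 u v * D3 c 0 u v.
Proof. known_v u v; unfold x2; partial_value; unfold l; ring. Qed.

Lemma D2_x3 (u v : R) : D2 x3 0 u v =
  D2 (D2 c) 0 u v + D2 l 0 u v * b 0 u v + lam u * D2 b 0 u v
  - 2 * D2 p 0 u v * b 0 u v - 2 * p 0 u v * D2 b 0 u v.
Proof. known_u u v; unfold x3; partial_value; unfold l; ring. Qed.

Lemma D3_x3 (u v : R) : D3 x3 0 u v =
  D3 (D2 c) 0 u v + lam u * D3 b 0 u v - 2 * D3 p 0 u v * b 0 u v
  - 2 * p 0 u v * D3 b 0 u v.
Proof. known_v u v; unfold x3; partial_value; unfold l; ring. Qed.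

Lemma D3_y2 (u v : R) : D3 y2 0 u v =
  D3 (D3 b) 0 u v + 2 * D3 r 0 u v * c 0 u v + 2 * r 0 u v * D3 c 0 u v.
Proof. known_v u v; unfold y2; partial_value. Qed.

Lemma D3_y3 (u v : R) : D3 y3 0 u v =
  D3 (D3 c) 0 u v - 2 * D3 r 0 u v * b 0 u v - 2 * r 0 u v * D3 b 0 u v.
Proof. known_v u v; unfold y3; partial_value. Qed.

Lemma D2_P (u v : R) : D2 P 0 u v =
  sg * (D2 c 0 u v * (1 + lam u ^ 2) * r 0 u v
        + c 0 u v * 2 * lam u * D2 l 0 u v * r 0 u v
        + c 0 u v * (1 + lam u ^ 2) * D2 r 0 u v
        - (2 * D2 r 0 u v * (lam u * D2 b 0 u v - b 0 u v * D2 l 0 u v)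
           + 2 * r 0 u v * (lam u * D2 (D2 b) 0 u v - b 0 u v * D2 (D2 l) 0 u v)
           - 2 * D2 p 0 u v * lam u * D3 b 0 u v
           - 2 * p 0 u v * D2 l 0 u v * D3 b 0 u v
           - 2 * p 0 u v * lam u * D3 (D2 b) 0 u v)).
Proof.
  known_u u v; unfold P; rewrite <- (D23_comm b 0 u v b_smooth).
  partial_value; unfold l; ring.
Qed.

(** All s-derivatives are written in frame components of [xi]; the factor [sg], common to the
    integrand and the flux, reduces the claim to the central identity with lam'' eliminated by
    [Hode]. *)
Lemma integrand_divergence (u v : R) : 0 < u < L ->
  is_derive (fun w => Q 0 u w) v
    (ddensity (M 0 u v) (Gm 0 u v) (D1 M 0 u v) (D1 Gm 0 u v) - D2 P 0 u v).
Proof.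
  intro Hu; known_v u v.
  assert (Hinv : is_derive (fun w => / r 0 u w) v (- D3 r 0 u v / r 0 u v ^ 2)).
  { apply (is_derive_inv (fun w => r 0 u w) v (D3 r 0 u v)); [assumption|].
    now apply r_neq0. }
  unfold Q; eapply is_derive_R; [derive_poly|cbv beta].
  rewrite M_value, Gm_value, (ddensity_value sg) by (auto using sg_cases, sg_r).
  rewrite DM_value, DGm_value by exact Hu.
  rewrite D2_x2, D3_x2, D2_x3, D3_x3, D3_y2, D3_y3, D2_P; unfold x2, x3, y2, y3.
  change (l 0 u v) with (lam u).
  pose proof (r_neq0 u v Hu) as Hr.
  rewrite (willmore_integrand_variation (p 0 u v) (D2 p 0 u v) (D3 p 0 u v) (r 0 u v)
    (D2 r 0 u v) (D3 r 0 u v) (lam u) (D2 l 0 u v) (D2 (D2 l) 0 u v)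
    (a 0 u v) (D2 a 0 u v) (D3 a 0 u v) (D2 (D2 a) 0 u v) (D3 (D2 a) 0 u v)
    (D3 (D3 a) 0 u v)
    (b 0 u v) (D2 b 0 u v) (D3 b 0 u v) (D2 (D2 b) 0 u v) (D3 (D2 b) 0 u v)
    (D3 (D3 b) 0 u v)
    (c 0 u v) (D2 c 0 u v) (D3 c 0 u v) (D2 (D2 c) 0 u v) (D3 (D2 c) 0 u v)
    (D3 (D3 c) 0 u v) Hr (p_v_eq_r_u u v Hu) (Hode u Hu)).
  field; exact Hr.
Qed.

Lemma Derive_periodic (f : R -> R) (k x : R) :
  ex_derive f (x + k) -> (forall y, f (y + k) = f y) -> Derive f (x + k) = Derive f x.
Proof.
  intros Hf Hk; symmetry; apply is_derive_unique.
  eapply is_derive_fun_ext; [intro y; symmetry; apply Hk|].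
  eapply is_derive_R.
  - apply (is_derive_comp f (fun y => y + k) x); [now apply Derive_correct|].
    auto_derive; [trivial|reflexivity].
  - apply Rmult_1_l.
Qed.

Lemma Q_periodic (u : R) : 0 < u < L -> Q 0 u (2 * PI) = Q 0 u 0.
Proof.
  intro Hu.
  assert (Hb : forall y v, 0 < y < L -> b 0 y (v + 2 * PI) = b 0 y v)
    by (intros; unfold b; now rewrite Hper_xi).
  assert (E2 : D2 b 0 u (0 + 2 * PI) = D2 b 0 u 0).
  { apply Derive_ext_loc, (locally_open_interval 0 L u _ Hu); auto. }
  assert (E3 : D3 b 0 u (0 + 2 * PI) = D3 b 0 u 0).
  { apply (Derive_periodic (fun w => b 0 u w)); [|intro; now apply Hb].
    eexists; apply (is_derive_D3 b 0 u _ b_smooth). }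
  replace (2 * PI) with (0 + 2 * PI) at 1 by ring.
  unfold Q; rewrite E2, E3, Hb by exact Hu.
  unfold a, c, p, r; now rewrite Hper_al, Hper_be, Hper_xi by exact Hu.
Qed.

(** The inequalities on u are strict because [P] contains the u-derivative of b, which is seen to
    vanish where b vanishes on a neighbourhood. *)
Lemma P_support (u v : R) :
  0 < u < L -> u < delta \/ L - delta < u -> P 0 u v = 0.
Proof.
  intros Hu Hd.
  assert (Hz : forall y w, 0 < y < L -> y <= delta \/ L - delta <= y ->
    b 0 y w = 0 /\ c 0 y w = 0).
  { intros y w Hy Hyd; unfold b, c; rewrite Hsupp by assumption.
    generalize (Derive3 X y) (cross3 (X y) (Derive3 X y)); split; r3_ring. }
  assert (E2 : D2 b 0 u v = 0).
  { apply (is_derive_const_loc (fun y => b 0 y v) u 0);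
      [|now apply is_derive_D2, b_smooth].
    destruct Hd as [Hd|Hd].
    (* [delta] may exceed [L], hence the minimum. *)
    - apply (locally_open_interval 0 (Rmin delta L)); [split; [lra|]|].
      + apply Rmin_glb_lt; lra.
      + intros y Hy; pose proof (Rmin_l delta L); pose proof (Rmin_r delta L).
        apply Hz; lra.
    - apply (locally_open_interval (Rmax 0 (L - delta)) L); [split; [|lra]|].
      + apply Rmax_lub_lt; lra.
      + intros y Hy; pose proof (Rmax_l 0 (L - delta)); pose proof (Rmax_r 0 (L - delta)).
        apply Hz; lra. }
  assert (E3 : D3 b 0 u v = 0).
  { apply (is_derive_const_loc (fun w => b 0 u w) v 0);
      [|now apply is_derive_D3, b_smooth].
    apply filter_forall; intro w; apply Hz; lra. }
  destruct (Hz u v Hu) as [Eb Ec]; [lra|].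
  unfold P; rewrite E2, E3, Eb, Ec; ring.
Qed.

Lemma P_left (v : R) : P 0 0 v = 0.
Proof.
  pose proof (Rmin_l delta L); pose proof (Rmin_r delta L).
  assert (0 < Rmin delta L) by (apply Rmin_glb_lt; lra).
  apply (continuous_eq_closed (fun u => P 0 u v) 0 (Rmin delta L) 0); try lra.
  - intro; apply C3_section2, smooth3_C3, P_smooth.
  - intros u Hu; apply P_support; lra.
Qed.

Lemma P_right (v : R) : P 0 L v = 0.
Proof.
  pose proof (Rmax_l 0 (L - delta)); pose proof (Rmax_r 0 (L - delta)).
  assert (Rmax 0 (L - delta) < L) by (apply Rmax_lub_lt; lra).
  apply (continuous_eq_closed (fun u => P 0 u v) (Rmax 0 (L - delta)) L 0); try lra.
  - intro; apply C3_section2, smooth3_C3, P_smooth.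
  - intros u Hu; apply P_support; lra.
Qed.

Lemma first_variation_zero (h : R -> R -> R -> R) :
  C3 h ->
  (forall u v, 0 < u < L ->
     h 0 u v = ddensity (M 0 u v) (Gm 0 u v) (D1 M 0 u v) (D1 Gm 0 u v)) ->
  RInt (fun u => RInt (fun v => h 0 u v) 0 (2 * PI)) 0 L = 0.
Proof.
  intros Hh E; apply (RInt_divergence L h P Q); auto using P_smooth, P_left, P_right,
    Q_periodic.
  intros u v Hu; rewrite E by exact Hu; now apply integrand_divergence.
Qed.

End FirstVariation.

(** * Surfaces in the unit quaternions *)

Ltac quat_ring :=
  intros;
  repeat match goal with q : quat |- _ => destruct q as [? [[? ?] ?]] end;
  repeat match goal with x : R3 |- _ => destruct x as [[? ?] ?] end;
  unfold hopf, crossq, addq, scalq, mulq, conjq, dotq, imq, zeroq, add3, scal3, cross3,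
    dot3, zero3;
  cbn [fst snd]; repeat (apply injective_projections; cbn [fst snd]); ring.

(* the imaginary part of [p / q], for [q] in S^3 *)
Definition rlog (q p : quat) : R3 :=
  add3 (add3 (scal3 (fst q) (snd p)) (scal3 (- fst p) (snd q))) (cross3 (snd q) (snd p)).

(** The real part of p conj(q) is the inner product of q and p, so for p tangent to S^3 at q the
    quotient p / q is purely imaginary. *)
Lemma mulq_rlog (q p : quat) :
  dotq q q = 1 -> dotq q p = 0 -> p = mulq (imq (rlog q p)) q.
Proof.
  intros H1 H0.
  assert (E : addq (scalq (dotq q q) p) (scalq (- dotq q p) q) = mulq (imq (rlog q p)) q)
    by (unfold rlog; quat_ring).
  rewrite <- E, H1, H0; quat_ring.
Qed.

Lemma rlog_mulq (q : quat) (x : R3) : rlog q (mulq (imq x) q) = scal3 (dotq q q) x.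
Proof. unfold rlog; quat_ring. Qed.

Lemma rlog_self (q : quat) : rlog q q = zero3.
Proof. unfold rlog; quat_ring. Qed.

Lemma rlog_zero (q : quat) : rlog q zeroq = zero3.
Proof. unfold rlog; quat_ring. Qed.

Lemma rlog_mulq_mulq (q : quat) (x y : R3) :
  rlog (mulq (imq y) q) (mulq (imq x) q) = scal3 (- dotq q q) (cross3 x y).
Proof. unfold rlog; quat_ring. Qed.

Lemma crossq_mulq (q : quat) (x y : R3) :
  crossq q (mulq (imq x) q) (mulq (imq y) q)
  = scalq (- dotq q q) (mulq (imq (cross3 x y)) q).
Proof. quat_ring. Qed.

Lemma dotq_mulq (q w : quat) (x : R3) : dotq w (mulq (imq x) q) = dot3 (rlog q w) x.
Proof. unfold rlog; quat_ring. Qed.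

(** Differentiating [rlog q p1] while q moves with velocity p2 creates the term [rlog p2 p1]. This
    is the source of the cross products in the structure equations; antisymmetry doubles them. *)
Lemma rlog_swap (q p1 p2 : quat) :
  dotq q q = 1 -> dotq q p1 = 0 -> dotq q p2 = 0 ->
  rlog p2 p1 = scal3 (-1) (cross3 (rlog q p1) (rlog q p2)).
Proof.
  intros H H1 H2.
  rewrite (mulq_rlog q p1 H H1), (mulq_rlog q p2 H H2) at 1.
  now rewrite rlog_mulq_mulq, H.
Qed.

(** Right multiplication by f preserves inner products, so the fundamental forms are computed on x
    and y. From f_u = x f follows f_uv = (x_v + x y) f, and x × y is the imaginary part of x y; in
    f_uu and f_vv the corresponding squares are real and leave no trace. The unit normal is - (x ×
    y) f / |x × y|, whose sign disappears in the square of the mean curvature. *)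
Lemma willmore_density (f : R -> R -> quat) (u v : R) (x y xu xv yv : R3) :
  dotq (f u v) (f u v) = 1 ->
  du f u v = mulq (imq x) (f u v) -> dv f u v = mulq (imq y) (f u v) ->
  rlog (f u v) (du (du f) u v) = xu ->
  rlog (f u v) (dv (du f) u v) = add3 xv (cross3 x y) ->
  rlog (f u v) (dv (dv f) u v) = yv ->
  0 < gram3 x y ->
  ((mean_curvature f u v) ^ 2 + 1) * area_density f u v
  = density (shape3 x y xu xv yv) (gram3 x y).
Proof.
  intros Hq Hx Hy Hxu Hxv Hyv Hpos.
  set (q := f u v) in *.
  assert (HE : first_E f u v = dot3 x x).
  { unfold first_E; rewrite Hx, dotq_mulq, rlog_mulq, Hq, scal3_one; reflexivity. }
  assert (HF : first_F f u v = dot3 x y).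
  { unfold first_F; rewrite Hx, Hy, dotq_mulq, rlog_mulq, Hq, scal3_one; reflexivity. }
  assert (HG : first_G f u v = dot3 y y).
  { unfold first_G; rewrite Hy, dotq_mulq, rlog_mulq, Hq, scal3_one; reflexivity. }
  assert (Hgram : gram f u v = gram3 x y).
  { unfold gram; rewrite HE, HF, HG; unfold gram3; r3_ring. }
  assert (Hn : unit_normal f u v
    = scalq (- / sqrt (gram3 x y)) (mulq (imq (cross3 x y)) q)).
  { unfold unit_normal; fold q; rewrite Hx, Hy, crossq_mulq, Hq.
    replace (dotq (scalq (Ropp 1) (mulq (imq (cross3 x y)) q))
               (scalq (Ropp 1) (mulq (imq (cross3 x y)) q))) with (gram3 x y).
    - generalize (/ sqrt (gram3 x y)) (mulq (imq (cross3 x y)) q); quat_ring.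
    - transitivity (dotq q q * gram3 x y); [rewrite Hq; ring|].
      unfold gram3; generalize (cross3 x y); quat_ring. }
  assert (Hdot : forall w, dotq w (unit_normal f u v)
    = - / sqrt (gram3 x y) * dot3 (rlog q w) (cross3 x y)).
  { intro w; rewrite Hn, <- dotq_mulq.
    generalize (- / sqrt (gram3 x y)) (mulq (imq (cross3 x y)) q); quat_ring. }
  assert (He : second_e f u v = - / sqrt (gram3 x y) * dot3 xu (cross3 x y)).
  { unfold second_e; now rewrite Hdot, Hxu. }
  assert (Hf : second_f f u v
    = - / sqrt (gram3 x y) * (dot3 xv (cross3 x y) + gram3 x y)).
  { unfold second_f; rewrite Hdot, Hxv; f_equal.
    unfold gram3; generalize (cross3 x y); r3_ring. }
  assert (Hg : second_g f u v = - / sqrt (gram3 x y) * dot3 yv (cross3 x y)).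
  { unfold second_g; now rewrite Hdot, Hyv. }
  pose proof (sqrt_lt_R0 _ Hpos) as Hs.
  pose proof (sqrt_sqrt _ (Rlt_le _ _ Hpos)) as Hss.
  assert (HH : mean_curvature f u v
    = - shape3 x y xu xv yv / (2 * gram3 x y * sqrt (gram3 x y))).
  { unfold mean_curvature, shape11, shape22, shape3.
    rewrite HE, HF, HG, Hgram, He, Hf, Hg; field; lra. }
  unfold area_density, density; rewrite HH, Hgram; f_equal; f_equal.
  set (m := shape3 x y xu xv yv); set (g := gram3 x y) in *.
  replace (4 * g ^ 3) with (4 * g ^ 2 * (sqrt g * sqrt g)) by (rewrite Hss; ring).
  field; lra.
Qed.

(** * Calculus of quaternion-valued functions and of the Hopf map *)

Definition is_deriveq (f : R -> quat) (x : R) (l : quat) : Prop :=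
  is_derive (fun y => fst (f y)) x (fst l) /\ is_derive3 (fun y => snd (f y)) x (snd l).

Lemma is_derive_dotq (f g : R -> quat) (x : R) (a b : quat) :
  is_deriveq f x a -> is_deriveq g x b ->
  is_derive (fun y => dotq (f y) (g y)) x (dotq a (g x) + dotq (f x) b).
Proof.
  intros [F1 F2] [G1 G2]; pose proof (is_derive_dot3 _ _ _ _ _ F2 G2) as H.
  unfold dotq; eapply is_derive_R; [derive_poly|cbv beta; ring].
Qed.

Lemma is_derive3_rlog (f g : R -> quat) (x : R) (a b : quat) :
  is_deriveq f x a -> is_deriveq g x b ->
  is_derive3 (fun y => rlog (f y) (g y)) x (add3 (rlog a (g x)) (rlog (f x) b)).
Proof.
  intros [F1 F2] [G1 G2].
  pose proof (is_derive3_add3 _ _ _ _ _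
    (is_derive3_add3 _ _ _ _ _ (is_derive3_scal3 _ _ _ _ _ F1 G2)
      (is_derive3_scal3 _ _ _ _ _ (is_derive_Ropp _ _ _ G1) F2))
    (is_derive3_cross3 _ _ _ _ _ F2 G2)) as E; cbv beta in E.
  match type of E with is_derive3 _ _ ?w => replace (add3 _ _) with w; [exact E|] end.
  unfold rlog; generalize (f x) (g x); quat_ring.
Qed.

Definition hopfv (q : quat) : R3 := snd (hopf q).

Definition dhopfv (q p : quat) : R3 :=
  snd (addq (mulq (mulq p (imq (1, 0, 0))) (conjq q))
            (mulq (mulq q (imq (1, 0, 0))) (conjq p))).

(** Restates the Hopf map in the operations that have derivative and smoothness rules. *)
Lemma hopfv_eq (q : quat) : hopfv q =
  add3 (scal3 (fst q * fst q - dot3 (snd q) (snd q)) (1, 0, 0))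
    (add3 (scal3 (2 * dot3 (snd q) (1, 0, 0)) (snd q))
       (scal3 (2 * fst q) (cross3 (snd q) (1, 0, 0)))).
Proof. unfold hopfv; quat_ring. Qed.

Lemma is_derive3_const (c : R3) (x : R) : is_derive3 (fun _ => c) x zero3.
Proof. split; [|split]; apply is_derive_Rconst. Qed.

Lemma is_derive3_hopfv (f : R -> quat) (x : R) (a : quat) :
  is_deriveq f x a -> is_derive3 (fun y => hopfv (f y)) x (dhopfv (f x) a).
Proof.
  intros [F1 F2].
  pose proof (is_derive3_const (1, 0, 0) x) as Hi.
  pose proof (is_derive_Rmult _ _ _ _ _ F1 F1) as H1.
  pose proof (is_derive_dot3 _ _ _ _ _ F2 F2) as H2.
  pose proof (is_derive_dot3 _ _ _ _ _ F2 Hi) as H3.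
  pose proof (is_derive_Rconst 2 x) as Hk.
  pose proof (is_derive3_add3 _ _ _ _ _
    (is_derive3_scal3 _ _ _ _ _ (is_derive_Rminus _ _ _ _ _ H1 H2) Hi)
    (is_derive3_add3 _ _ _ _ _
      (is_derive3_scal3 _ _ _ _ _ (is_derive_Rmult _ _ _ _ _ Hk H3) F2)
      (is_derive3_scal3 _ _ _ _ _ (is_derive_Rmult _ _ _ _ _ Hk F1)
         (is_derive3_cross3 _ _ _ _ _ F2 Hi)))) as E; cbv beta in E.
  apply is_derive3_ext_loc with (1 := filter_forall _ (fun y => eq_sym (hopfv_eq (f y)))).
  match type of E with is_derive3 _ _ ?w => replace (dhopfv _ _) with w; [exact E|] end.
  unfold dhopfv; generalize (f x); quat_ring.
Qed.

(** For h = q i conj(q) the derivative is x h - h x, and the commutator of imaginary quaternions is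
    twice the cross product. *)
Lemma dhopfv_mulq (q : quat) (x : R3) :
  dhopfv q (mulq (imq x) q) = scal3 2 (cross3 x (hopfv q)).
Proof. unfold dhopfv, hopfv; quat_ring. Qed.

Lemma Deriveq_ext_loc (f g : R -> quat) (x : R) :
  locally x (fun y => f y = g y) -> Deriveq f x = Deriveq g x.
Proof.
  intro H; unfold Deriveq, Derive3.
  repeat (apply injective_projections; cbn [fst snd]);
    (apply Derive_ext_loc; revert H; apply filter_imp; intros y E; now rewrite E).
Qed.

Lemma is_deriveq_unique (f : R -> quat) (x : R) (l : quat) :
  is_deriveq f x l -> Deriveq f x = l.
Proof.
  intros [H1 H2]; unfold Deriveq.
  apply injective_projections; cbn [fst snd];
    [now apply is_derive_unique|now apply is_derive3_unique].
Qed.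

Lemma Deriveq_const (q : quat) (x : R) : Deriveq (fun _ => q) x = zeroq.
Proof.
  apply is_deriveq_unique; split; [apply is_derive_Rconst|apply is_derive3_const].
Qed.

Definition smoothq (G : R -> R -> R -> quat) : Prop :=
  smooth3 (fun s u v => fst (G s u v)) /\ smooth3v (fun s u v => snd (G s u v)).

Definition q1 (G : R -> R -> R -> quat) (s u v : R) : quat := Deriveq (fun x => G x u v) s.
Definition q2 (G : R -> R -> R -> quat) (s u v : R) : quat := Deriveq (fun x => G s x v) u.
Definition q3 (G : R -> R -> R -> quat) (s u v : R) : quat := Deriveq (fun x => G s u x) v.

Lemma smoothq_q1 (G : R -> R -> R -> quat) : smoothq G -> smoothq (q1 G).
Proof. intros [H1 H2]; split; [exact (smooth3_D1 _ H1)|exact (smooth3v_V1 _ H2)]. Qed.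

Lemma smoothq_q2 (G : R -> R -> R -> quat) : smoothq G -> smoothq (q2 G).
Proof. intros [H1 H2]; split; [exact (smooth3_D2 _ H1)|exact (smooth3v_V2 _ H2)]. Qed.

Lemma smoothq_q3 (G : R -> R -> R -> quat) : smoothq G -> smoothq (q3 G).
Proof. intros [H1 H2]; split; [exact (smooth3_D3 _ H1)|exact (smooth3v_V3 _ H2)]. Qed.

Lemma is_deriveq_q1 (G : R -> R -> R -> quat) (s u v : R) :
  smoothq G -> is_deriveq (fun x => G x u v) s (q1 G s u v).
Proof.
  intros [H1 H2]; split; [exact (is_derive_D1 _ s u v H1)|exact (is_derive3_V1 _ s u v H2)].
Qed.

Lemma is_deriveq_q2 (G : R -> R -> R -> quat) (s u v : R) :
  smoothq G -> is_deriveq (fun x => G s x v) u (q2 G s u v).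
Proof.
  intros [H1 H2]; split; [exact (is_derive_D2 _ s u v H1)|exact (is_derive3_V2 _ s u v H2)].
Qed.

Lemma is_deriveq_q3 (G : R -> R -> R -> quat) (s u v : R) :
  smoothq G -> is_deriveq (fun x => G s u x) v (q3 G s u v).
Proof.
  intros [H1 H2]; split; [exact (is_derive_D3 _ s u v H1)|exact (is_derive3_V3 _ s u v H2)].
Qed.

Lemma q12_comm (G : R -> R -> R -> quat) (s u v : R) :
  smoothq G -> q1 (q2 G) s u v = q2 (q1 G) s u v.
Proof.
  intros [H1 H2]; apply injective_projections;
    [exact (D12_comm _ s u v H1)|exact (V12_comm _ s u v H2)].
Qed.

Lemma q13_comm (G : R -> R -> R -> quat) (s u v : R) :
  smoothq G -> q1 (q3 G) s u v = q3 (q1 G) s u v.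
Proof.
  intros [H1 H2]; apply injective_projections;
    [exact (D13_comm _ s u v H1)|exact (V13_comm _ s u v H2)].
Qed.

Lemma q23_comm (G : R -> R -> R -> quat) (s u v : R) :
  smoothq G -> q2 (q3 G) s u v = q3 (q2 G) s u v.
Proof.
  intros [H1 H2]; apply injective_projections;
    [exact (D23_comm _ s u v H1)|exact (V23_comm _ s u v H2)].
Qed.

Lemma smooth3v_rlog (G H : R -> R -> R -> quat) :
  smoothq G -> smoothq H -> smooth3v (fun s u v => rlog (G s u v) (H s u v)).
Proof.
  intros [G1 G2] [H1 H2]; unfold rlog.
  apply (smooth3v_add3 (fun s u v => add3 (scal3 (fst (G s u v)) (snd (H s u v)))
           (scal3 (- fst (H s u v)) (snd (G s u v))))
           (fun s u v => cross3 (snd (G s u v)) (snd (H s u v)))).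
  - apply (smooth3v_add3 (fun s u v => scal3 (fst (G s u v)) (snd (H s u v)))
             (fun s u v => scal3 (- fst (H s u v)) (snd (G s u v)))).
    + now apply (smooth3v_scal3 (fun s u v => fst (G s u v)) (fun s u v => snd (H s u v))).
    + apply (smooth3v_scal3 (fun s u v => - fst (H s u v)) (fun s u v => snd (G s u v)));
        [now apply smooth3_opp|assumption].
  - now apply (smooth3v_cross3 (fun s u v => snd (G s u v)) (fun s u v => snd (H s u v))).
Qed.

Lemma smooth3_dotq (G H : R -> R -> R -> quat) :
  smoothq G -> smoothq H -> smooth3 (fun s u v => dotq (G s u v) (H s u v)).
Proof.
  intros [G1 G2] [H1 H2]; unfold dotq.
  apply (smooth3_plus (fun s u v => fst (G s u v) * fst (H s u v))
           (fun s u v => dot3 (snd (G s u v)) (snd (H s u v)))).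
  - now apply smooth3_mult.
  - now apply (smooth3_dot3 (fun s u v => snd (G s u v)) (fun s u v => snd (H s u v))).
Qed.

Lemma smooth3v_ext (A B : R -> R -> R -> R3) :
  (forall s u v, A s u v = B s u v) -> smooth3v A -> smooth3v B.
Proof. intros E H; replace B with A; [exact H|fun_ext3; apply E]. Qed.

Lemma smooth3v_hopfv (G : R -> R -> R -> quat) :
  smoothq G -> smooth3v (fun s u v => hopfv (G s u v)).
Proof.
  intros [G1 G2].
  assert (Hi : smooth3v (fun _ _ _ => (1, 0, 0)))
    by (split; [|split]; apply smooth3_const).
  eapply smooth3v_ext; [intros; symmetry; apply hopfv_eq|].
  pose proof (smooth3_dot3 _ _ G2 G2) as H1; pose proof (smooth3_dot3 _ _ G2 Hi) as H2.
  apply (smooth3v_add3 _ _ (smooth3v_scal3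
    (fun s u v => fst (G s u v) * fst (G s u v) - dot3 (snd (G s u v)) (snd (G s u v)))
    _ ltac:(smooth3_poly) Hi)).
  apply (smooth3v_add3 _ _ (smooth3v_scal3
    (fun s u v => 2 * dot3 (snd (G s u v)) (1, 0, 0)) _ ltac:(smooth3_poly) G2)).
  apply (smooth3v_scal3 (fun s u v => 2 * fst (G s u v)) _ ltac:(smooth3_poly)
    (smooth3v_cross3 _ _ G2 Hi)).
Qed.

Lemma in_S3_tangent (f : R -> quat) (x : R) (a : quat) :
  is_deriveq f x a -> locally x (fun y => dotq (f y) (f y) = 1) -> dotq (f x) a = 0.
Proof.
  intros Hf H1.
  pose proof (is_derive_const_loc _ _ _ _ H1 (is_derive_dotq _ _ _ _ _ Hf Hf)) as E.
  replace (dotq a (f x)) with (dotq (f x) a) in E; [lra|].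
  generalize (f x); quat_ring.
Qed.

Lemma locally_Rabs_lt (e s : R) : Rabs s < e -> locally s (fun x => Rabs x < e).
Proof.
  intro Hs; apply (locally_open_interval (- e) e).
  - now apply Rabs_def2 in Hs.
  - intros; now apply Rabs_def1.
Qed.

Lemma add3_zero_l (x : R3) : add3 zero3 x = x.
Proof. r3_ring. Qed.

(** * Structure equations of a family of surfaces in S^3 *)

Section Family.

Context (G : R -> R -> R -> quat) (e L : R).
Context (HG : smoothq G) (HL : 0 < L).
Context (HS : forall s u v, Rabs s < e -> 0 <= u <= L -> dotq (G s u v) (G s u v) = 1).

Definition al (s u v : R) : R3 := rlog (G s u v) (q2 G s u v).
Definition be (s u v : R) : R3 := rlog (G s u v) (q3 G s u v).
Definition xi (s u v : R) : R3 := rlog (G s u v) (q1 G s u v).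

Lemma al_smooth : smooth3v al.
Proof. apply smooth3v_rlog; [exact HG|now apply smoothq_q2]. Qed.

Lemma be_smooth : smooth3v be.
Proof. apply smooth3v_rlog; [exact HG|now apply smoothq_q3]. Qed.

Lemma xi_smooth : smooth3v xi.
Proof. apply smooth3v_rlog; [exact HG|now apply smoothq_q1]. Qed.

Lemma tangent_q2 (s u v : R) : Rabs s < e -> 0 <= u <= L ->
  dotq (G s u v) (q2 G s u v) = 0.
Proof.
  intros Hs Hu.
  (* At u = 0 and u = L the family lies in S^3 on one side only, so the relation is proved inside
     and extended by continuity. *)
  apply (continuous_eq_closed (fun y => dotq (G s y v) (q2 G s y v)) 0 L 0 HL);
    [|intros y Hy|exact Hu].
  - intro y; apply (C3_section2 (fun s u v => dotq (G s u v) (q2 G s u v))).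
    apply smooth3_C3, smooth3_dotq; [exact HG|now apply smoothq_q2].
  - apply (in_S3_tangent (fun w => G s w v)); [now apply is_deriveq_q2|].
    apply (locally_open_interval 0 L y _ Hy); intros; apply HS; [exact Hs|lra].
Qed.

Lemma tangent_q3 (s u v : R) : Rabs s < e -> 0 <= u <= L ->
  dotq (G s u v) (q3 G s u v) = 0.
Proof.
  intros Hs Hu; apply (in_S3_tangent (fun w => G s u w)); [now apply is_deriveq_q3|].
  apply filter_forall; intros; now apply HS.
Qed.

Lemma tangent_q1 (s u v : R) : Rabs s < e -> 0 <= u <= L ->
  dotq (G s u v) (q1 G s u v) = 0.
Proof.
  intros Hs Hu; apply (in_S3_tangent (fun w => G w u v)); [now apply is_deriveq_q1|].
  generalize (locally_Rabs_lt e s Hs); apply filter_imp; intros; now apply HS.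
Qed.

Lemma q2_eq (s u v : R) : Rabs s < e -> 0 <= u <= L ->
  q2 G s u v = mulq (imq (al s u v)) (G s u v).
Proof. intros Hs Hu; apply mulq_rlog; [now apply HS|now apply tangent_q2]. Qed.

Lemma q3_eq (s u v : R) : Rabs s < e -> 0 <= u <= L ->
  q3 G s u v = mulq (imq (be s u v)) (G s u v).
Proof. intros Hs Hu; apply mulq_rlog; [now apply HS|now apply tangent_q3]. Qed.

Lemma V1_al (s u v : R) : V1 al s u v =
  add3 (rlog (q1 G s u v) (q2 G s u v)) (rlog (G s u v) (q1 (q2 G) s u v)).
Proof.
  apply is_derive3_unique, (is_derive3_rlog (fun x => G x u v) (fun x => q2 G x u v));
    apply is_deriveq_q1; [exact HG|now apply smoothq_q2].
Qed.

Lemma V2_al (s u v : R) : V2 al s u v = rlog (G s u v) (q2 (q2 G) s u v).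
Proof.
  transitivity (add3 (rlog (q2 G s u v) (q2 G s u v)) (rlog (G s u v) (q2 (q2 G) s u v))).
  - apply is_derive3_unique, (is_derive3_rlog (fun x => G s x v) (fun x => q2 G s x v));
      apply is_deriveq_q2; [exact HG|now apply smoothq_q2].
  - rewrite rlog_self; apply add3_zero_l.
Qed.

Lemma V3_al (s u v : R) : V3 al s u v =
  add3 (rlog (q3 G s u v) (q2 G s u v)) (rlog (G s u v) (q3 (q2 G) s u v)).
Proof.
  apply is_derive3_unique, (is_derive3_rlog (fun x => G s u x) (fun x => q2 G s u x));
    apply is_deriveq_q3; [exact HG|now apply smoothq_q2].
Qed.

Lemma V1_be (s u v : R) : V1 be s u v =
  add3 (rlog (q1 G s u v) (q3 G s u v)) (rlog (G s u v) (q1 (q3 G) s u v)).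
Proof.
  apply is_derive3_unique, (is_derive3_rlog (fun x => G x u v) (fun x => q3 G x u v));
    apply is_deriveq_q1; [exact HG|now apply smoothq_q3].
Qed.

Lemma V2_be (s u v : R) : V2 be s u v =
  add3 (rlog (q2 G s u v) (q3 G s u v)) (rlog (G s u v) (q2 (q3 G) s u v)).
Proof.
  apply is_derive3_unique, (is_derive3_rlog (fun x => G s x v) (fun x => q3 G s x v));
    apply is_deriveq_q2; [exact HG|now apply smoothq_q3].
Qed.

Lemma V3_be (s u v : R) : V3 be s u v = rlog (G s u v) (q3 (q3 G) s u v).
Proof.
  transitivity (add3 (rlog (q3 G s u v) (q3 G s u v)) (rlog (G s u v) (q3 (q3 G) s u v))).
  - apply is_derive3_unique, (is_derive3_rlog (fun x => G s u x) (fun x => q3 G s u x));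
      apply is_deriveq_q3; [exact HG|now apply smoothq_q3].
  - rewrite rlog_self; apply add3_zero_l.
Qed.

Lemma V2_xi (s u v : R) : V2 xi s u v =
  add3 (rlog (q2 G s u v) (q1 G s u v)) (rlog (G s u v) (q2 (q1 G) s u v)).
Proof.
  apply is_derive3_unique, (is_derive3_rlog (fun x => G s x v) (fun x => q1 G s x v));
    apply is_deriveq_q2; [exact HG|now apply smoothq_q1].
Qed.

Lemma V3_xi (s u v : R) : V3 xi s u v =
  add3 (rlog (q3 G s u v) (q1 G s u v)) (rlog (G s u v) (q3 (q1 G) s u v)).
Proof.
  apply is_derive3_unique, (is_derive3_rlog (fun x => G s u x) (fun x => q1 G s u x));
    apply is_deriveq_q3; [exact HG|now apply smoothq_q1].
Qed.

Ltac structure_equation s u v :=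
  pose proof (HS s u v ltac:(assumption) ltac:(assumption)) as Hq;
  pose proof (tangent_q1 s u v ltac:(assumption) ltac:(assumption)) as Ht1;
  pose proof (tangent_q2 s u v ltac:(assumption) ltac:(assumption)) as Ht2;
  pose proof (tangent_q3 s u v ltac:(assumption) ltac:(assumption)) as Ht3;
  rewrite ?(rlog_swap (G s u v) _ _ Hq Ht1 Ht2), ?(rlog_swap (G s u v) _ _ Hq Ht2 Ht1),
    ?(rlog_swap (G s u v) _ _ Hq Ht1 Ht3), ?(rlog_swap (G s u v) _ _ Hq Ht3 Ht1),
    ?(rlog_swap (G s u v) _ _ Hq Ht2 Ht3), ?(rlog_swap (G s u v) _ _ Hq Ht3 Ht2).

Lemma compat_al_be (s u v : R) : Rabs s < e -> 0 <= u <= L ->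
  V3 al s u v = add3 (V2 be s u v) (scal3 (-2) (cross3 (al s u v) (be s u v))).
Proof.
  intros Hs Hu; rewrite V3_al, V2_be, q23_comm by exact HG; structure_equation s u v.
  fold (al s u v) (be s u v).
  generalize (al s u v) (be s u v) (rlog (G s u v) (q3 (q2 G) s u v)); r3_ring.
Qed.

Lemma compat_al_xi (s u v : R) : Rabs s < e -> 0 <= u <= L ->
  V1 al s u v = add3 (V2 xi s u v) (scal3 (-2) (cross3 (al s u v) (xi s u v))).
Proof.
  intros Hs Hu; rewrite V1_al, V2_xi, q12_comm by exact HG; structure_equation s u v.
  fold (al s u v) (xi s u v).
  generalize (al s u v) (xi s u v) (rlog (G s u v) (q2 (q1 G) s u v)); r3_ring.
Qed.

Lemma compat_be_xi (s u v : R) : Rabs s < e -> 0 <= u <= L ->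
  V1 be s u v = add3 (V3 xi s u v) (scal3 (-2) (cross3 (be s u v) (xi s u v))).
Proof.
  intros Hs Hu; rewrite V1_be, V3_xi, q13_comm by exact HG; structure_equation s u v.
  fold (be s u v) (xi s u v).
  generalize (be s u v) (xi s u v) (rlog (G s u v) (q3 (q1 G) s u v)); r3_ring.
Qed.

Definition shape (s u v : R) : R :=
  shape3 (al s u v) (be s u v) (V2 al s u v) (V3 al s u v) (V3 be s u v).
Definition gramian (s u v : R) : R := gram3 (al s u v) (be s u v).

Lemma gramian_smooth : smooth3 gramian.
Proof.
  pose proof (smooth3v_cross3 _ _ al_smooth be_smooth) as H.
  exact (smooth3_dot3 _ _ H H).
Qed.

Lemma shape_smooth : smooth3 shape.
Proof.
  pose proof al_smooth as Ha; pose proof be_smooth as Hb.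
  pose proof (smooth3v_cross3 _ _ Ha Hb) as H.
  pose proof gramian_smooth as Hg; unfold gramian in Hg.
  pose proof (smooth3_dot3 _ _ Ha Ha) as H1.
  pose proof (smooth3_dot3 _ _ Ha Hb) as H2.
  pose proof (smooth3_dot3 _ _ Hb Hb) as H3.
  pose proof (smooth3_dot3 _ _ (smooth3v_V2 _ Ha) H) as H4.
  pose proof (smooth3_dot3 _ _ (smooth3v_V3 _ Ha) H) as H5.
  pose proof (smooth3_dot3 _ _ (smooth3v_V3 _ Hb) H) as H6.
  unfold shape, shape3; smooth3_poly.
Qed.

(** If al × be = 0, then |be|^2 al - <al, be> be = 0, and independence forces be = 0; but then 0 al
    + 1 be = 0 is a nontrivial relation. *)
Lemma gramian_pos (s u v : R) : Rabs s < e -> 0 <= u <= L ->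
  (forall k m : R, addq (scalq k (q2 G s u v)) (scalq m (q3 G s u v)) = zeroq ->
     k = 0 /\ m = 0) ->
  0 < gramian s u v.
Proof.
  intros Hs Hu Hi; apply dot3_self_pos; intro E.
  pose proof (cross3_eq0_dependent _ _ E) as Ed.
  assert (Hlin : forall k m, add3 (scal3 k (al s u v)) (scal3 m (be s u v)) = zero3 ->
    k = 0 /\ m = 0).
  { intros k m H; apply Hi; rewrite q2_eq, q3_eq by assumption.
    transitivity (mulq (imq (add3 (scal3 k (al s u v)) (scal3 m (be s u v)))) (G s u v)).
    - generalize (al s u v) (be s u v) (G s u v); quat_ring.
    - rewrite H; generalize (G s u v); quat_ring. }
  destruct (Hlin _ _ Ed) as [Hb _]; apply dot3_self_eq0 in Hb.
  destruct (Hlin 0 1) as [_ H]; [|lra].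
  rewrite Hb; generalize (al s u v); r3_ring.
Qed.

Lemma willmore_integrand (s u v : R) : Rabs s < e -> 0 <= u <= L -> 0 < gramian s u v ->
  ((mean_curvature (G s) u v) ^ 2 + 1) * area_density (G s) u v
  = density (shape s u v) (gramian s u v).
Proof.
  intros Hs Hu Hpos; apply willmore_density.
  - now apply HS.
  - now apply q2_eq.
  - now apply q3_eq.
  - symmetry; apply V2_al.
  - rewrite V3_al; structure_equation s u v; fold (al s u v) (be s u v).
    change (dv (du (G s)) u v) with (q3 (q2 G) s u v).
    generalize (al s u v) (be s u v) (rlog (G s u v) (q3 (q2 G) s u v)); r3_ring.
  - symmetry; apply V3_be.
  - exact Hpos.
Qed.

Lemma hopf_al (X : R -> R3) (s u v : R) : Rabs s < e -> 0 < u < L ->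
  (forall y, 0 < y < L -> hopfv (G s y v) = X y) ->
  scal3 2 (cross3 (al s u v) (X u)) = Derive3 X u.
Proof.
  intros Hs Hu HX; symmetry; apply is_derive3_unique.
  apply is_derive3_ext_loc with (fun y => hopfv (G s y v)).
  - now apply (locally_open_interval 0 L u _ Hu).
  - rewrite <- HX, <- dhopfv_mulq, <- q2_eq by (assumption || lra).
    now apply (is_derive3_hopfv (fun y => G s y v) u), is_deriveq_q2.
Qed.

Lemma hopf_be (x : R3) (s u v : R) : Rabs s < e -> 0 <= u <= L ->
  (forall w, hopfv (G s u w) = x) -> cross3 (be s u v) x = zero3.
Proof.
  intros Hs Hu Hx.
  assert (E : zero3 = scal3 2 (cross3 (be s u v) x)).
  { rewrite <- (is_derive3_unique _ _ _ (is_derive3_const x v)).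
    apply is_derive3_unique, is_derive3_ext_loc with (fun w => hopfv (G s u w)).
    - now apply filter_forall.
    - rewrite <- (Hx v), <- dhopfv_mulq, <- q3_eq by assumption.
      now apply (is_derive3_hopfv (fun w => G s u w) v), is_deriveq_q3. }
  transitivity (scal3 (/ 2) (scal3 2 (cross3 (be s u v) x))).
  - rewrite scal3_scal3; replace (/ 2 * 2) with 1 by lra; now rewrite scal3_one.
  - rewrite <- E; r3_ring.
Qed.

End Family.

(** * Differentiating the Willmore energy under the integral *)

Lemma continuous_Rplus {U : UniformSpace} (f g : U -> R) (x : U) :
  continuous f x -> continuous g x -> continuous (fun y => f y + g y) x.
Proof. exact (continuous_plus (V := R_NormedModule) f g x). Qed.

Lemma continuous_Ropp {U : UniformSpace} (f : U -> R) (x : U) :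
  continuous f x -> continuous (fun y => - f y) x.
Proof. exact (continuous_opp (V := R_NormedModule) f x). Qed.

Lemma continuous_Rmult {U : UniformSpace} (f g : U -> R) (x : U) :
  continuous f x -> continuous g x -> continuous (fun y => f y * g y) x.
Proof. exact (continuous_mult (K := R_AbsRing) f g x). Qed.

Lemma continuous_Rpow {U : UniformSpace} (f : U -> R) (n : nat) (x : U) :
  continuous f x -> continuous (fun y => f y ^ n) x.
Proof.
  intro H; induction n as [|n IH]; [apply continuous_const|].
  now apply (continuous_Rmult f (fun y => f y ^ n)).
Qed.

Lemma continuous_Rinv_fun {U : UniformSpace} (f : U -> R) (x : U) :
  continuous f x -> f x <> 0 -> continuous (fun y => / f y) x.
Proof.
  intros H Hx; apply (continuous_comp f Rinv); [exact H|].
  apply (ex_derive_continuous (V := R_NormedModule) Rinv (f x)).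
  auto_derive; exact Hx.
Qed.

Ltac continuous_alg :=
  lazymatch goal with
  | |- continuous (fun y => _ + _) _ => apply continuous_Rplus; continuous_alg
  | |- continuous (fun y => - _) _ => apply continuous_Ropp; continuous_alg
  | |- continuous (fun y => _ * _) _ => apply continuous_Rmult; continuous_alg
  | |- continuous (fun y => _ ^ _) _ => apply continuous_Rpow; continuous_alg
  | |- continuous (fun y => / _) _ => apply continuous_Rinv_fun; [continuous_alg|]
  | |- _ => first [assumption | apply continuous_const]
  end.

Lemma continuous_density {U : UniformSpace} (m q : U -> R) (x : U) :
  continuous m x -> continuous q x -> 0 < q x ->
  continuous (fun y => density (m y) (q y)) x.
Proof.
  intros Hm Hq Hpos.
  assert (Hs : continuous (fun y => sqrt (q y)) x)
    by (apply (continuous_comp q sqrt); [exact Hq|apply continuous_sqrt]).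
  pose proof (pow_lt _ 3 Hpos).
  unfold density, Rdiv; continuous_alg; lra.
Qed.

Lemma continuous_ddensity {U : UniformSpace} (m q dm dq : U -> R) (x : U) :
  continuous m x -> continuous q x -> continuous dm x -> continuous dq x -> 0 < q x ->
  continuous (fun y => ddensity (m y) (q y) (dm y) (dq y)) x.
Proof.
  intros Hm Hq Hdm Hdq Hpos.
  assert (Hs : continuous (fun y => sqrt (q y)) x)
    by (apply (continuous_comp q sqrt); [exact Hq|apply continuous_sqrt]).
  pose proof (pow_lt _ 3 Hpos); pose proof (pow_lt _ 4 Hpos).
  pose proof (sqrt_lt_R0 _ Hpos).
  unfold ddensity, Rdiv, Rminus; continuous_alg; lra.
Qed.

(** [h] must be continuous everywhere to differentiate under both integrals, whereas its formula is
    needed only at s = 0 over interior u, where the clamps act as the identity. *)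
Lemma willmore_energy_derive (G : R -> R -> R -> quat) (e L : R) :
  0 < e -> 0 < L -> smoothq G ->
  (forall s u v, Rabs s < e -> 0 <= u <= L -> dotq (G s u v) (G s u v) = 1) ->
  (forall s u v, Rabs s < e -> 0 <= u <= L -> 0 < gramian G s u v) ->
  exists h, C3 h /\
    (forall u v, 0 < u < L ->
       h 0 u v = ddensity (shape G 0 u v) (gramian G 0 u v)
                   (D1 (shape G) 0 u v) (D1 (gramian G) 0 u v)) /\
    is_derive (fun s => willmore_energy L (G s)) 0
      (RInt (fun u => RInt (fun v => h 0 u v) 0 (2 * PI)) 0 L).
Proof.
  intros He HL HG HS Hpos.
  pose proof (shape_smooth G HG) as Hsh; pose proof (gramian_smooth G HG) as Hgr.
  (* outside the domain where [gramian G] is positive the integrand is cut off by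
     clamping its arguments *)
  set (cs := clamp (- (e / 2)) (e / 2)); set (cu := clamp 0 L).
  assert (Hcs : forall s, Rabs (cs s) < e).
  { intro s; pose proof (clamp_in (- (e / 2)) (e / 2) s ltac:(lra)).
    apply Rabs_def1; unfold cs; lra. }
  assert (Hcu : forall u, 0 <= cu u <= L) by (intro; apply clamp_in; lra).
  assert (Hcsi : forall s, Rabs s < e / 2 -> cs s = s).
  { intros s Hs; apply Rabs_def2 in Hs; apply clamp_id; lra. }
  assert (Hcl : forall f, smooth3 f -> forall p : R * R * R,
    continuous (fun q : R * R * R => f (cs (fst (fst q))) (cu (snd (fst q))) (snd q)) p).
  { intros f Hf p.
    apply (C3_slice f (fun q : R * R * R => cs (fst (fst q)))
             (fun q : R * R * R => cu (snd (fst q))) (fun q : R * R * R => snd q));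
      [now apply smooth3_C3| | |apply continuous_snd].
    - apply (continuous_comp (fun q : R * R * R => fst (fst q)) cs);
        [|apply continuous_clamp; lra].
      apply (continuous_comp (fun q : R * R * R => fst q) fst);
        apply continuous_fst.
    - apply (continuous_comp (fun q : R * R * R => snd (fst q)) cu);
        [|apply continuous_clamp; lra].
      apply (continuous_comp (fun q : R * R * R => fst q) snd);
        [apply continuous_fst|apply continuous_snd]. }
  set (f := fun s u v => density (shape G (cs s) (cu u) v) (gramian G (cs s) (cu u) v)).
  set (h := fun s u v => ddensity (shape G (cs s) (cu u) v) (gramian G (cs s) (cu u) v)
    (D1 (shape G) (cs s) (cu u) v) (D1 (gramian G) (cs s) (cu u) v)).
  assert (Hh : C3 h).
  { intro p; apply (continuous_ddensity
      (fun q : R * R * R => shape G (cs (fst (fst q))) (cu (snd (fst q))) (snd q))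
      (fun q : R * R * R => gramian G (cs (fst (fst q))) (cu (snd (fst q))) (snd q))
      (fun q : R * R * R => D1 (shape G) (cs (fst (fst q))) (cu (snd (fst q))) (snd q))
      (fun q : R * R * R => D1 (gramian G) (cs (fst (fst q))) (cu (snd (fst q))) (snd q)));
      auto using smooth3_D1. }
  assert (Hf : C3 f).
  { intro p; apply (continuous_density
      (fun q : R * R * R => shape G (cs (fst (fst q))) (cu (snd (fst q))) (snd q))
      (fun q : R * R * R => gramian G (cs (fst (fst q))) (cu (snd (fst q))) (snd q)));
      auto. }
  exists h; split; [exact Hh|split].
  - intros u v Hu; unfold h; rewrite (Hcsi 0) by (rewrite Rabs_R0; lra).
    now unfold cu; rewrite clamp_id by lra.
  - apply is_derive_ext_loc with
      (fun s => RInt (fun u => RInt (fun v => f s u v) 0 (2 * PI)) 0 L).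
    + assert (He2 : 0 < e / 2) by lra.
      exists (mkposreal _ He2); intros s Hs.
      change (Rabs (s - 0) < e / 2) in Hs; rewrite Rminus_0_r in Hs.
      apply RInt_ext; intros u Hu; rewrite Rmin_left, Rmax_right in Hu by lra.
      apply RInt_ext; intros v _; symmetry.
      unfold f; rewrite (Hcsi s Hs); unfold cu; rewrite clamp_id by lra.
      apply (willmore_integrand G e L HG HL HS); [lra|lra|apply Hpos; lra].
    + pose proof PI_RGT_0.
      apply (is_derive_RInt2 f h 0 (2 * PI) 0 L (e / 2)); auto; try lra.
      intros s u v Hs; unfold h; rewrite (Hcsi s Hs).
      apply is_derive_ext_loc with
        (fun x => density (shape G x (cu u) v) (gramian G x (cu u) v)).
      * generalize (locally_Rabs_lt _ _ Hs); apply filter_imp; intros x Hx.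
        unfold f; now rewrite Hcsi.
      * apply (is_derive_density (fun x => shape G x (cu u) v)
                 (fun x => gramian G x (cu u) v));
          [now apply is_derive_D1|now apply is_derive_D1|apply Hpos; auto; lra].
Qed.

(** * From [smooth] to smooth coordinate functions *)

Lemma is_linear_fst_snd :
  is_linear (fun q : R * R * R => fst (fst q)) /\
  is_linear (fun q : R * R * R => snd (fst q)).
Proof.
  split; [apply (is_linear_comp fst fst)|apply (is_linear_comp fst snd)];
    first [apply is_linear_fst|apply is_linear_snd].
Qed.

Lemma smooth3v_of_smooth (A : R -> R -> R -> R3) :
  smooth (fun p : R * R * R => A (fst (fst p)) (snd (fst p)) (snd p)) -> smooth3v A.
Proof.
  intro H; destruct is_linear_fst_snd as [H1 H2]; split; [|split].
  - exact (smooth_comp_linear (fun q : R * R * R => fst (fst q)) _ H1 H).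
  - exact (smooth_comp_linear (fun q : R * R * R => snd (fst q)) _ H2 H).
  - exact (smooth_comp_linear (fun q : R * R * R => snd q) _ is_linear_snd H).
Qed.

Lemma smoothq_of_smooth (G : R -> R -> R -> quat) :
  smooth (fun p : R * R * R => G (fst (fst p)) (snd (fst p)) (snd p)) -> smoothq G.
Proof.
  intro H; split.
  - exact (smooth_comp_linear (fun q : R * (R * R * R) => fst q) _ is_linear_fst H).
  - apply smooth3v_of_smooth.
    exact (smooth_comp_linear (fun q : R * (R * R * R) => snd q) _ is_linear_snd H).
Qed.

Lemma smooth13_of_smooth (g : R -> R3) : smooth g -> smooth13 g.
Proof.
  intro H; apply (smooth3v_of_smooth (fun _ u _ => g u)).
  exact (smooth_precomp_linear (fun q : R * R * R => snd (fst q)) g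
           (proj2 is_linear_fst_snd) H).
Qed.

Lemma smoothq_of_smooth2 (F : R -> R -> quat) :
  smooth (fun p : R * R => F (fst p) (snd p)) -> smoothq (fun _ u v => F u v).
Proof.
  intro H; apply smoothq_of_smooth.
  apply (smooth_precomp_linear (fun q : R * R * R => (snd (fst q), snd q))
           (fun p : R * R => F (fst p) (snd p))); [|exact H].
  apply is_linear_prod; [apply is_linear_fst_snd|apply is_linear_snd].
Qed.

Lemma smoothq_of_smooth2_slice (F : R -> R -> quat) :
  smooth (fun p : R * R => F (fst p) (snd p)) -> smoothq (fun _ u _ => F u 0).
Proof.
  intro H; apply smoothq_of_smooth.
  apply (smooth_precomp_linear (fun q : R * R * R => (snd (fst q), zero))
           (fun p : R * R => F (fst p) (snd p))); [|exact H].
  apply is_linear_prod; [apply is_linear_fst_snd|apply is_linear_zero].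
Qed.

Lemma Deriveq_periodic (f : R -> quat) (k x : R) (l : quat) :
  is_deriveq f (x + k) l -> (forall y, f (y + k) = f y) ->
  Deriveq f (x + k) = Deriveq f x.
Proof.
  intros [H0 (H1 & H2 & H3)] Hk; unfold Deriveq, Derive3.
  repeat (apply injective_projections; cbn [fst snd]).
  - apply (Derive_periodic (fun y => fst (f y))); [eexists; exact H0|intro; now rewrite Hk].
  - apply (Derive_periodic (fun y => fst (fst (snd (f y)))));
      [eexists; exact H1|intro; now rewrite Hk].
  - apply (Derive_periodic (fun y => snd (fst (snd (f y)))));
      [eexists; exact H2|intro; now rewrite Hk].
  - apply (Derive_periodic (fun y => snd (snd (f y))));
      [eexists; exact H3|intro; now rewrite Hk].
Qed.

(** * The frame cylinder is immersed and Willmore *)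

Section FrameCylinder.

Context (L : R) (X : R -> R3) (F : R -> R -> quat).
Context (HL : 0 < L) (HX : smooth13 X).
Context (Hon : forall u, 0 < u < L -> orthonormal (X u) (Derive3 X u)).
Context (HFs : smooth (fun p : R * R => F (fst p) (snd p))).
Context (HF1 : forall u v, 0 <= u <= L -> dotq (F u v) (F u v) = 1).
Context (HFX : forall u v, 0 <= u <= L -> hopfv (F u v) = X u).
Context (HFp : forall u v, 0 <= u <= L -> F u (v + 2 * PI) = F u v).
Context (HFv : forall u v, 0 <= u <= L -> dv F u v <> zeroq).

(** A relation k al + m be = 0, crossed with X, loses its second term because be × X = 0. The first
    has length |k| / 2, so k = 0; then m = 0 by regularity of the fibre parametrization. *)
Lemma frame_cylinder_immersed : immersed_cylinder L F.
Proof.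
  split; [exact HFs|].
  (* The constant family makes the lemmas on families available; the bound 1 on s is arbitrary. *)
  set (Fh := fun _ : R => F).
  pose proof (smoothq_of_smooth2 F HFs) as HS; fold Fh in HS.
  assert (H1 : forall s u v, Rabs s < 1 -> 0 <= u <= L -> dotq (Fh s u v) (Fh s u v) = 1)
    by (intros; now apply HF1).
  assert (H0 : Rabs 0 < 1) by (rewrite Rabs_R0; lra).
  (* From 2 al × X = X' with X' a unit vector. Both facts are available only over interior u, so the
     value is carried to the ends by continuity. *)
  assert (Hquarter : forall u v, 0 <= u <= L -> gram3 (al Fh 0 u v) (X u) = / 4).
  { intros u v Hu.
    apply (continuous_eq_closed (fun y => gram3 (al Fh 0 y v) (X y)) 0 L (/ 4) HL);
      [| |exact Hu].
    - intro y; pose proof (smooth3v_cross3 _ _ (al_smooth Fh HS) (lift_smooth13 X HX)) as Hc.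
      exact (C3_section2 _ 0 v y (smooth3_C3 _ (smooth3_dot3 _ _ Hc Hc))).
    - intros y Hy.
      pose proof (hopf_al Fh 1 L HS HL H1 X 0 y v H0 Hy
        (fun z Hz => HFX z v ltac:(lra))) as E.
      destruct (Hon y Hy) as (_ & Hn & _); rewrite <- E in Hn.
      unfold gram3; revert Hn; generalize (cross3 (al Fh 0 y v) (X y)); intros w Hw.
      replace (dot3 (scal3 2 w) (scal3 2 w)) with (4 * dot3 w w) in Hw by r3_ring; lra. }
  intros u v Hu; split; [now apply HF1|split; [now apply HFp|]].
  intros k m E.
  pose proof (q2_eq Fh 1 L HS HL H1 0 u v H0 Hu) as E2.
  pose proof (q3_eq Fh 1 L HS H1 0 u v H0 Hu) as E3.
  pose proof (hopf_be Fh 1 L HS H1 (X u) 0 u v H0 Hu (fun w => HFX u w Hu)) as Hb.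
  change (q2 Fh 0 u v) with (du F u v) in E2; change (q3 Fh 0 u v) with (dv F u v) in E3.
  change (Fh 0 u v) with (F u v) in E2, E3.
  assert (Ez : add3 (scal3 k (al Fh 0 u v)) (scal3 m (be Fh 0 u v)) = zero3).
  { rewrite <- (scal3_one (add3 _ _)), <- (HF1 u v Hu), <- rlog_mulq.
    transitivity (rlog (F u v) zeroq); [|apply rlog_zero].
    f_equal; rewrite <- E, E2, E3.
    generalize (al Fh 0 u v) (be Fh 0 u v) (F u v); quat_ring. }
  assert (Hk : k = 0).
  { assert (E4 : scal3 k (cross3 (al Fh 0 u v) (X u)) = zero3).
    { transitivity (cross3 (add3 (scal3 k (al Fh 0 u v)) (scal3 m (be Fh 0 u v))) (X u)).
      - transitivity (add3 (scal3 k (cross3 (al Fh 0 u v) (X u)))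
                        (scal3 m (cross3 (be Fh 0 u v) (X u)))).
        + rewrite Hb; generalize (cross3 (al Fh 0 u v) (X u)); r3_ring.
        + generalize (al Fh 0 u v) (be Fh 0 u v) (X u); r3_ring.
      - rewrite Ez; generalize (X u); r3_ring. }
    assert (E5 : k * k * gram3 (al Fh 0 u v) (X u) = 0).
    { transitivity (dot3 (scal3 k (cross3 (al Fh 0 u v) (X u)))
                      (scal3 k (cross3 (al Fh 0 u v) (X u)))).
      - unfold gram3; generalize (cross3 (al Fh 0 u v) (X u)); r3_ring.
      - rewrite E4; r3_ring. }
    rewrite Hquarter in E5 by exact Hu; nra. }
  split; [exact Hk|].
  apply NNPP; intro Hm; apply (HFv u v Hu); rewrite E3.
  assert (Hbe0 : be Fh 0 u v = zero3).
  { rewrite Hk in Ez.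
    transitivity (scal3 (/ m) (add3 (scal3 0 (al Fh 0 u v)) (scal3 m (be Fh 0 u v)))).
    - transitivity (scal3 (/ m * m) (be Fh 0 u v)).
      + rewrite Rinv_l by exact Hm; now rewrite scal3_one.
      + generalize (al Fh 0 u v) (be Fh 0 u v); r3_ring.
    - rewrite Ez; r3_ring. }
  rewrite Hbe0; generalize (F u v); quat_ring.
Qed.

Let lam (x : R) : R := dot3 (Derive3 (Derive3 X) x) (cross3 (X x) (Derive3 X x)).

Lemma frame_cylinder_willmore :
  (forall u, 0 < u < L -> Derive (Derive lam) u = - (lam u * (1 + lam u ^ 2) / 2)) ->
  willmore_cylinder L F.
Proof.
  intro Hode; split; [exact frame_cylinder_immersed|].
  intros G (HGs & HG0 & eps & delta & He & Hd & Hvar).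
  pose proof (smoothq_of_smooth G HGs) as HG.
  assert (HS : forall s u v, Rabs s < eps -> 0 <= u <= L -> dotq (G s u v) (G s u v) = 1)
    by (intros s u v Hs Hu; apply (proj1 (Hvar s Hs) u v Hu)).
  assert (Hpos : forall s u v, Rabs s < eps -> 0 <= u <= L -> 0 < gramian G s u v).
  { intros s u v Hs Hu; apply (gramian_pos G eps L HG HL HS s u v Hs Hu).
    apply (proj1 (Hvar s Hs) u v Hu). }
  assert (H0 : Rabs 0 < eps) by now rewrite Rabs_R0.
  destruct (willmore_energy_derive G eps L He HL HG HS Hpos) as (h & Hh & Eh & Hder).
  (* Leaves the vanishing of this integral, which is the content of [first_variation_zero]. *)
  replace 0 with (RInt (fun u => RInt (fun v => h 0 u v) 0 (2 * PI)) 0 L) at 2;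
    [exact Hder|].
  assert (Hq1 : forall u v y, 0 < u < L -> (forall s, Rabs s < eps -> G s u y = G s u v) ->
    q1 G 0 u y = q1 G 0 u v).
  { intros u v y Hu E; apply Deriveq_ext_loc.
    generalize (locally_Rabs_lt _ _ H0); apply filter_imp; exact E. }
  assert (Hper : forall s u v, Rabs s < eps -> 0 <= u <= L -> G s u (v + 2 * PI) = G s u v)
    by (intros s u v Hs Hu; apply (proj1 (Hvar s Hs) u v Hu)).
  apply (first_variation_zero L (al G) (be G) (xi G) X) with (delta := delta); auto.
  - now apply al_smooth.
  - now apply be_smooth.
  - now apply xi_smooth.
  - intros u v Hu; apply (compat_al_be G eps L HG HL HS); lra.
  - intros u v Hu; apply (compat_al_xi G eps L HG HL HS); lra.
  - intros u v Hu; apply (compat_be_xi G eps L HG HL HS); lra.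
  - intros u v Hu; apply (hopf_al G eps L HG HL HS X 0 u v H0 Hu).
    intros y Hy; rewrite HG0 by lra; apply HFX; lra.
  - intros u v Hu; apply (hopf_be G eps L HG HS (X u) 0 u v H0); [lra|].
    intro w; rewrite HG0 by lra; apply HFX; lra.
  - intros u v Hu E; apply (HFv u v ltac:(lra)).
    transitivity (q3 G 0 u v).
    (* At s = 0 the family equals [F] for all v at fixed u in [0, L], so the v-derivatives agree. *)
    + apply Deriveq_ext_loc, filter_forall; intro w; symmetry; apply HG0; lra.
    + rewrite (q3_eq G eps L HG HS) by (assumption || lra); rewrite E.
      generalize (G 0 u v); quat_ring.
  - intros u v Hu; unfold al; rewrite Hper by (assumption || lra); f_equal.
    apply Deriveq_ext_loc, (locally_open_interval 0 L u _ Hu).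
    intros y Hy; apply Hper; [assumption|lra].
  - intros u v Hu; unfold be; rewrite Hper by (assumption || lra); f_equal.
    apply (Deriveq_periodic (fun w => G 0 u w) _ _ (q3 G 0 u (v + 2 * PI)));
      [now apply is_deriveq_q3|].
    intro y; apply Hper; [assumption|lra].
  - intros u v Hu; unfold xi; rewrite Hper by (assumption || lra); f_equal.
    apply Hq1; [exact Hu|]; intros s Hs; apply Hper; [assumption|lra].
  - intros u v Hu Hud; unfold xi.
    replace (q1 G 0 u v) with zeroq; [apply rlog_zero|].
    symmetry; transitivity (Deriveq (fun _ => F u v) 0); [|apply Deriveq_const].
    apply Deriveq_ext_loc; generalize (locally_Rabs_lt _ _ H0); apply filter_imp.
    intros s Hs; apply (proj2 (Hvar s Hs)); [lra|exact Hud].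
Qed.

End FrameCylinder.

Theorem mainTheorem6 :
  forall (mu L : R) (gamma : R -> R3) (Lt : R) (T : R -> R3) (F : R -> R -> quat),
    0 < L ->
    force_free_strip mu L gamma ->
    arclength_tangent_image L gamma Lt T ->
    frame_cylinder Lt T F ->
    willmore_cylinder Lt F.
Proof.
  intros mu L gamma Lt T F HL [[[Hg Hfr] _] Hforce] HT [HFs HF].
  apply smooth13_of_smooth in Hg.
  (* [F u 0] lies in the fibre over [T u], so its Hopf image is a smooth curve on the line extending
     [T]. *)
  set (X := fun u => hopfv (F u 0)).
  assert (HX : smooth13 X)
    by exact (smooth3v_hopfv (fun _ u _ => F u 0) (smoothq_of_smooth2_slice F HFs)).
  assert (Hfib : forall u v, 0 <= u <= Lt ->
    dotq (F u v) (F u v) = 1 /\ hopfv (F u v) = T u).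
  { intros u v Hu; destruct (HF u Hu) as (_ & _ & Hq).
    destruct (proj1 (Hq (F u v)) (ex_intro _ v eq_refl)) as [H1 H2].
    split; [exact H1|]; unfold hopfv; now rewrite H2. }
  assert (HXT : forall x, 0 <= x <= Lt -> X x = T x) by (intros; now apply Hfib).
  pose proof (arclength_pos L gamma Lt T HL Hg Hfr HT) as HLt.
  apply (frame_cylinder_willmore Lt X F HLt HX).
  - intros u Hu; now apply (X_orthonormal L gamma Lt T X HL Hg Hfr HT HX HXT).
  - exact HFs.
  - intros u v Hu; now apply Hfib.
  - intros u v Hu; rewrite HXT by exact Hu; now apply Hfib.
  - intros u v Hu; now apply HF.
  - intros u v Hu; now apply HF.
  - exact (elastic_equation mu L gamma Lt T X HL Hg Hfr Hforce HT HX HXT).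
Qed.
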